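(* Let $K\ge 1$, $k=(K-1)/(K+1)$, and let $m,p,q\ge 1$ be integers. Let $R_{m,q}\in(0,1)$ be the unique root in $(0,1)$ of the equation $r^{2m}+2r^q-1=0$, and let $r_{m,p,q,k}\in(0,1)$ be the smallest positive root of the equation $$\frac{2r^q}{1+r^m}+\frac{2(k+r^p)(1+r^m)r^p}{1-r^p}-(1-r^m)=0 .$$ Let $f(z)=h(z)+\overline{g(z)}=\sum_{n=0}^\infty a_n z^n+\overline{\sum_{n=1}^\infty b_n z^n}$ be a sense-preserving $K$-quasiconformal harmonic mapping in $\mathbb{D}$ with $\Vert h\Vert_\infty\le 1$, and let $(\omega_j)_{j\ge 1}$ be functions with $\omega_j\in\mathcal{B}_j$ for each $j\ge1$. Then $r_{m,p,q,k}\le R_{m,q}$ and $$|h(\omega_m(z))|+|h'(\omega_m(z))|\,|\omega_q(z)|+\sum_{n=2}^\infty |a_n|\,|\omega_p(z)|^n+\sum_{n=1}^\infty |b_n|\,|\omega_p(z)|^n\le 1\qquad\text{for } |z|=r\le r_{m,p,q,k}.$$ Moreover, the radius $r_{m,p,q,k}$ cannot be improved: for every $R$ with $r_{m,p,q,k}<R<1$ there exist a sense-preserving $K$-quasiconformal harmonic mapping $f(z)=h(z)+\overline{g(z)}=\sum_{n=0}^\infty a_n z^n+\overline{\sum_{n=1}^\infty b_n z^n}$ in $\mathbb{D}$ with $\Vert h\Vert_\infty\le 1$, functions $(\omega_j)_{j\ge1}$ with $\omega_j\in\mathcal{B}_j$ for each $j\ge1$ (for the same $K,m,p,q$), and a point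 $z$ with $|z|\le R$ for which the displayed inequality $|h(\omega_m(z))|+|h'(\omega_m(z))|\,|\omega_q(z)|+\sum_{n=2}^\infty |a_n|\,|\omega_p(z)|^n+\sum_{n=1}^\infty |b_n|\,|\omega_p(z)|^n\le 1$ fails.
   Context: $\mathbb{D}=\{z\in\mathbb{C}:|z|<1\}$. For an analytic function $h$ in $\mathbb{D}$, $\Vert h\Vert_\infty=\sup_{z\in\mathbb{D}}|h(z)|$. $\mathcal{B}$ is the set of analytic functions $\omega$ in $\mathbb{D}$ with $\Vert\omega\Vert_\infty\le 1$, and for an integer $j\ge1$, $$\mathcal{B}_j=\{\omega\in\mathcal{B}:\ \omega(0)=\omega'(0)=\cdots=\omega^{(j-1)}(0)=0,\ \omega^{(j)}(0)\ne 0\}.$$ A harmonic mapping in $\mathbb{D}$ is written $f=h+\overline{g}$ with $h,g$ analytic in $\mathbb{D}$. It is locally univalent and sense-preserving if $|h'(z)|^2-|g'(z)|^2>0$ for all $z\in\mathbb{D}$ (in particular $h'\neq0$ in $\mathbb{D}$). For $K\ge1$ and $k=(K-1)/(K+1)\in[0,1)$, a locally univalent sense-preserving harmonic mapping $f=h+\overline g$ is called a sense-preserving $K$-quasiconformal harmonic mapping in $\mathbb{D}$ if $|g'(z)/h'(z)|\le k$ for all $z\in\mathbb{D}$. *)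

(* Defs.v *)
From Stdlib Require Import Reals.
From Coquelicot Require Import Coquelicot.
Open Scope R_scope.

Definition unit_disk (z : C) : Prop := Cmod z < 1.

(* Functions on the disk are total functions [C -> C]; their values outside the
   disk are irrelevant. *)
Definition analytic_on_disk (f : C -> C) : Prop :=
  forall z0 : C, unit_disk z0 ->
    exists (c : nat -> C) (d : R), 0 < d /\
      forall z : C, Cmod (z - z0) < d ->
        is_pseries (K := C_AbsRing) (V := C_NormedModule) c (z - z0)%C (f z).

Definition sup_norm (f : C -> C) : Rbar :=
  Lub_Rbar (fun x : R => exists z : C, unit_disk z /\ x = Cmod (f z)).

(* [C_derive f z] is the complex derivative only where [f] is complex
   differentiable; below it is applied only to functions analytic in the disk,
   at points of the disk. *)
Fixpoint C_derive_n (f : C -> C) (n : nat) (z : C) : C :=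
  match n with
  | O => f z
  | S n => C_derive (fun w => C_derive_n f n w) z
  end.

Definition class_B (w : C -> C) : Prop :=
  analytic_on_disk w /\ Rbar_le (sup_norm w) 1.

Definition class_Bj (j : nat) (w : C -> C) : Prop :=
  class_B w /\
  (forall i : nat, (i < j)%nat -> C_derive_n w i (RtoC 0) = RtoC 0) /\
  C_derive_n w j (RtoC 0) <> RtoC 0.

Definition harmonic_decomp (f h g : C -> C) : Prop :=
  analytic_on_disk h /\ analytic_on_disk g /\
  forall z : C, unit_disk z -> f z = (h z + Cconj (g z))%C.

Definition sense_preserving_loc_univalent (h g : C -> C) : Prop :=
  forall z : C, unit_disk z ->
    Cmod (C_derive h z) ^ 2 - Cmod (C_derive g z) ^ 2 > 0.

Definition dilatation_bound (K : R) : R := (K - 1) / (K + 1).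

Definition quasiconformal_harmonic (K : R) (f h g : C -> C) : Prop :=
  harmonic_decomp f h g /\
  sense_preserving_loc_univalent h g /\
  forall z : C, unit_disk z ->
    Cmod (C_derive g z / C_derive h z) <= dilatation_bound K.

(* The expansion of [g] starts at [n = 1], hence [b 0 = 0]. *)
Definition disk_expansion (h g : C -> C) (a b : nat -> C) : Prop :=
  b 0%nat = RtoC 0 /\
  forall z : C, unit_disk z ->
    is_pseries (K := C_AbsRing) (V := C_NormedModule) a z (h z) /\
    is_pseries (K := C_AbsRing) (V := C_NormedModule) b z (g z).

(* Extended-real sum of [u n] over [n >= n0], used for nonnegative [u] only;
   a divergent such series has sum [p_infty]. *)
Definition sum_from (n0 : nat) (u : nat -> R) : Rbar :=
  Lim_seq (fun N => sum_n_m u n0 N).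

Definition bohr_sum (h : C -> C) (a b : nat -> C) (w : nat -> C -> C)
    (m p q : nat) (z : C) : Rbar :=
  Rbar_plus
    (Rbar_plus
      (Finite (Cmod (h (w m z)) + Cmod (C_derive h (w m z)) * Cmod (w q z)))
      (sum_from 2 (fun n => Cmod (a n) * Cmod (w p z) ^ n)))
    (sum_from 1 (fun n => Cmod (b n) * Cmod (w p z) ^ n)).

Definition eqn_R (m q : nat) (r : R) : Prop :=
  r ^ (2 * m) + 2 * r ^ q - 1 = 0.

Definition eqn_r (m p q : nat) (k r : R) : Prop :=
  2 * r ^ q / (1 + r ^ m)
  + 2 * (k + r ^ p) * (1 + r ^ m) * r ^ p / (1 - r ^ p)
  - (1 - r ^ m) = 0.

(* The points of [(0,1)] exclude [s = 1], where the left-hand side of [eqn_r]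
   is undefined; a positive root outside [(0,1)] could not be smaller. *)
Definition smallest_positive_root (E : R -> Prop) (r : R) : Prop :=
  0 < r < 1 /\ E r /\ forall s : R, 0 < s < 1 -> E s -> r <= s.

(* Main.v *)
Require Import Defs.
From Stdlib Require Import Reals Lra Lia Classical IndefiniteDescription Wf_nat.
From Coquelicot Require Import Coquelicot.
Open Scope R_scope.

(** The Bohr sum is estimated term by term, with [A = |a 0|] and [r = |z|].

    Schwarz's lemma gives [|w j z| <= r^j].  Schwarz-Pick's lemma bounds [|h|] at
    [w m z] by [(A + r^m) / (1 + A r^m)] and [|h'|] there by
    [(1 - |h|^2) / (1 - |w m z|^2)].  As long as [r^(2m) + 2 r^q <= 1] the function
    [X + lam (1 - X^2)] with [lam = r^q / (1 - r^(2m))] increases on [0,1], so the two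
    bounds may be inserted together.  The Taylor coefficients of a function bounded by 1
    satisfy [|a n| <= 1 - A^2] for [n >= 1].  The dilatation bound [|g'| <= k |h'|] gives,
    by Parseval's formula and two integrations, that the sum of [|b n|^2 x^n] is at most
    [k^2] times that of [|a n|^2 x^n] over [n >= 1], and then that the sum of [|b n| x^n]
    is at most [k (1 - A^2) x / (1 - x)].  One minus the sum of all these bounds is [1 - A]
    times a bracket which is nonnegative as soon as it is so at [A = 1], and there it is the
    negative of the equation of the radius, up to a positive factor
    ([first_terms_le], [majorant_le_1], [bohr_inequality]).

    Multiplied by [1 + r^m], the left-hand side of that equation becomes an increasing
    function of [r] ([radius_fun]).  So its root in (0,1) is unique, the function is
    positive to the right of it, and at the root [r^(2m) + 2 r^q <= 1].

    Sharpness comes from the disk automorphisms [h z = (a + z) / (1 + a z)] with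
    [g = k (h - a)] and [w j z = z^j], for which every estimate is exact to first order in
    [1 - a]: at a point [r] beyond the root the excess of the Bohr sum over 1 is [1 - a] times
    a quantity with a positive limit ([bohr_radius_sharp]).

    Schwarz's and Schwarz-Pick's lemmas follow from a maximum principle for local quotients
    of analytic functions ([max_principle]).  It rests on two facts: a nonzero power series
    without constant term takes values of every direction near its centre, and a continuous function
    attains its maximum on a closed disk.  Parseval's formula ([parseval_mean]) is obtained
    from finite means over roots of unity, and it also yields the coefficient bound: the
    product of [h] by [x + y z^n] has a square mean at most that of [x + y z^n]. *)

(** * Complex power series *)

Notation is_Cpseries c z l :=
  (is_pseries (K := C_AbsRing) (V := C_NormedModule) c z l).
Notation is_Cseries u l :=
  (is_series (K := C_AbsRing) (V := C_NormedModule) u l).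

(** The type of a [sum_n] is the carrier of a structure; [ring] needs to see [C] or [R]. *)
Ltac Cring := match goal with |- @eq _ ?a ?b => change (@eq C a b) end; ring.

Ltac Rring := match goal with |- @eq _ ?a ?b => change (@eq R a b) end; ring.

Lemma pow_n_Cpow : forall (z : C) (n : nat), pow_n (K := C_Ring) z n = (z ^ n)%C.
Proof.
  intros z n; induction n as [|n IH]; [reflexivity|].
  rewrite Cpow_S, <- IH. reflexivity.
Qed.

Lemma is_Cpseries_series : forall (c : nat -> C) (z l : C),
  is_Cpseries c z l <-> is_Cseries (fun n => (c n * z ^ n)%C) l.
Proof.
  intros c z l; split; apply is_series_ext; intro n;
    rewrite <- pow_n_Cpow; change scal with Cmult; apply Cmult_comm.
Qed.

Lemma is_Cseries_eps : forall (u : nat -> C) (l : C),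
  is_Cseries u l <->
  (forall eps, 0 < eps -> exists N, forall n, (N <= n)%nat -> Cmod (sum_n u n - l)%C < eps).
Proof.
  intros u l; split.
  - intros H eps He.
    destruct (proj1 (filterlim_locally_ball_norm _ _) H (mkposreal eps He)) as [N HN].
    exists N; intros n Hn; exact (HN n Hn).
  - intros H. apply (proj2 (filterlim_locally_ball_norm _ _)).
    intros [eps He]. destruct (H eps He) as [N HN].
    exists N; intros n Hn; exact (HN n Hn).
Qed.

Lemma sum_Sn_C : forall (u : nat -> C) n, sum_n u (S n) = (sum_n u n + u (S n))%C.
Proof. intros; exact (sum_Sn (G := C_AbelianMonoid) u n). Qed.

Lemma Cmod_sum_n : forall (u : nat -> C) n, Cmod (sum_n u n) <= sum_n (fun k => Cmod (u k)) n.
Proof.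
  intros u n; induction n as [|n IH].
  - rewrite !sum_O; lra.
  - rewrite sum_Sn_C, sum_Sn. eapply Rle_trans; [apply Cmod_triangle|].
    apply Rplus_le_compat_r, IH.
Qed.

Lemma Cmod_minus_sym : forall a b, Cmod (a - b)%C = Cmod (b - a)%C.
Proof. intros. replace (b - a)%C with (- (a - b))%C by ring. now rewrite Cmod_opp. Qed.

Lemma Cmod_triangle_rev : forall a b, Cmod a - Cmod b <= Cmod (a - b)%C.
Proof.
  intros a b. replace a with ((a - b) + b)%C at 1 by ring.
  pose proof (Cmod_triangle (a - b) b). lra.
Qed.

Lemma Cmod_minus_le : forall a b, Cmod (a - b)%C <= Cmod a + Cmod b.
Proof. intros. unfold Cminus. eapply Rle_trans; [apply Cmod_triangle|]. rewrite Cmod_opp; lra. Qed.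

Lemma Cmod_self_minus : forall z : C, Cmod (z - z)%C = 0.
Proof. intro z. replace (z - z)%C with (RtoC 0) by ring. apply Cmod_0. Qed.

Lemma is_Cseries_unique : forall (u : nat -> C) (l1 l2 : C), is_Cseries u l1 -> is_Cseries u l2 -> l1 = l2.
Proof.
  intros u l1 l2 H1 H2.
  exact (filterlim_locally_unique (F := eventually) (K := C_AbsRing) (V := C_NormedModule) (sum_n u) l1 l2 H1 H2).
Qed.

Lemma is_Cpseries_unique : forall (c : nat -> C) (z l1 l2 : C), is_Cpseries c z l1 -> is_Cpseries c z l2 -> l1 = l2.
Proof.
  intros c z l1 l2 H1 H2. apply is_Cpseries_series in H1. apply is_Cpseries_series in H2.
  eapply is_Cseries_unique; eauto.
Qed.

Lemma Cseries_le : forall (u : nat -> C) (l : C) (v : nat -> R) (m : R),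
  (forall n, Cmod (u n) <= v n) -> is_Cseries u l -> is_series v m -> Cmod l <= m.
Proof.
  intros u l v m Huv Hu Hv.
  apply Rnot_lt_le; intro Hlt.
  destruct (proj1 (is_Cseries_eps u l) Hu ((Cmod l - m) / 2)) as [N HN]; [lra|].
  assert (Hs : forall n, sum_n v n <= m).
  { intro n. apply (is_lim_seq_incr_compare (sum_n v) m).
    - exact Hv.
    - intro k. rewrite sum_Sn. change plus with Rplus.
      pose proof (Huv (S k)); pose proof (Cmod_ge_0 (u (S k))); lra. }
  specialize (HN N (Nat.le_refl _)).
  pose proof (Cmod_triangle_rev l (sum_n u N)). rewrite Cmod_minus_sym in H.
  pose proof (Cmod_sum_n u N).
  assert (sum_n (fun k => Cmod (u k)) N <= sum_n v N).
  { apply sum_n_m_le; auto. }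
  specialize (Hs N). lra.
Qed.

Lemma ex_Cseries_le : forall (u : nat -> C) (v : nat -> R),
  (forall n, Cmod (u n) <= v n) -> ex_series v -> exists l, is_Cseries u l.
Proof.
  intros u v H Hv.
  exact (ex_series_le (K := C_AbsRing) (V := C_CompleteNormedModule) u v H Hv).
Qed.

(** A term is the difference of two consecutive partial sums, and these are bounded. *)
Lemma Cpseries_terms_bounded : forall (c : nat -> C) (z l : C), is_Cpseries c z l ->
  exists B, 0 <= B /\ forall n, Cmod (c n) * Cmod z ^ n <= B.
Proof.
  intros c z l H. apply is_Cpseries_series in H.
  destruct (filterlim_bounded (K := C_AbsRing) (V := C_NormedModule)
              (sum_n (fun n => (c n * z ^ n)%C)) (ex_intro _ l H)) as [M HM].
  change (forall n, Cmod (sum_n (fun n => (c n * z ^ n)%C) n) <= M) in HM.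
  exists (2 * M). set (t := fun n => (c n * z ^ n)%C) in *.
  assert (H0 : Cmod (t 0%nat) <= M) by (rewrite <- (sum_O (G := C_AbelianMonoid) t); apply HM).
  pose proof (Cmod_ge_0 (t 0%nat)).
  split; [lra|]. intros n.
  rewrite <- Cmod_pow, <- Cmod_mult. change (Cmod (t n) <= 2 * M).
  destruct n as [|n]; [lra|].
  pose proof (HM n) as Hn. pose proof (HM (S n)) as HS.
  rewrite sum_Sn_C in HS.
  pose proof (Cmod_minus_le (sum_n t n + t (S n))%C (sum_n t n)) as Hd.
  replace (sum_n t n + t (S n) - sum_n t n)%C with (t (S n)) in Hd by ring. lra.
Qed.

(** Series are centred at 0; an expansion at [z0] is one of the translated function. *)
Definition has_series (c : nat -> C) (d : R) (F : C -> C) : Prop :=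
  0 < d /\ forall z, Cmod z < d -> is_Cpseries c z (F z).

(** Equivalent to convergence in the disk of radius [d], but visibly stable under
    shifting, differentiation and averaging of the coefficients. *)
Definition coef_bounded (c : nat -> C) (d : R) : Prop :=
  forall s, 0 <= s < d -> exists B, 0 <= B /\ forall n, Cmod (c n) * s ^ n <= B.

Lemma has_series_coef_bounded : forall c d F, has_series c d F -> coef_bounded c d.
Proof.
  intros c d F [Hd H] s Hs.
  assert (E : Cmod (RtoC s) = s) by (rewrite Cmod_R; apply Rabs_pos_eq; lra).
  destruct (Cpseries_terms_bounded c (RtoC s) (F (RtoC s))) as [B HB].
  - apply H. rewrite E; lra.
  - rewrite E in HB. now exists B.
Qed.

Lemma coef_bounded_shift : forall c d, coef_bounded c d -> coef_bounded (fun n => c (S n)) d.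
Proof.
  intros c d Hc s Hs.
  destruct (Hc ((s + d) / 2)) as [B [HB0 HB]]; [lra|].
  exists (B / ((s + d) / 2)). split.
  { apply Rmult_le_pos; [lra|left; apply Rinv_0_lt_compat; lra]. }
  intro n. specialize (HB (S n)). simpl in HB.
  apply (Rmult_le_reg_r ((s + d) / 2)); [lra|].
  replace (B / ((s + d) / 2) * ((s + d) / 2)) with B by (field; lra).
  eapply Rle_trans; [|exact HB].
  rewrite Rmult_assoc. apply Rmult_le_compat_l; [apply Cmod_ge_0|].
  rewrite Rmult_comm. apply Rmult_le_compat_l; [lra|]. apply pow_incr; lra.
Qed.

Lemma pow_div_le : forall x s n, 0 < s -> x ^ n = s ^ n * (x / s) ^ n.
Proof. intros. rewrite <- Rpow_mult_distr. f_equal. field; lra. Qed.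

Lemma is_series_geom_scal : forall B x, 0 <= x < 1 -> is_series (fun n => B * x ^ n) (B / (1 - x)).
Proof.
  intros B x Hx. apply (is_series_scal_l (K := R_AbsRing) (V := R_NormedModule) B (fun n => x ^ n) (/ (1 - x))).
  apply is_series_geom. rewrite Rabs_pos_eq; lra.
Qed.

(** Boundedness at a radius strictly between [x] and [d] is geometric decay at [x],
    hence the convergence and all uniform tail estimates below. *)
Lemma coef_bounded_terms : forall c d x, coef_bounded c d -> 0 <= x < d ->
  exists B y, 0 <= B /\ 0 <= y < 1 /\ forall n, Cmod (c n) * x ^ n <= B * y ^ n.
Proof.
  intros c d x Hc Hx.
  destruct (Hc ((x + d) / 2)) as [B [HB0 HB]]; [lra|].
  exists B, (x / ((x + d) / 2)). split; [exact HB0|]. split.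
  - split; [apply Rmult_le_pos; [lra|left; apply Rinv_0_lt_compat; lra]|].
    apply (Rmult_lt_reg_r ((x + d) / 2)); [lra|]. field_simplify; lra.
  - intro n. rewrite (pow_div_le x ((x + d) / 2)) by lra.
    rewrite <- Rmult_assoc. apply Rmult_le_compat_r; [|apply HB].
    apply pow_le, Rmult_le_pos; [lra|left; apply Rinv_0_lt_compat; lra].
Qed.

Lemma coef_bounded_converges : forall c d z, coef_bounded c d -> Cmod z < d ->
  exists l, is_Cpseries c z l.
Proof.
  intros c d z Hc Hz. pose proof (Cmod_ge_0 z) as Hz0.
  destruct (coef_bounded_terms c d (Cmod z) Hc (conj Hz0 Hz)) as [B [y [HB [Hy H]]]].
  destruct (ex_Cseries_le (fun n => (c n * z ^ n)%C) (fun n => B * y ^ n)) as [l Hl].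
  - intro n. rewrite Cmod_mult, Cmod_pow. apply H.
  - exists (B / (1 - y)). now apply is_series_geom_scal.
  - exists l. now apply is_Cpseries_series.
Qed.

Lemma coef_bounded_has_series : forall c d, 0 < d -> coef_bounded c d ->
  exists F, has_series c d F.
Proof.
  intros c d Hd Hc.
  assert (H : forall z, exists l, Cmod z < d -> is_Cpseries c z l).
  { intro z. destruct (classic (Cmod z < d)) as [Hz|Hz].
    - destruct (coef_bounded_converges c d z Hc Hz) as [l Hl]. now exists l.
    - exists (RtoC 0). contradiction. }
  destruct (functional_choice (fun z l => Cmod z < d -> is_Cpseries c z l) H) as [F HF].
  exists F. now split.
Qed.

Lemma has_series_bounded : forall c d F s, has_series c d F -> s < d ->
  exists B, 0 <= B /\ forall z, Cmod z <= s -> Cmod (F z) <= B.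
Proof.
  intros c d F s HF Hs.
  pose proof (has_series_coef_bounded c d F HF) as Hc. destruct HF as [Hd HF].
  destruct (Rle_or_lt 0 s) as [Hs0|Hs0].
  2:{ exists 0. split; [lra|]. intros z Hz. pose proof (Cmod_ge_0 z). lra. }
  destruct (coef_bounded_terms c d s Hc (conj Hs0 Hs)) as [B [y [HB [Hy H]]]].
  exists (B / (1 - y)). split.
  - apply Rmult_le_pos; [lra|left; apply Rinv_0_lt_compat; lra].
  - intros z Hz.
    apply (Cseries_le (fun n => (c n * z ^ n)%C) (F z) (fun n => B * y ^ n)).
    + intro n. rewrite Cmod_mult, Cmod_pow.
      eapply Rle_trans; [|apply H]. apply Rmult_le_compat_l; [apply Cmod_ge_0|].
      apply pow_incr. split; [apply Cmod_ge_0|exact Hz].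
    + apply is_Cpseries_series, HF. lra.
    + now apply is_series_geom_scal.
Qed.

Lemma has_series_at_0 : forall c d F, has_series c d F -> F (RtoC 0) = c 0%nat.
Proof.
  intros c d F [Hd HF].
  apply (is_Cpseries_unique c (RtoC 0)).
  - apply HF. rewrite Cmod_0; lra.
  - exact (is_pseries_0 (K := C_AbsRing) (V := C_NormedModule) c).
Qed.

(** The constant term being zero, [z] divides the series, also as a function at [z = 0]. *)
Lemma has_series_factor : forall c d F, has_series c d F -> c 0%nat = RtoC 0 ->
  exists E, has_series (fun n => c (S n)) d E /\ forall z, Cmod z < d -> F z = (z * E z)%C.
Proof.
  intros c d F HF H0.
  pose proof (coef_bounded_shift c d (has_series_coef_bounded c d F HF)) as Hc.
  destruct (coef_bounded_has_series _ d (proj1 HF) Hc) as [E HE].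
  exists E. split; [exact HE|]. intros z Hz.
  apply (is_Cpseries_unique c z); [now apply HF|].
  apply (is_pseries_ext (K := C_AbsRing) (V := C_NormedModule) (PS_incr_1 (fun n => c (S n)))).
  - intros [|n]; simpl; [now rewrite H0|reflexivity].
  - apply (is_pseries_incr_1 (K := C_AbsRing) (V := C_NormedModule)). now apply HE.
Qed.

Lemma has_series_minus_const : forall c d F, has_series c d F ->
  has_series (fun n => match n with O => RtoC 0 | S _ => c n end) d (fun z => (F z - c 0%nat)%C).
Proof.
  intros c d F [Hd HF]. split; [exact Hd|]. intros z Hz. specialize (HF z Hz).
  apply is_Cpseries_series in HF. apply is_Cpseries_series.
  apply (is_series_decr_1 (K := C_AbsRing) (V := C_NormedModule)).
  apply (is_series_incr_1 (K := C_AbsRing) (V := C_NormedModule) (fun n => (c n * z ^ n)%C)).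
  match goal with |- is_series _ ?t => replace t with (F z); [exact HF|] end.
  simpl. change plus with Cplus. change opp with Copp. change (Cpow z 0) with (RtoC 1). ring.
Qed.

Lemma has_series_continuous_0 : forall c d F, has_series c d F ->
  forall eps, 0 < eps -> exists delta, 0 < delta /\ delta <= d /\
    forall z, Cmod z < delta -> Cmod (F z - c 0%nat)%C < eps.
Proof.
  intros c d F HF eps He.
  destruct (has_series_factor _ d _ (has_series_minus_const c d F HF) eq_refl) as [E [HE HEq]].
  pose proof (proj1 HF) as Hd.
  destruct (has_series_bounded _ d E (d / 2) HE) as [B [HB HB']]; [lra|].
  exists (Rmin (d / 2) (eps / (B + 1))).
  assert (0 < eps / (B + 1)) by (apply Rdiv_lt_0_compat; lra).
  pose proof (Rmin_l (d / 2) (eps / (B + 1))). pose proof (Rmin_r (d / 2) (eps / (B + 1))).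
  split; [apply Rmin_pos; lra|]. split; [lra|]. intros z Hz.
  rewrite HEq by lra. rewrite Cmod_mult.
  apply Rle_lt_trans with (Cmod z * B).
  - apply Rmult_le_compat_l; [apply Cmod_ge_0|]. apply HB'; lra.
  - apply Rle_lt_trans with (Cmod z * (B + 1)).
    + apply Rmult_le_compat_l; [apply Cmod_ge_0|lra].
    + apply Rlt_le_trans with (eps / (B + 1) * (B + 1)).
      * apply Rmult_lt_compat_r; lra.
      * right. field. lra.
Qed.

Lemma has_series_factor_pow : forall l c d F, has_series c d F ->
  (forall n, (n < l)%nat -> c n = RtoC 0) ->
  exists E, has_series (fun n => c (l + n)%nat) d E /\
    forall z, Cmod z < d -> F z = (z ^ l * E z)%C.
Proof.
  induction l as [|l IH]; intros c d F HF H0.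
  - exists F. split; [exact HF|]. intros z _. change (z ^ 0)%C with (RtoC 1). ring.
  - destruct (has_series_factor c d F HF) as [E1 [HE1 Eq1]]; [apply H0; lia|].
    destruct (IH _ d E1 HE1) as [E [HE Eq]]; [intros n Hn; apply H0; lia|].
    exists E. split; [exact HE|]. intros z Hz.
    rewrite Eq1, Eq by exact Hz. rewrite Cpow_S. ring.
Qed.

Lemma C_derive_eps : forall (f : C -> C) (z l : C),
  (forall eps, 0 < eps -> exists delta, 0 < delta /\
     forall y, y <> z -> Cmod (y - z)%C < delta -> Cmod ((f y - f z) / (y - z) - l)%C < eps) ->
  C_derive f z = l.
Proof.
  intros f z l H. apply is_C_lim_unique.
  apply (proj2 (filterlim_locally_ball_norm (K := C_AbsRing) (U := C_NormedModule) _ _)).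
  intros [eps He]. destruct (H eps He) as [delta [Hd HD]].
  apply (locally_le_locally_norm (K := C_AbsRing) (V := C_NormedModule)).
  exists (mkposreal delta Hd). intros y Hy Hne. apply HD; assumption.
Qed.

(** Induction; it bounds [n x^n] by the sum [1 + x + ... + x^(n-1)] of the geometric
    series, so that a factor [n] does not change the radius of convergence. *)
Lemma INR_pow_le : forall x n, 0 <= x < 1 -> INR n * x ^ n * (1 - x) <= 1 - x ^ n.
Proof.
  intros x n Hx; induction n as [|n IH]; [simpl; lra|].
  rewrite S_INR. simpl pow. set (p := x ^ n) in *. 
  assert (0 <= p <= 1).
  { split; [apply pow_le; lra|]. unfold p. rewrite <- (pow1 n). apply pow_incr; lra. }
  assert (x * (INR n * p * (1 - x)) <= x * (1 - p)) by (apply Rmult_le_compat_l; lra).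
  assert (x * p <= 1) by nra.
  assert (0 <= (1 - x) * (1 - x * p)) by (apply Rmult_le_pos; lra).
  lra.
Qed.

Lemma coef_bounded_mult_INR : forall c d, coef_bounded c d ->
  coef_bounded (fun n => (RtoC (INR n) * c n)%C) d.
Proof.
  intros c d Hc s Hs. 
  destruct (coef_bounded_terms c d s Hc Hs) as [B [y [HB [Hy H]]]].
  exists (B / (1 - y)). split.
  { apply Rmult_le_pos; [lra|left; apply Rinv_0_lt_compat; lra]. }
  intro n. rewrite Cmod_mult, Cmod_R, (Rabs_pos_eq (INR n)) by apply pos_INR.
  pose proof (pos_INR n).
  apply Rle_trans with (INR n * (B * y ^ n)).
  { rewrite Rmult_assoc. apply Rmult_le_compat_l; [assumption|apply H]. }
  apply (Rmult_le_reg_r (1 - y)); [lra|].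
  replace (B / (1 - y) * (1 - y)) with B by (field; lra).
  pose proof (INR_pow_le y n Hy). assert (0 <= y ^ n) by (apply pow_le; lra).
  replace (INR n * (B * y ^ n) * (1 - y)) with (B * (INR n * y ^ n * (1 - y))) by ring.
  nra.
Qed.

Definition deriv_coef (c : nat -> C) (n : nat) : C := (RtoC (INR (S n)) * c (S n))%C.

Lemma coef_bounded_deriv : forall c d, coef_bounded c d -> coef_bounded (deriv_coef c) d.
Proof.
  intros c d Hc. exact (coef_bounded_shift _ d (coef_bounded_mult_INR c d Hc)).
Qed.

Lemma Cpow_diff_le : forall (z h : C) rho n, Cmod z <= rho -> Cmod (z + h)%C <= rho ->
  rho * Cmod ((z + h) ^ n - z ^ n)%C <= Cmod h * (INR n * rho ^ n).
Proof.
  intros z h rho n Hz Hzh. pose proof (Cmod_ge_0 z). pose proof (Cmod_ge_0 h).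
  assert (0 <= rho) by lra.
  induction n as [|n IH].
  - change ((z + h) ^ 0)%C with (RtoC 1). change (z ^ 0)%C with (RtoC 1).
    replace (RtoC 1 - RtoC 1)%C with (RtoC 0) by ring. rewrite Cmod_0. simpl. nra.
  - rewrite !Cpow_S, S_INR.
    replace ((z + h) * (z + h) ^ n - z * z ^ n)%C with ((z + h) * ((z + h) ^ n - z ^ n) + h * z ^ n)%C by ring.
    pose proof (Cmod_triangle ((z + h) * ((z + h) ^ n - z ^ n)) (h * z ^ n)) as HT.
    rewrite !Cmod_mult, Cmod_pow in HT.
    assert (Cmod z ^ n <= rho ^ n) by (apply pow_incr; lra).
    assert (0 <= rho ^ n) by (apply pow_le; lra).
    set (u := Cmod ((z + h) ^ n - z ^ n)) in *. assert (0 <= u) by apply Cmod_ge_0.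
    assert (Cmod (z + h) * u <= rho * u) by (apply Rmult_le_compat_r; lra).
    assert (Cmod h * Cmod z ^ n <= Cmod h * rho ^ n) by (apply Rmult_le_compat_l; lra).
    apply Rle_trans with (rho * (rho * u + Cmod h * rho ^ n)).
    + apply Rmult_le_compat_l; lra.
    + simpl pow. nra.
Qed.

(** The remainder [e n] satisfies [e (n+1) = z e n + h ((z+h)^n - z^n)]. *)
Lemma Cpow_taylor_le : forall (z h : C) rho n, Cmod z <= rho -> Cmod (z + h)%C <= rho ->
  rho * rho * Cmod ((z + h) ^ S n - z ^ S n - h * (RtoC (INR (S n)) * z ^ n))%C
  <= Cmod h * Cmod h * (INR (S n) * INR (S n) * rho ^ S n).
Proof.
  intros z h rho n Hz Hzh. pose proof (Cmod_ge_0 z). pose proof (Cmod_ge_0 h).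
  assert (0 <= rho) by lra.
  induction n as [|n IH].
  - rewrite !Cpow_1_r. change (z ^ 0)%C with (RtoC 1). simpl INR.
    replace (z + h - z - h * (1 * 1))%C with (RtoC 0) by ring. rewrite Cmod_0.
    simpl. nra.
  - pose proof (Cpow_diff_le z h rho (S n) Hz Hzh) as HD.
    rewrite (Cpow_S (z + h) (S n)), (Cpow_S z (S n)), (S_INR (S n)), RtoC_plus.
    set (e := ((z + h) ^ S n - z ^ S n - h * (RtoC (INR (S n)) * z ^ n))%C) in *.
    set (u := ((z + h) ^ S n - z ^ S n)%C) in *.
    replace ((z + h) * (z + h) ^ S n - z * z ^ S n - h * ((RtoC (INR (S n)) + 1) * z ^ S n))%C
      with (z * e + h * u)%C by (unfold e, u; rewrite (Cpow_S z n); ring).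
    pose proof (Cmod_triangle (z * e) (h * u)) as HT. rewrite !Cmod_mult in HT.
    pose proof (Cmod_ge_0 e). pose proof (Cmod_ge_0 u).
    set (a := Cmod h) in *. set (m := INR (S n)) in *. set (p := rho ^ S n) in *.
    assert (0 <= p) by (apply pow_le; lra). assert (0 <= m) by apply pos_INR.
    assert (Cmod z * Cmod e <= rho * Cmod e) by (apply Rmult_le_compat_r; lra).
    apply Rle_trans with (rho * rho * (rho * Cmod e + a * Cmod u)).
    { apply Rmult_le_compat_l; [nra|lra]. }
    replace (rho ^ S (S n)) with (rho * p) by reflexivity.
    assert (rho * (rho * rho * Cmod e) <= rho * (a * a * (m * m * p))) by (apply Rmult_le_compat_l; lra).
    assert ((rho * a) * (rho * Cmod u) <= (rho * a) * (a * (m * p))).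
    { apply Rmult_le_compat_l; [apply Rmult_le_pos; lra|lra]. }
    clearbody a m p.
    assert (0 <= rho * a * a * p * (m + 1)) by (repeat apply Rmult_le_pos; lra).
    lra.
Qed.

(** Termwise differentiation is justified by a quadratic remainder, dominated by
    [|h|^2] times the convergent series of [n^2 |c n| rho^n]. *)
Lemma has_series_derive : forall c d F, has_series c d F ->
  has_series (deriv_coef c) d (C_derive F).
Proof.
  intros c d F HF.
  pose proof (has_series_coef_bounded c d F HF) as Hc.
  destruct (coef_bounded_has_series (deriv_coef c) d (proj1 HF) (coef_bounded_deriv c d Hc)) as [G HG].
  split; [apply HF|]. intros z Hz.
  replace (C_derive F z) with (G z); [now apply HG|]. symmetry.
  pose proof (Cmod_ge_0 z) as Hz0.
  set (rho := (Cmod z + d) / 2).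
  assert (Hrho : 0 < rho /\ Cmod z < rho < d) by (unfold rho; lra).
  destruct (coef_bounded_terms _ d rho
    (coef_bounded_mult_INR _ d (coef_bounded_mult_INR c d Hc))) as [B [y [HB [Hy Hterm]]]]; [lra|].
  set (K := B / (1 - y) / (rho * rho)).
  assert (HK : 0 <= K).
  { unfold K, Rdiv. repeat apply Rmult_le_pos; try lra; left; apply Rinv_0_lt_compat; nra. }
  assert (Hquad : forall h, Cmod h < rho - Cmod z ->
    Cmod (F (z + h) - F z - h * G z)%C <= K * (Cmod h * Cmod h)).
  { intros h Hh.
    assert (Hzh : Cmod (z + h) < rho) by (pose proof (Cmod_triangle z h); lra).
    apply (Cseries_le (fun n => (c n * (z + h) ^ n - c n * z ^ n
              - match n with O => RtoC 0 | S m => h * (deriv_coef c m * z ^ m) end)%C) _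
            (fun n => Cmod h * Cmod h / (rho * rho) * B * y ^ n)).
    - intros [|n].
      + change ((z + h) ^ 0)%C with (RtoC 1). change (z ^ 0)%C with (RtoC 1).
        replace (c 0%nat * 1 - c 0%nat * 1 - 0)%C with (RtoC 0) by ring. rewrite Cmod_0.
        pose proof (Cmod_ge_0 h). simpl. unfold Rdiv.
        repeat apply Rmult_le_pos; try lra; left; apply Rinv_0_lt_compat; nra.
      + unfold deriv_coef.
        replace (c (S n) * (z + h) ^ S n - c (S n) * z ^ S n - h * (RtoC (INR (S n)) * c (S n) * z ^ n))%C
          with (c (S n) * ((z + h) ^ S n - z ^ S n - h * (RtoC (INR (S n)) * z ^ n)))%C by ring.
        rewrite Cmod_mult.
        pose proof (Cpow_taylor_le z h rho n) as HT.
        specialize (HT (Rlt_le _ _ (proj1 (proj2 Hrho))) (Rlt_le _ _ Hzh)).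
        specialize (Hterm (S n)). rewrite !Cmod_mult, !Cmod_R, (Rabs_pos_eq (INR (S n))) in Hterm by apply pos_INR.
        set (e := Cmod ((z + h) ^ S n - z ^ S n - h * (RtoC (INR (S n)) * z ^ n))) in *.
        apply (Rmult_le_reg_l (rho * rho)); [nra|].
        replace (rho * rho * (Cmod h * Cmod h / (rho * rho) * B * y ^ S n)) with (Cmod h * Cmod h * (B * y ^ S n)) by (field; lra).
        apply Rle_trans with (Cmod (c (S n)) * (Cmod h * Cmod h * (INR (S n) * INR (S n) * rho ^ S n))).
        * replace (rho * rho * (Cmod (c (S n)) * e)) with (Cmod (c (S n)) * (rho * rho * e)) by ring.
          apply Rmult_le_compat_l; [apply Cmod_ge_0|exact HT].
        * replace (Cmod (c (S n)) * (Cmod h * Cmod h * (INR (S n) * INR (S n) * rho ^ S n)))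
            with (Cmod h * Cmod h * (INR (S n) * (INR (S n) * Cmod (c (S n))) * rho ^ S n)) by ring.
          apply Rmult_le_compat_l; [|exact Hterm].
          pose proof (Cmod_ge_0 h); nra.
    - assert (H1 : is_Cseries (fun n => c n * (z + h) ^ n)%C (F (z + h)%C)).
      { apply is_Cpseries_series, HF. lra. }
      assert (H2 : is_Cseries (fun n => c n * z ^ n)%C (F z)).
      { apply is_Cpseries_series, HF. lra. }
      assert (H3 : is_Cseries (fun n => match n with O => RtoC 0 | S m => h * (deriv_coef c m * z ^ m) end)%C (h * G z)%C).
      { apply (is_series_decr_1 (K := C_AbsRing) (V := C_NormedModule)).
        match goal with |- is_series _ ?t => replace t with (h * G z)%C end.
        - apply (is_series_scal_l (K := C_AbsRing) (V := C_NormedModule) h (fun m => deriv_coef c m * z ^ m)%C).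
          apply is_Cpseries_series, HG. lra.
        - change plus with Cplus. change opp with Copp. ring. }
      exact (is_series_minus _ _ _ _ (is_series_minus _ _ _ _ H1 H2) H3).
    - replace (K * (Cmod h * Cmod h)) with (Cmod h * Cmod h / (rho * rho) * B / (1 - y)).
      + now apply is_series_geom_scal.
      + unfold K. field. lra. }
  apply C_derive_eps. intros eps He.
  exists (Rmin (rho - Cmod z) (eps / (K + 1))).
  assert (0 < eps / (K + 1)) by (apply Rdiv_lt_0_compat; lra).
  split; [apply Rmin_pos; lra|]. intros w Hw Hwd.
  pose proof (Rmin_l (rho - Cmod z) (eps / (K + 1))). pose proof (Rmin_r (rho - Cmod z) (eps / (K + 1))).
  set (h := (w - z)%C) in *.
  assert (Hh : h <> RtoC 0) by (apply Cminus_eq_contra; exact Hw).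
  assert (Hh0 : 0 < Cmod h) by now apply Cmod_gt_0.
  replace w with (z + h)%C by (unfold h; ring).
  replace ((F (z + h) - F z) / h - G z)%C with ((F (z + h) - F z - h * G z) / h)%C by (field; exact Hh).
  rewrite Cmod_div by exact Hh.
  apply (Rmult_lt_reg_r (Cmod h)); [exact Hh0|].
  replace (Cmod (F (z + h)%C - F z - h * G z) / Cmod h * Cmod h) with (Cmod (F (z + h)%C - F z - h * G z)) by (field; lra).
  apply Rle_lt_trans with (K * (Cmod h * Cmod h)); [apply Hquad; lra|].
  assert (Cmod h * (K + 1) < eps).
  { apply Rlt_le_trans with (eps / (K + 1) * (K + 1)); [apply Rmult_lt_compat_r; lra|right; field; lra]. }
  nra.
Qed.

Lemma derive_n_has_series : forall n c d F, has_series c d F ->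
  has_series (Nat.iter n deriv_coef c) d (C_derive_n F n).
Proof.
  induction n as [|n IH]; intros c d F HF; [exact HF|].
  simpl Nat.iter. exact (has_series_derive _ _ _ (IH c d F HF)).
Qed.

(** The factor [r] is [(n+m)! / m!]; only its positivity matters for vanishing orders. *)
Lemma iter_deriv_coef : forall n c m, exists r : R, 0 < r /\
  Nat.iter n deriv_coef c m = (RtoC r * c (n + m)%nat)%C.
Proof.
  induction n as [|n IH]; intros c m.
  - exists 1. split; [lra|]. simpl. now rewrite Cmult_1_l.
  - destruct (IH c (S m)) as [r [Hr E]]. simpl Nat.iter.
    exists (INR (S m) * r). split; [apply Rmult_lt_0_compat; [apply lt_0_INR; lia|exact Hr]|].
    unfold deriv_coef at 1. rewrite E, RtoC_mult, <- Nat.add_succ_comm. ring.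
Qed.

Lemma derive_n_at_0 : forall n c d F, has_series c d F ->
  (C_derive_n F n (RtoC 0) = RtoC 0 <-> c n = RtoC 0).
Proof.
  intros n c d F HF.
  rewrite (has_series_at_0 _ _ _ (derive_n_has_series n c d F HF)).
  destruct (iter_deriv_coef n c 0) as [r [Hr E]].
  rewrite E, Nat.add_0_r. split; intro H.
  - destruct (classic (c n = RtoC 0)) as [H0|H0]; [exact H0|exfalso].
    apply (Cmult_neq_0 (RtoC r) (c n)); [|exact H0|exact H].
    intro Hr0. apply (RtoC_inj r 0) in Hr0. lra.
  - rewrite H. ring.
Qed.

(** * Analyticity at a point *)

Definition analytic_at (f : C -> C) (z0 : C) : Prop :=
  exists c d, has_series c d (fun h => f (z0 + h)%C).

Lemma analytic_on_disk_at : forall f z, analytic_on_disk f -> Cmod z < 1 -> analytic_at f z.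
Proof.
  intros f z Hf Hz. destruct (Hf z Hz) as [c [d [Hd H]]].
  exists c, d. split; [exact Hd|]. intros h Hh.
  replace h with ((z + h) - z)%C at 1 by ring. apply H.
  now replace ((z + h) - z)%C with h by ring.
Qed.

Lemma analytic_at_on_disk : forall f, (forall z, Cmod z < 1 -> analytic_at f z) -> analytic_on_disk f.
Proof.
  intros f Hf z Hz. destruct (Hf z Hz) as [c [d [Hd H]]].
  exists c, d. split; [exact Hd|]. intros y Hy.
  specialize (H (y - z)%C Hy). simpl in H. now replace (z + (y - z))%C with y in H by ring.
Qed.

Lemma analytic_at_ext_loc : forall f g z0 d, 0 < d ->
  (forall z, Cmod (z - z0)%C < d -> f z = g z) -> analytic_at f z0 -> analytic_at g z0.
Proof.
  intros f g z0 d Hd Heq [c [d' [Hd' H]]].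
  exists c, (Rmin d d'). split; [now apply Rmin_pos|]. intros h Hh.
  pose proof (Rmin_l d d'). pose proof (Rmin_r d d').
  rewrite <- Heq; [apply H; lra|]. replace (z0 + h - z0)%C with h by ring. lra.
Qed.

Lemma analytic_at_const : forall a z0, analytic_at (fun _ => a) z0.
Proof.
  intros a z0. exists (fun n => match n with O => a | S _ => RtoC 0 end), 1.
  split; [lra|]. intros h Hh. apply is_Cpseries_series, is_Cseries_eps.
  intros eps He. exists O. intros n _.
  replace (sum_n _ n) with a.
  { now rewrite Cmod_self_minus. }
  induction n as [|n IH].
  - rewrite sum_O. change (h ^ 0)%C with (RtoC 1). ring.
  - rewrite sum_Sn_C, <- IH. ring.
Qed.

Lemma analytic_at_plus : forall f g z0, analytic_at f z0 -> analytic_at g z0 ->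
  analytic_at (fun z => f z + g z)%C z0.
Proof.
  intros f g z0 [c [d [Hd H]]] [c' [d' [Hd' H']]].
  exists (PS_plus (K := C_AbsRing) (V := C_NormedModule) c c'), (Rmin d d').
  split; [now apply Rmin_pos|]. intros h Hh.
  pose proof (Rmin_l d d'). pose proof (Rmin_r d d').
  apply (is_pseries_plus (K := C_AbsRing) (V := C_NormedModule)); [apply H|apply H']; lra.
Qed.

Lemma analytic_at_scal : forall a f z0, analytic_at f z0 -> analytic_at (fun z => a * f z)%C z0.
Proof.
  intros a f z0 [c [d [Hd H]]].
  exists (PS_scal (K := C_AbsRing) (V := C_NormedModule) a c), d.
  split; [exact Hd|]. intros h Hh.
  apply (is_pseries_scal (K := C_AbsRing) (V := C_NormedModule)); [apply Cmult_comm|now apply H].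
Qed.

Lemma analytic_at_mult_id : forall f z0, analytic_at f z0 -> analytic_at (fun z => z * f z)%C z0.
Proof.
  intros f z0 Hf.
  apply (analytic_at_ext_loc (fun z => z0 * f z + (z - z0) * f z)%C _ z0 1); [lra|intros; ring|].
  apply analytic_at_plus; [now apply analytic_at_scal|].
  destruct Hf as [c [d [Hd H]]].
  exists (PS_incr_1 c), d. split; [exact Hd|]. intros h Hh.
  replace (z0 + h - z0)%C with h by ring.
  apply (is_pseries_incr_1 (K := C_AbsRing) (V := C_NormedModule)). now apply H.
Qed.

(** Affine factors are the only products that the Schwarz-Pick quotients involve. *)
Lemma analytic_at_mult_affine : forall a b f z0, analytic_at f z0 ->
  analytic_at (fun z => (a + b * z) * f z)%C z0.
Proof.
  intros a b f z0 Hf.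
  apply (analytic_at_ext_loc (fun z => a * f z + b * (z * f z))%C _ z0 1); [lra|intros; ring|].
  apply analytic_at_plus; apply analytic_at_scal; [|apply analytic_at_mult_id]; exact Hf.
Qed.

Lemma analytic_at_pow : forall n z0, analytic_at (fun z => z ^ n)%C z0.
Proof.
  induction n as [|n IH]; intro z0.
  - exact (analytic_at_const (RtoC 1) z0).
  - exact (analytic_at_mult_id _ z0 (IH z0)).
Qed.

Lemma analytic_at_continuous : forall f z0, analytic_at f z0 ->
  forall eps, 0 < eps -> exists delta, 0 < delta /\
    forall z, Cmod (z - z0)%C < delta -> Cmod (f z - f z0)%C < eps.
Proof.
  intros f z0 [c [d H]] eps He.
  destruct (has_series_continuous_0 _ _ _ H eps He) as [delta [Hd [_ HD]]].
  exists delta. split; [exact Hd|]. intros z Hz.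
  specialize (HD (z - z0)%C Hz). cbv beta in HD.
  pose proof (has_series_at_0 _ _ _ H) as E. cbv beta in E.
  replace (z0 + (z - z0))%C with z in HD by ring.
  now replace (z0 + 0)%C with z0 in E by ring; rewrite <- E in HD.
Qed.

Lemma C_derive_factor : forall (f E : C -> C) z0 d, 0 < d -> analytic_at E z0 ->
  (forall z, Cmod (z - z0)%C < d -> f z = (f z0 + (z - z0) * E z)%C) ->
  C_derive f z0 = E z0.
Proof.
  intros f E z0 d Hd HE HF. apply C_derive_eps. intros eps He.
  destruct (analytic_at_continuous _ z0 HE eps He) as [delta [Hdelta HD]].
  exists (Rmin d delta). split; [now apply Rmin_pos|].
  pose proof (Rmin_l d delta). pose proof (Rmin_r d delta).
  intros y Hy Hyd. rewrite (HF y) by lra.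
  replace ((f z0 + (y - z0) * E y - f z0) / (y - z0) - E z0)%C with (E y - E z0)%C.
  - apply HD; lra.
  - field. now apply Cminus_eq_contra.
Qed.

(** The value [E z0 = C_derive f z0] is what turns a bound for the quotient [E] into a
    bound for the derivative. *)
Lemma analytic_at_factor : forall f z0, analytic_at f z0 ->
  exists E d, 0 < d /\ analytic_at E z0 /\ E z0 = C_derive f z0 /\
    forall z, Cmod (z - z0)%C < d -> f z = (f z0 + (z - z0) * E z)%C.
Proof.
  intros f z0 [c [d H]].
  pose proof (has_series_at_0 _ _ _ H) as E0. cbv beta in E0.
  replace (z0 + 0)%C with z0 in E0 by ring.
  destruct (has_series_factor _ d _ (has_series_minus_const c d _ H) eq_refl) as [E [HE HEq]].
  cbv beta in HEq. rewrite <- E0 in HEq.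
  exists (fun z => E (z - z0)%C), d. split; [apply H|].
  assert (HA : analytic_at (fun z => E (z - z0)%C) z0).
  { exists (fun n => c (S n)), d. split; [apply H|]. intros h Hh.
    replace (z0 + h - z0)%C with h by ring. now apply HE. }
  assert (HF : forall z, Cmod (z - z0) < d -> f z = (f z0 + (z - z0) * E (z - z0)%C)%C).
  { intros z Hz. rewrite <- (HEq (z - z0)%C Hz).
    replace (z0 + (z - z0))%C with z by ring. ring. }
  split; [exact HA|]. split; [|exact HF].
  symmetry. exact (C_derive_factor f _ z0 d (proj1 H) HA HF).
Qed.

(** Either all coefficients vanish, or the first nonzero one gives the order of the
    zero; it is positive, whence the exponent [S l]. *)
Lemma analytic_at_zero_order : forall f z0, analytic_at f z0 -> f z0 = RtoC 0 ->
  (exists d, 0 < d /\ forall z, Cmod (z - z0)%C < d -> f z = RtoC 0) \/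
  (exists l E d, 0 < d /\ analytic_at E z0 /\ E z0 <> RtoC 0 /\
     forall z, Cmod (z - z0)%C < d -> f z = ((z - z0) ^ S l * E z)%C).
Proof.
  intros f z0 [c [d H]] Hf0.
  destruct (classic (exists n, c n <> RtoC 0)) as [Hex|Hno].
  - right.
    destruct (dec_inh_nat_subset_has_unique_least_element (fun n => c n <> RtoC 0)
       (fun n => classic _) Hex) as [l [[Hl Hmin] _]].
    assert (H0 : forall n, (n < l)%nat -> c n = RtoC 0).
    { intros n Hn. apply NNPP. intro Hc. specialize (Hmin n Hc). lia. }
    destruct (has_series_factor_pow l c d _ H H0) as [E [HE HEq]]. cbv beta in HEq.
    destruct l as [|l].
    { exfalso. apply Hl. rewrite <- (has_series_at_0 _ _ _ H).
      now replace (z0 + 0)%C with z0 by ring. }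
    exists l, (fun z => E (z - z0)%C), d. split; [apply H|]. split; [|split].
    + exists (fun n => c (S l + n)%nat), d. split; [apply H|]. intros h Hh.
      replace (z0 + h - z0)%C with h by ring. now apply HE.
    + replace (z0 - z0)%C with (RtoC 0) by ring.
      rewrite (has_series_at_0 _ _ _ HE). now rewrite Nat.add_0_r.
    + intros z Hz. rewrite <- (HEq (z - z0)%C Hz). f_equal. ring.
  - left. exists d. split; [apply H|]. intros z Hz.
    destruct H as [Hd H]. specialize (H (z - z0)%C Hz). cbv beta in H.
    replace (z0 + (z - z0))%C with z in H by ring.
    apply is_Cpseries_series in H.
    apply (is_Cseries_unique _ _ _ H). apply is_Cseries_eps. intros eps He.
    exists O. intros n _. replace (sum_n _ n) with (RtoC 0).
    { now rewrite Cmod_self_minus. }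
    assert (HC : forall n, c n = RtoC 0) by (intro k; apply NNPP; intro; apply Hno; now exists k).
    induction n as [|n IH].
    + rewrite sum_O, HC. ring.
    + rewrite sum_Sn_C, <- IH, HC. ring.
Qed.

(** * The local maximum principle *)

Definition expi (t : R) : C := (cos t, sin t).

Lemma expi_plus : forall a b, expi (a + b) = (expi a * expi b)%C.
Proof.
  intros a b. apply injective_projections; simpl; [rewrite cos_plus|rewrite sin_plus]; ring.
Qed.

Lemma expi_0 : expi 0 = RtoC 1.
Proof. unfold expi. now rewrite cos_0, sin_0. Qed.

Lemma expi_pow : forall t n, (expi t ^ n)%C = expi (INR n * t).
Proof.
  intros t n; induction n as [|n IH].
  - simpl INR. rewrite Rmult_0_l, expi_0. reflexivity.
  - rewrite Cpow_S, IH, S_INR, <- expi_plus. f_equal. ring.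
Qed.

Lemma Cmod_sq : forall z : C, Cmod z * Cmod z = fst z * fst z + snd z * snd z.
Proof.
  intro z. unfold Cmod. rewrite sqrt_sqrt; [ring|].
  pose proof (pow2_ge_0 (fst z)). pose proof (pow2_ge_0 (snd z)). lra.
Qed.

Lemma Cmod_expi : forall t, Cmod (expi t) = 1.
Proof.
  intro t. pose proof (Cmod_sq (expi t)) as H. simpl in H.
  pose proof (sin2_cos2 t) as H1. unfold Rsqr in H1.
  pose proof (Cmod_ge_0 (expi t)). nra.
Qed.

Lemma polar : forall v : C, exists t, v = (RtoC (Cmod v) * expi t)%C.
Proof.
  intro v. destruct (classic (v = RtoC 0)) as [->|Hv].
  { exists 0. rewrite Cmod_0. ring. }
  apply Cmod_gt_0 in Hv. pose proof (Cmod_sq v) as Hsq.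
  set (x := fst v / Cmod v).
  assert (Hx : fst v = Cmod v * x) by (unfold x; field; lra).
  set (y := snd v / Cmod v).
  assert (Hy : snd v = Cmod v * y) by (unfold y; field; lra).
  assert (Hxy : x * x + y * y = 1).
  { rewrite Hx, Hy in Hsq. apply (Rmult_eq_reg_l (Cmod v * Cmod v)); [lra|nra]. }
  assert (Hx1 : -1 <= x <= 1) by nra.
  assert (Hc : cos (acos x) = x) by now apply cos_acos.
  assert (Hs : sin (acos x) = Rabs y).
  { rewrite sin_acos by exact Hx1. rewrite <- sqrt_Rsqr_abs. f_equal. unfold Rsqr. lra. }
  destruct (Rle_or_lt 0 y) as [Hy0|Hy0].
  - exists (acos x). rewrite Rabs_pos_eq in Hs by exact Hy0.
    apply injective_projections; simpl; rewrite Hc, Hs; lra.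
  - exists (- acos x). rewrite Rabs_left in Hs by exact Hy0.
    apply injective_projections; simpl; rewrite cos_neg, sin_neg, Hc, Hs; lra.
Qed.

(** A unit number has roots of every order, so the phase of [u^(n+1) w] can be made that
    of [lambda], and then the moduli add up. *)
Lemma aligned_direction : forall (w lambda : C) (n : nat),
  exists u : C, Cmod u = 1 /\
    forall s, 0 <= s -> Cmod (lambda + RtoC s * (u ^ S n * w))%C = Cmod lambda + s * Cmod w.
Proof.
  intros w lambda n.
  destruct (polar w) as [a Ha]. destruct (polar lambda) as [b Hb].
  pose proof (Cmod_ge_0 w) as Hw. pose proof (Cmod_ge_0 lambda) as Hl.
  set (A := Cmod w) in *. set (L := Cmod lambda) in *.
  exists (expi ((b - a) / INR (S n))). split; [apply Cmod_expi|]. intros s Hs.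
  rewrite expi_pow.
  replace (INR (S n) * ((b - a) / INR (S n))) with (b - a) by (field; apply not_0_INR; lia).
  rewrite Ha, Hb.
  replace (RtoC L * expi b + RtoC s * (expi (b - a) * (RtoC A * expi a)))%C
    with (RtoC (L + s * A) * expi b)%C.
  - rewrite Cmod_mult, Cmod_expi, Cmod_R, Rabs_pos_eq; [ring|]. nra.
  - rewrite RtoC_plus, RtoC_mult.
    replace b with ((b - a) + a) at 1 by ring. rewrite (expi_plus (b - a) a).
    replace (expi b) with (expi (b - a) * expi a)%C by (rewrite <- expi_plus; f_equal; ring). ring.
Qed.

(** A class of functions to which the maximum principle applies and which contains the
    quotients of Schwarz's and Schwarz-Pick's lemmas with their removable singularities:
    the value at [z0] is determined by [P z0 / Q z0], and no power series has to be
    divided by or composed with another. *)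
Definition quotient_at (phi : C -> C) (z0 : C) : Prop :=
  exists P Q d, analytic_at P z0 /\ analytic_at Q z0 /\ Q z0 <> RtoC 0 /\ 0 < d /\
    forall z, Cmod (z - z0)%C < d -> (phi z * Q z)%C = P z.

Lemma analytic_at_nonzero : forall Q z0, analytic_at Q z0 -> Q z0 <> RtoC 0 ->
  exists d, 0 < d /\ forall z, Cmod (z - z0)%C < d -> Cmod (Q z0) / 2 < Cmod (Q z).
Proof.
  intros Q z0 HQ H0. apply Cmod_gt_0 in H0.
  destruct (analytic_at_continuous Q z0 HQ (Cmod (Q z0) / 2)) as [d [Hd HD]]; [lra|].
  exists d. split; [exact Hd|]. intros z Hz. specialize (HD z Hz).
  pose proof (Cmod_triangle_rev (Q z0) (Q z)) as HT. rewrite Cmod_minus_sym in HT. lra.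
Qed.

Lemma quotient_at_continuous : forall phi z0, quotient_at phi z0 ->
  forall eps, 0 < eps -> exists delta, 0 < delta /\
    forall z, Cmod (z - z0)%C < delta -> Cmod (phi z - phi z0)%C < eps.
Proof.
  intros phi z0 [P [Q [d [HP [HQ [H0 [Hd Heq]]]]]]] eps He.
  destruct (analytic_at_nonzero Q z0 HQ H0) as [d1 [Hd1 HQ1]].
  apply Cmod_gt_0 in H0.
  assert (HD : analytic_at (fun z => P z + (- phi z0) * Q z)%C z0).
  { apply analytic_at_plus; [exact HP|now apply analytic_at_scal]. }
  destruct (analytic_at_continuous _ z0 HD (eps * (Cmod (Q z0) / 2))) as [d2 [Hd2 HD2]]; [nra|].
  exists (Rmin d (Rmin d1 d2)). split; [repeat apply Rmin_pos; assumption|]. intros z Hz.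
  pose proof (Rmin_l d (Rmin d1 d2)). pose proof (Rmin_r d (Rmin d1 d2)).
  pose proof (Rmin_l d1 d2). pose proof (Rmin_r d1 d2).
  specialize (HD2 z). cbv beta in HD2. specialize (HQ1 z).
  rewrite <- (Heq z), <- (Heq z0) in HD2 by (rewrite ?Cmod_self_minus; lra).
  replace (phi z * Q z + - phi z0 * Q z - (phi z0 * Q z0 + - phi z0 * Q z0))%C
    with ((phi z - phi z0) * Q z)%C in HD2 by ring.
  rewrite Cmod_mult in HD2. specialize (HD2 ltac:(lra)). specialize (HQ1 ltac:(lra)).
  apply Rnot_le_lt; intro Hle.
  assert (eps * (Cmod (Q z0) / 2) <= Cmod (phi z - phi z0) * Cmod (Q z)) by (apply Rmult_le_compat; lra).
  lra.
Qed.

(** With [lambda = phi z0], if [P - lambda Q] is not locally zero then [phi - lambda] is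
    [(z-z0)^n] times a function close to a nonzero constant [w], so the modulus increases
    in the direction that aligns [w (z-z0)^n] with [lambda]. *)
Lemma quotient_at_local_max : forall phi z0, quotient_at phi z0 ->
  (exists d, 0 < d /\ forall z, Cmod (z - z0)%C < d -> phi z = phi z0) \/
  (forall delta, 0 < delta -> exists z, Cmod (z - z0)%C < delta /\ Cmod (phi z0) < Cmod (phi z)).
Proof.
  intros phi z0 [P [Q [d [HP [HQ [H0 [Hd Heq]]]]]]].
  destruct (analytic_at_nonzero Q z0 HQ H0) as [d1 [Hd1 HQ1]].
  pose proof (proj1 (Cmod_gt_0 _) H0) as HQ0.
  assert (HQnz : forall z, Cmod (z - z0) < d1 -> Q z <> RtoC 0).
  { intros z Hz. apply Cmod_gt_0. specialize (HQ1 z Hz). lra. }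
  assert (HD : analytic_at (fun z => P z + (- phi z0) * Q z)%C z0).
  { apply analytic_at_plus; [exact HP|now apply analytic_at_scal]. }
  destruct (analytic_at_zero_order _ z0 HD) as [[d2 [Hd2 HZ]]|[l [E [d2 [Hd2 [HE [HE0 HEq]]]]]]].
  - cbv beta. rewrite <- Heq by (rewrite Cmod_self_minus; exact Hd). ring.
  - left. exists (Rmin d (Rmin d1 d2)). split; [repeat apply Rmin_pos; assumption|]. intros z Hz.
    pose proof (Rmin_l d (Rmin d1 d2)). pose proof (Rmin_r d (Rmin d1 d2)).
    pose proof (Rmin_l d1 d2). pose proof (Rmin_r d1 d2).
    specialize (HZ z). cbv beta in HZ. rewrite <- (Heq z) in HZ by lra.
    specialize (HZ ltac:(lra)).
    apply NNPP. intro Hne. apply (Cmult_neq_0 (phi z - phi z0) (Q z)).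
    + now apply Cminus_eq_contra.
    + apply HQnz; lra.
    + rewrite <- HZ. ring.
  - right. intros delta Hdelta. cbv beta in HEq.
    set (w := (E z0 / Q z0)%C).
    assert (Hw : 0 < Cmod w).
    { unfold w. rewrite Cmod_div by exact H0. apply Cmod_gt_0 in HE0. now apply Rdiv_lt_0_compat. }
    assert (HF : analytic_at (fun z => E z + (- w) * Q z)%C z0).
    { apply analytic_at_plus; [exact HE|now apply analytic_at_scal]. }
    destruct (analytic_at_continuous _ z0 HF (Cmod w * (Cmod (Q z0) / 2))) as [d3 [Hd3 HF3]]; [nra|].
    cbv beta in HF3.
    destruct (aligned_direction w (phi z0) l) as [u [Hu Halign]].
    set (t := Rmin (Rmin delta d) (Rmin d1 (Rmin d2 d3)) / 2).
    assert (Ht : 0 < t /\ t < delta /\ t < d /\ t < d1 /\ t < d2 /\ t < d3).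
    { assert (0 < Rmin (Rmin delta d) (Rmin d1 (Rmin d2 d3))) by (repeat apply Rmin_pos; assumption).
      pose proof (Rmin_l (Rmin delta d) (Rmin d1 (Rmin d2 d3))).
      pose proof (Rmin_r (Rmin delta d) (Rmin d1 (Rmin d2 d3))).
      pose proof (Rmin_l delta d). pose proof (Rmin_r delta d).
      pose proof (Rmin_l d1 (Rmin d2 d3)). pose proof (Rmin_r d1 (Rmin d2 d3)).
      pose proof (Rmin_l d2 d3). pose proof (Rmin_r d2 d3). unfold t. lra. }
    set (z := (z0 + RtoC t * u)%C).
    assert (Hzt : Cmod (z - z0) = t).
    { unfold z. replace (z0 + RtoC t * u - z0)%C with (RtoC t * u)%C by ring.
      rewrite Cmod_mult, Hu, Cmod_R, Rabs_pos_eq; lra. }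
    exists z. split; [lra|].
    specialize (HEq z ltac:(lra)). rewrite <- (Heq z) in HEq by lra.
    specialize (HF3 z ltac:(lra)). specialize (HQ1 z ltac:(lra)).
    assert (HQz : Q z <> RtoC 0) by (apply HQnz; lra).
    replace (E z0 + - w * Q z0)%C with (RtoC 0) in HF3 by (unfold w; field; exact H0).
    (* The perturbation of [w] is smaller than [w] itself, so it cannot undo the gain. *)
    set (err := (E z / Q z - w)%C).
    assert (Herr : Cmod err < Cmod w).
    { replace (E z + - w * Q z - 0)%C with (err * Q z)%C in HF3 by (unfold err; field; exact HQz).
      rewrite Cmod_mult in HF3. apply Rnot_le_lt; intro Hle.
      assert (Cmod w * (Cmod (Q z0) / 2) <= Cmod err * Cmod (Q z)) by (apply Rmult_le_compat; lra).
      lra. }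
    assert (Hphi : phi z = ((phi z0 + RtoC (t ^ S l) * (u ^ S l * w)) + RtoC (t ^ S l) * (u ^ S l * err))%C).
    { rewrite RtoC_pow.
      replace (phi z0 + RtoC t ^ S l * (u ^ S l * w) + RtoC t ^ S l * (u ^ S l * err))%C
        with (phi z0 + (RtoC t ^ S l * u ^ S l) * (w + err))%C by ring.
      rewrite <- Cpow_mult_l.
      replace (RtoC t * u)%C with (z - z0)%C by (unfold z; ring).
      replace (w + err)%C with (E z / Q z)%C by (unfold err; ring).
      replace (phi z) with ((phi z * Q z + - phi z0 * Q z) / Q z + phi z0)%C by (field; exact HQz).
      rewrite HEq. field. exact HQz. }
    rewrite Hphi.
    assert (Htp : 0 < t ^ S l) by (apply pow_lt; lra).
    set (X := (phi z0 + RtoC (t ^ S l) * (u ^ S l * w))%C) in *.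
    set (Y := (RtoC (t ^ S l) * (u ^ S l * err))%C) in *.
    assert (HX : Cmod X = Cmod (phi z0) + t ^ S l * Cmod w) by (apply Halign; lra).
    assert (HY : Cmod Y = t ^ S l * Cmod err).
    { unfold Y. rewrite !Cmod_mult, Cmod_pow, Hu, pow1, Cmod_R, Rabs_pos_eq; lra. }
    pose proof (Cmod_triangle_rev X (- Y)) as HT. rewrite Cmod_opp in HT.
    replace (X - - Y)%C with (X + Y)%C in HT by ring.
    assert (t ^ S l * Cmod err < t ^ S l * Cmod w) by (apply Rmult_lt_compat_l; lra).
    lra.
Qed.

(** * The maximum principle on the disk *)

(** Cousin's lemma, by the supremum of the [x] with [P a x]; it serves below in place of
    finite subcovers, once in each coordinate. *)
Lemma interval_induction : forall (P : R -> R -> Prop) (a b : R), a <= b ->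
  (forall x y z, x <= y <= z -> P x y -> P y z -> P x z) ->
  (forall x, a <= x <= b -> exists d, 0 < d /\
     forall u v, x - d < u -> u <= v -> v < x + d -> P u v) ->
  P a b.
Proof.
  intros P a b Hab Hcat Hloc.
  set (S := fun x => a <= x <= b /\ P a x).
  assert (Ha : S a).
  { split; [lra|]. destruct (Hloc a) as [d [Hd H]]; [lra|]. apply H; lra. }
  destruct (completeness S) as [s [Hub Hlub]].
  { exists b. intros x [Hx _]. lra. }
  { now exists a. }
  assert (Has : a <= s) by now apply Hub.
  assert (Hsb : s <= b) by (apply Hlub; intros x [Hx _]; lra).
  destruct (Hloc s) as [d [Hd H]]; [lra|].
  assert (Hx : exists x, S x /\ s - d < x).
  { apply NNPP. intro Hno. assert (s <= s - d); [|lra]. apply Hlub. intros x Sx.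
    apply Rnot_lt_le. intro Hlt. apply Hno. now exists x. }
  destruct Hx as [x [[Hx HPx] Hsx]].
  assert (Hxs : x <= s) by (apply Hub; now split).
  set (y := Rmin b (s + d / 2)).
  assert (Hy : s <= y /\ y <= b /\ y <= s + d / 2).
  { unfold y. pose proof (Rmin_l b (s + d / 2)). pose proof (Rmin_r b (s + d / 2)).
    split; [apply Rmin_glb; lra|lra]. }
  assert (HPy : P a y) by (apply (Hcat a x y); [lra|exact HPx|apply H; lra]).
  assert (Hys : y <= s) by (apply Hub; split; [lra|exact HPy]).
  assert (Hyb : y = b).
  { unfold y, Rmin in *. destruct (Rle_dec b (s + d / 2)); lra. }
  now rewrite <- Hyb.
Qed.

Lemma Cmod_le_abs : forall z : C, Cmod z <= Rabs (fst z) + Rabs (snd z).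
Proof.
  intro z. pose proof (Cmod_sq z). pose proof (Cmod_ge_0 z).
  pose proof (Rabs_pos (fst z)). pose proof (Rabs_pos (snd z)).
  pose proof (Rsqr_abs (fst z)) as Hx. pose proof (Rsqr_abs (snd z)) as Hy. unfold Rsqr in *.
  nra.
Qed.

Lemma fst_le_Cmod : forall z : C, - Cmod z <= fst z <= Cmod z.
Proof. intro z. pose proof (Cmod_sq z). pose proof (Cmod_ge_0 z). split; nra. Qed.

Lemma snd_le_Cmod : forall z : C, - Cmod z <= snd z <= Cmod z.
Proof. intro z. pose proof (Cmod_sq z). pose proof (Cmod_ge_0 z). split; nra. Qed.

(** If no point were maximal, every point would have a neighbourhood on which [u] stays
    below one of its values; finite unions of boxes keep that property, and the whole
    set cannot have it. *)
Lemma attains_max : forall (D : C -> Prop) (u : C -> R) (rho : R),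
  (exists z, D z) -> (forall z, D z -> Cmod z <= rho) ->
  (forall z, ~ D z -> exists d, 0 < d /\ forall y, Cmod (y - z)%C < d -> ~ D y) ->
  (forall z, D z -> forall eps, 0 < eps -> exists d, 0 < d /\
     forall y, D y -> Cmod (y - z)%C < d -> u y < u z + eps) ->
  exists z, D z /\ forall y, D y -> u y <= u z.
Proof.
  intros D u rho [p0 Hp0] Hbd Hclosed Husc.
  assert (Hrho : 0 <= rho) by (pose proof (Hbd p0 Hp0); pose proof (Cmod_ge_0 p0); lra).
  apply NNPP. intro Hno.
  assert (Hloc : forall z, exists d, 0 < d /\ exists p, D p /\
            forall y, D y -> Cmod (y - z) < d -> u y < u p).
  { intro z. destruct (classic (D z)) as [Hz|Hz].
    - assert (exists p, D p /\ u z < u p) as [p [Hp Hlt]].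
      { apply NNPP. intro Hn. apply Hno. exists z. split; [exact Hz|]. intros y Hy.
        apply Rnot_lt_le. intro Hlt. apply Hn. now exists y. }
      destruct (Husc z Hz (u p - u z)) as [d [Hd H]]; [lra|].
      exists d. split; [exact Hd|]. exists p. split; [exact Hp|].
      intros y Hy Hyz. specialize (H y Hy Hyz). lra.
    - destruct (Hclosed z Hz) as [d [Hd H]]. exists d. split; [exact Hd|].
      exists p0. split; [exact Hp0|]. intros y Hy Hyz. now specialize (H y Hyz). }
  assert (Hmax : forall p q, D p -> D q -> exists r, D r /\ u p <= u r /\ u q <= u r).
  { intros p q Hp Hq. destruct (Rle_or_lt (u p) (u q)); [exists q|exists p]; repeat split; trivial; lra. }
  assert (Hall : exists p, D p /\ forall y, D y -> - rho <= fst y <= rho -> u y < u p).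
  { apply (interval_induction (fun x1 x2 => exists p, D p /\ forall y, D y -> x1 <= fst y <= x2 -> u y < u p)); [lra| |].
    - intros x1 x2 x3 Hx [p [Hp H1]] [q [Hq H2]].
      destruct (Hmax p q Hp Hq) as [r [Hr [Hpr Hqr]]]. exists r. split; [exact Hr|].
      intros y Hy Hyx. destruct (Rle_or_lt (fst y) x2) as [Hle|Hlt].
      + specialize (H1 y Hy ltac:(lra)). lra.
      + specialize (H2 y Hy ltac:(lra)). lra.
    - intros x _.
      (* First cover the vertical segment over [x]: this gives a strip around it. *)
      assert (Hstrip : exists d, 0 < d /\ exists p, D p /\ forall y, D y ->
          Rabs (fst y - x) < d -> - rho <= snd y <= rho -> u y < u p).
      { apply (interval_induction (fun y1 y2 => exists d, 0 < d /\ exists p, D p /\ forall y, D y ->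
          Rabs (fst y - x) < d -> y1 <= snd y <= y2 -> u y < u p)); [lra| |].
        - intros y1 y2 y3 Hys [d [Hd [p [Hp H1]]]] [d' [Hd' [q [Hq H2]]]].
          destruct (Hmax p q Hp Hq) as [r [Hr [Hpr Hqr]]].
          exists (Rmin d d'). split; [now apply Rmin_pos|]. exists r. split; [exact Hr|].
          pose proof (Rmin_l d d'). pose proof (Rmin_r d d').
          intros y Hy Hyx Hyy. destruct (Rle_or_lt (snd y) y2) as [Hle|Hlt].
          + specialize (H1 y Hy ltac:(lra) ltac:(lra)). lra.
          + specialize (H2 y Hy ltac:(lra) ltac:(lra)). lra.
        - intros y0 _. destruct (Hloc (x, y0)) as [d [Hd [p [Hp H]]]].
          exists (d / 2). split; [lra|]. intros y1 y2 Hy1 Hy12 Hy2.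
          exists (d / 2). split; [lra|]. exists p. split; [exact Hp|].
          intros y Hy Hyx Hyy. apply H; [exact Hy|].
          pose proof (Cmod_le_abs (y - (x, y0))%C) as HC. simpl in HC.
          assert (Rabs (snd y + - y0) < d / 2) by (apply Rabs_def1; lra).
          unfold Rminus in Hyx. lra. }
      destruct Hstrip as [d [Hd [p [Hp H]]]].
      exists d. split; [exact Hd|]. intros x1 x2 Hx1 Hx12 Hx2.
      exists p. split; [exact Hp|]. intros y Hy Hyx. apply H; [exact Hy| |].
      + apply Rabs_def1; lra.
      + pose proof (snd_le_Cmod y). pose proof (Hbd y Hy). lra. }
  destruct Hall as [p [Hp H]].
  pose proof (fst_le_Cmod p). pose proof (Hbd p Hp).
  specialize (H p Hp ltac:(lra)). lra.
Qed.

(** One of the two horizontal directions does not decrease the modulus to first order,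
    and the second-order term is positive. *)
Lemma farther_point : forall (z : C) d, 0 < d ->
  exists y, Cmod (y - z)%C < d /\ Cmod z < Cmod y.
Proof.
  intros z d Hd.
  assert (H : exists v, (v = 1 \/ v = -1) /\ 0 <= fst z * v).
  { destruct (Rle_or_lt 0 (fst z)); [exists 1|exists (-1)]; split; auto; lra. }
  destruct H as [v [Hv Hz]].
  set (t := d / 2 * v).
  assert (Ht : Rabs t < d /\ 0 < t * t /\ 0 <= fst z * t).
  { unfold t. split; [|split; [destruct Hv; subst v; nra|nra]].
    destruct Hv; subst v; [rewrite Rabs_pos_eq|rewrite Rabs_left]; lra. }
  exists (z + RtoC t)%C. split.
  - replace (z + RtoC t - z)%C with (RtoC t) by ring. rewrite Cmod_R. lra.
  - pose proof (Cmod_sq z). pose proof (Cmod_sq (z + RtoC t)). simpl in *.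
    pose proof (Cmod_ge_0 z). pose proof (Cmod_ge_0 (z + RtoC t)).
    apply Rnot_le_lt. intro Hle.
    assert (Cmod (z + RtoC t) * Cmod (z + RtoC t) <= Cmod z * Cmod z) by (apply Rmult_le_compat; lra).
    nra.
Qed.

(** Among the points of the closed disk where [|phi|] is maximal take one of largest
    modulus.  If it were interior, [phi] would be constant near it by the local
    principle, and a maximal point farther from the origin would exist. *)
Lemma max_principle : forall (phi : C -> C) (M : R),
  (forall z, Cmod z < 1 -> quotient_at phi z) ->
  (forall eps, 0 < eps -> exists r, r < 1 /\
     forall z, r <= Cmod z -> Cmod z < 1 -> Cmod (phi z) <= M + eps) ->
  forall z, Cmod z < 1 -> Cmod (phi z) <= M.
Proof.
  intros phi M Hq Hbd z Hz. apply le_epsilon. intros eps He.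
  destruct (Hbd eps He) as [r [Hr Hbr]].
  set (rho := Rmax r (Cmod z)).
  assert (Hrho : r <= rho /\ Cmod z <= rho /\ rho < 1).
  { unfold rho. pose proof (Rmax_l r (Cmod z)). pose proof (Rmax_r r (Cmod z)).
    split; [lra|split; [lra|now apply Rmax_lub_lt]]. }
  assert (Hcont : forall y, Cmod y < 1 -> forall e, 0 < e -> exists d, 0 < d /\
     forall x, Cmod (x - y) < d -> Rabs (Cmod (phi x) - Cmod (phi y)) < e).
  { intros y Hy e Hee. destruct (quotient_at_continuous phi y (Hq y Hy) e Hee) as [d [Hd H]].
    exists d. split; [exact Hd|]. intros x Hx. specialize (H x Hx).
    pose proof (Cmod_triangle_rev (phi x) (phi y)).
    pose proof (Cmod_triangle_rev (phi y) (phi x)) as H2. rewrite Cmod_minus_sym in H2.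
    apply Rabs_def1; lra. }
  assert (Hout : forall x, ~ Cmod x <= rho -> exists d, 0 < d /\ forall y, Cmod (y - x) < d -> ~ Cmod y <= rho).
  { intros x Hx. exists (Cmod x - rho). split; [lra|]. intros y Hy.
    pose proof (Cmod_triangle_rev x y) as HT. rewrite Cmod_minus_sym in HT. lra. }
  destruct (attains_max (fun y => Cmod y <= rho) (fun y => Cmod (phi y)) rho) as [p [Hp Hpmax]].
  - now exists z.
  - trivial.
  - exact Hout.
  - intros y Hy e Hee. destruct (Hcont y ltac:(lra) e Hee) as [d [Hd H]].
    exists d. split; [exact Hd|]. intros x _ Hx. specialize (H x Hx). apply Rabs_def2 in H. lra.
  - destruct (attains_max (fun y => Cmod y <= rho /\ Cmod (phi y) = Cmod (phi p)) Cmod rho) as [q [[Hq1 Hq2] Hqmax]].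
    + now exists p.
    + tauto.
    + intros x Hx. destruct (Rle_or_lt (Cmod x) rho) as [Hxr|Hxr].
      * assert (Hne : Cmod (phi x) <> Cmod (phi p)) by tauto.
        destruct (Hcont x ltac:(lra) (Rabs (Cmod (phi p) - Cmod (phi x)))) as [d [Hd H]].
        { apply Rabs_pos_lt. lra. }
        exists d. split; [exact Hd|]. intros y Hy [_ E]. specialize (H y Hy). rewrite E in H. lra.
      * destruct (Hout x ltac:(lra)) as [d [Hd H]]. exists d. split; [exact Hd|].
        intros y Hy [H1 _]. exact (H y Hy H1).
    + intros x _ e Hee. exists e. split; [exact Hee|]. intros y _ Hy.
      pose proof (Cmod_triangle_rev y x). lra.
    + pose proof (Hpmax z ltac:(lra)) as Hzp. cbv beta in Hzp.
      destruct (Rle_or_lt rho (Cmod q)) as [Hge|Hlt].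
      * pose proof (Hbr q ltac:(lra) ltac:(lra)). lra.
      * exfalso. destruct (quotient_at_local_max phi q (Hq q ltac:(lra))) as [[d [Hd H]]|H].
        -- destruct (farther_point q (Rmin d (rho - Cmod q))) as [y [Hy1 Hy2]]; [apply Rmin_pos; lra|].
           pose proof (Rmin_l d (rho - Cmod q)). pose proof (Rmin_r d (rho - Cmod q)).
           pose proof (Cmod_triangle_rev y q).
           assert (Cmod y <= Cmod q); [|lra]. apply Hqmax. split; [lra|].
           rewrite H by lra. exact Hq2.
        -- destruct (H (rho - Cmod q)) as [y [Hy1 Hy2]]; [lra|].
           pose proof (Cmod_triangle_rev y q).
           pose proof (Hpmax y ltac:(lra)) as Hyp. cbv beta in Hyp. lra.
Qed.

(** * Schwarz and Schwarz-Pick lemmas *)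

Lemma sup_norm_le_1 : forall f : C -> C,
  Rbar_le (sup_norm f) 1 <-> (forall z, Cmod z < 1 -> Cmod (f z) <= 1).
Proof.
  intro f. unfold sup_norm.
  destruct (Lub_Rbar_correct (fun x : R => exists z : C, unit_disk z /\ x = Cmod (f z))) as [Hub Hlub].
  split; intro H.
  - intros z Hz. apply (Rbar_le_trans (Cmod (f z)) _ 1 (Hub _ (ex_intro _ z (conj Hz eq_refl))) H).
  - apply Hlub. intros x [z [Hz ->]]. exact (H z Hz).
Qed.

Lemma patch_at : forall (f : C -> C) (z0 v : C),
  exists g : C -> C, g z0 = v /\ forall z, z <> z0 -> g z = f z.
Proof.
  intros f z0 v.
  destruct (functional_choice (fun z y => (z = z0 -> y = v) /\ (z <> z0 -> y = f z))) as [g Hg].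
  - intro z. destruct (classic (z = z0)); [exists v|exists (f z)]; tauto.
  - exists g. split; [now apply Hg|]. intros z Hz. now apply Hg.
Qed.

Lemma pow_near_1 : forall j eps, 0 < eps -> exists r, 0 < r < 1 /\
  forall x, r <= x <= 1 -> 1 <= (1 + eps) * x ^ j.
Proof.
  induction j as [|j IH]; intros eps He.
  - exists (1 / 2). split; [lra|]. intros x _. simpl. lra.
  - destruct (IH (eps / 2)) as [r [Hr H]]; [lra|].
    set (s := (1 + eps / 2) / (1 + eps)).
    assert (Hs : s * (1 + eps) = 1 + eps / 2) by (unfold s; field; lra).
    exists (Rmax r s). pose proof (Rmax_l r s). pose proof (Rmax_r r s).
    split; [split; [lra|apply Rmax_lub_lt; [lra|nra]]|].
    intros x Hx. specialize (H x ltac:(lra)). simpl.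
    assert (0 < x ^ j) by (apply pow_lt; lra).
    assert (s * (1 + eps) <= x * (1 + eps)) by (apply Rmult_le_compat_r; lra).
    assert ((1 + eps / 2) * x ^ j <= x * (1 + eps) * x ^ j) by (apply Rmult_le_compat_r; lra).
    lra.
Qed.

(** The quotient [w / z^j] has a removable singularity at 0, and near the unit circle its
    modulus is at most [1 / |z|^j], which tends to 1. *)
Lemma schwarz_order : forall j w, class_Bj j w ->
  forall z, Cmod z < 1 -> Cmod (w z) <= Cmod z ^ j.
Proof.
  intros j w [[Hw Hsup] [Hzero _]].
  pose proof (proj1 (sup_norm_le_1 w) Hsup) as Hbd.
  destruct (analytic_on_disk_at w (RtoC 0) Hw ltac:(rewrite Cmod_0; lra)) as [c [d HS]].
  assert (HS' : has_series c d w).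
  { destruct HS as [Hd H]. split; [exact Hd|]. intros z Hz. specialize (H z Hz). cbv beta in H.
    now rewrite Cplus_0_l in H. }
  assert (H0 : forall n, (n < j)%nat -> c n = RtoC 0).
  { intros n Hn. apply (proj1 (derive_n_at_0 n c d w HS')). now apply Hzero. }
  destruct (has_series_factor_pow j c d w HS' H0) as [E [HE HEq]].
  destruct (patch_at (fun z => w z / z ^ j)%C (RtoC 0) (E (RtoC 0))) as [phi [Hphi0 Hphi]].
  assert (Hmax : forall z, Cmod z < 1 -> Cmod (phi z) <= 1).
  { apply max_principle.
    - intros z0 Hz0. destruct (classic (z0 = RtoC 0)) as [->|Hne].
      + exists E, (fun _ => RtoC 1), d. split; [|split; [apply analytic_at_const|]].
        * exists (fun n => c (j + n)%nat), d. split; [apply HE|]. intros h Hh.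
          rewrite Cplus_0_l. now apply HE.
        * split; [apply C1_nz|]. split; [apply HE|]. intros z Hz.
          replace (z - 0)%C with z in Hz by ring.
          destruct (classic (z = RtoC 0)) as [->|Hz0']; [rewrite Hphi0; ring|].
          rewrite Hphi, HEq by assumption. field. now apply Cpow_nz.
      + exists w, (fun z => z ^ j)%C, (Cmod z0).
        split; [now apply analytic_on_disk_at|]. split; [apply analytic_at_pow|].
        split; [now apply Cpow_nz|]. split; [now apply Cmod_gt_0|]. intros z Hz.
        assert (Hz' : z <> RtoC 0).
        { intro Heq. rewrite Heq in Hz. replace (0 - z0)%C with (- z0)%C in Hz by ring.
          rewrite Cmod_opp in Hz. lra. }
        rewrite Hphi by exact Hz'. field. now apply Cpow_nz.
    - intros eps He. destruct (pow_near_1 j eps He) as [r [Hr H]].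
      exists r. split; [lra|]. intros z Hrz Hz.
      assert (Hz' : z <> RtoC 0) by (apply Cmod_gt_0; lra).
      rewrite Hphi by exact Hz'. rewrite Cmod_div by now apply Cpow_nz.
      rewrite Cmod_pow. specialize (H (Cmod z) ltac:(lra)). specialize (Hbd z Hz).
      assert (0 < Cmod z ^ j) by (apply pow_lt; lra).
      apply (Rmult_le_reg_r (Cmod z ^ j)); [assumption|].
      replace (Cmod (w z) / Cmod z ^ j * Cmod z ^ j) with (Cmod (w z)) by (field; lra). lra. }
  intros z Hz. destruct (classic (z = RtoC 0)) as [->|Hne].
  - rewrite HEq by (rewrite Cmod_0; apply HE). specialize (Hmax (RtoC 0) Hz). rewrite Hphi0 in Hmax.
    rewrite Cmod_mult, Cmod_pow. assert (0 <= Cmod (RtoC 0) ^ j) by (apply pow_le, Cmod_ge_0). nra.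
  - specialize (Hmax z Hz). rewrite Hphi in Hmax by exact Hne.
    rewrite Cmod_div, Cmod_pow in Hmax by now apply Cpow_nz.
    assert (0 < Cmod z ^ j) by (apply pow_lt; now apply Cmod_gt_0).
    apply (Rmult_le_reg_r (/ Cmod z ^ j)); [now apply Rinv_0_lt_compat|].
    rewrite Rinv_r by lra. exact Hmax.
Qed.

(** The identity behind the invariance of the disk: it compares numerator and
    denominator of the automorphism [(b - a) / (1 - Cconj a b)]. *)
Lemma blaschke_identity : forall a b : C,
  Cmod (1 - Cconj a * b)%C * Cmod (1 - Cconj a * b)%C - Cmod (b - a)%C * Cmod (b - a)%C
  = (1 - Cmod a * Cmod a) * (1 - Cmod b * Cmod b).
Proof.
  intros a b. rewrite !Cmod_sq. destruct a, b. simpl. ring.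
Qed.

Lemma Cmod_lt_1_nz : forall a b : C, Cmod a < 1 -> Cmod b <= 1 -> (1 - Cconj a * b)%C <> RtoC 0.
Proof.
  intros a b Ha Hb. apply Cmod_gt_0.
  pose proof (Cmod_triangle_rev 1 (Cconj a * b)) as H.
  rewrite Cmod_1, Cmod_mult, Cmod_conj in H.
  pose proof (Cmod_ge_0 a). pose proof (Cmod_ge_0 b). nra.
Qed.

Lemma blaschke_le : forall a b : C, Cmod a <= 1 -> Cmod b <= 1 ->
  Cmod (b - a)%C <= Cmod (1 - Cconj a * b)%C.
Proof.
  intros a b Ha Hb. pose proof (blaschke_identity a b) as H.
  pose proof (Cmod_ge_0 a). pose proof (Cmod_ge_0 b).
  pose proof (Cmod_ge_0 (b - a)%C). pose proof (Cmod_ge_0 (1 - Cconj a * b)%C).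
  assert (0 <= (1 - Cmod a * Cmod a) * (1 - Cmod b * Cmod b)) by (apply Rmult_le_pos; nra).
  nra.
Qed.

(** By the identity the squares of the two sides differ by
    [(1 - |w|^2) (1 - |z|^2)], which is small while [|z - w|] stays away from 0. *)
Lemma blaschke_near_boundary : forall (w : C) eps, Cmod w < 1 -> 0 < eps ->
  exists r, Cmod w < r /\ r < 1 /\ forall z, r <= Cmod z -> Cmod z < 1 ->
    Cmod (1 - Cconj w * z)%C <= (1 + eps) * Cmod (z - w)%C.
Proof.
  intros w eps Hw He. pose proof (Cmod_ge_0 w) as Hw0.
  set (b := 1 - Cmod w). assert (Hb : 0 < b <= 1) by (unfold b; lra).
  (* The first bound keeps [|z - w|] above [b/2], the second makes the difference of the
     squares at most [2 eps |z - w|^2]. *)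
  set (r := 1 - Rmin (b / 2) (eps * (b * b) / 4)).
  assert (Hbb : 0 < eps * (b * b) / 4) by (assert (0 < eps * (b * b)) by (repeat apply Rmult_lt_0_compat; lra); lra).
  assert (Hr : 0 < 1 - r /\ 1 - r <= b / 2 /\ 1 - r <= eps * (b * b) / 4).
  { unfold r. pose proof (Rmin_l (b / 2) (eps * (b * b) / 4)).
    pose proof (Rmin_r (b / 2) (eps * (b * b) / 4)).
    pose proof (Rmin_pos (b / 2) (eps * (b * b) / 4) ltac:(lra) Hbb). lra. }
  exists r. split; [unfold b in *; lra|]. split; [lra|]. intros z Hrz Hz.
  pose proof (blaschke_identity w z) as HI.
  pose proof (Cmod_triangle_rev z w) as HT.
  set (x := Cmod (z - w)%C) in *. set (y := Cmod (1 - Cconj w * z)%C) in *.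
  assert (Hx : b / 2 <= x) by (unfold b in *; lra).
  assert (Hy : 0 <= y) by apply Cmod_ge_0.
  assert (Hz2 : 1 - Cmod z * Cmod z <= 2 * (1 - r)) by nra.
  assert (Hprod : (1 - Cmod w * Cmod w) * (1 - Cmod z * Cmod z) <= 2 * (1 - r)).
  { assert (0 <= 1 - Cmod w * Cmod w <= 1) by nra. assert (0 <= 1 - Cmod z * Cmod z) by nra. nra. }
  assert (Hxx : b * b / 4 <= x * x) by nra.
  assert (Hex : eps * (b * b / 4) <= eps * (x * x)) by (apply Rmult_le_compat_l; lra).
  apply Rnot_lt_le. intro Hlt.
  assert ((1 + eps) * x * ((1 + eps) * x) < y * y).
  { apply Rmult_le_0_lt_compat; try lra; apply Rmult_le_pos; lra. }
  assert (0 <= eps * eps * (x * x)) by (repeat apply Rmult_le_pos; lra).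
  nra.
Qed.

Lemma analytic_at_minus_const : forall f a z0, analytic_at f z0 -> analytic_at (fun z => f z - a)%C z0.
Proof.
  intros f a z0 Hf. exact (analytic_at_plus f (fun _ => - a)%C z0 Hf (analytic_at_const _ z0)).
Qed.

(** The quotient of the automorphism sending [h w] to 0, taken at [h z], by the one
    sending [w] to 0, taken at [z], has a removable singularity at [w] and satisfies the
    maximum principle.  Its value at [w] gives the bound for the derivative. *)
Lemma schwarz_pick : forall (h : C -> C), analytic_on_disk h ->
  (forall z, Cmod z < 1 -> Cmod (h z) < 1) ->
  forall w, Cmod w < 1 ->
  Cmod (C_derive h w) * (1 - Cmod w * Cmod w) <= 1 - Cmod (h w) * Cmod (h w) /\
  forall z, Cmod z < 1 ->
    Cmod (h z - h w)%C * Cmod (1 - Cconj w * z)%C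
    <= Cmod (z - w)%C * Cmod (1 - Cconj (h w) * h z)%C.
Proof.
  intros h Hh Hbd w Hw.
  destruct (analytic_at_factor h w (analytic_on_disk_at h w Hh Hw)) as [E [d [Hd [HE [HEw HEq]]]]].
  assert (Hnz : forall z, Cmod z < 1 -> (1 - Cconj (h w) * h z)%C <> RtoC 0).
  { intros z Hz. apply Cmod_lt_1_nz; [now apply Hbd|left; now apply Hbd]. }
  destruct (patch_at (fun z => (h z - h w) * (1 - Cconj w * z) / ((z - w) * (1 - Cconj (h w) * h z)))%C w
     ((1 - Cconj w * w) * E w / (1 - Cconj (h w) * h w))%C) as [phi [Hphi0 Hphi]].
  assert (HQ : forall z0, Cmod z0 < 1 -> analytic_at (fun z => 1 - Cconj (h w) * h z)%C z0).
  { intros z0 Hz0. apply (analytic_at_ext_loc (fun z => - Cconj (h w) * h z - - (1))%C _ z0 1); [lra|intros; ring|].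
    apply analytic_at_minus_const, analytic_at_scal. now apply analytic_on_disk_at. }
  assert (Hin : forall z0 z, Cmod z0 < 1 -> Cmod (z - z0) < 1 - Cmod z0 -> Cmod z < 1).
  { intros z0 z Hz0 Hz. pose proof (Cmod_triangle_rev z z0). lra. }
  assert (Hmax : forall z, Cmod z < 1 -> Cmod (phi z) <= 1).
  { apply max_principle.
    - intros z0 Hz0. destruct (classic (z0 = w)) as [->|Hne].
      + exists (fun z => (1 + - Cconj w * z) * E z)%C, (fun z => 1 - Cconj (h w) * h z)%C, (Rmin d (1 - Cmod w)).
        split; [now apply analytic_at_mult_affine|]. split; [now apply HQ|].
        split; [now apply Hnz|]. split; [apply Rmin_pos; lra|]. intros z Hz.
        pose proof (Rmin_l d (1 - Cmod w)). pose proof (Rmin_r d (1 - Cmod w)).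
        assert (Hz1 : Cmod z < 1) by (apply (Hin w); lra).
        destruct (classic (z = w)) as [->|Hzw].
        * rewrite Hphi0. field. now apply Hnz.
        * rewrite Hphi by exact Hzw.
          transitivity ((h z - h w) * (1 - Cconj w * z) / (z - w))%C.
          -- field. split; solve [now apply Hnz | now apply Cminus_eq_contra].
          -- rewrite (HEq z) by lra. field. now apply Cminus_eq_contra.
      + exists (fun z => (1 + - Cconj w * z) * (h z - h w))%C, (fun z => (- w + 1 * z) * (1 - Cconj (h w) * h z))%C,
          (Rmin (Cmod (z0 - w)) (1 - Cmod z0)).
        split; [apply analytic_at_mult_affine, analytic_at_minus_const; now apply analytic_on_disk_at|].
        split; [apply analytic_at_mult_affine; now apply HQ|].
        assert (Hzw0 : 0 < Cmod (z0 - w)) by (apply Cmod_gt_0; now apply Cminus_eq_contra).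
        split.
        { apply Cmult_neq_0; [|now apply Hnz].
          replace (- w + 1 * z0)%C with (z0 - w)%C by ring. now apply Cmod_gt_0. }
        split; [apply Rmin_pos; lra|]. intros z Hz.
        pose proof (Rmin_l (Cmod (z0 - w)) (1 - Cmod z0)). pose proof (Rmin_r (Cmod (z0 - w)) (1 - Cmod z0)).
        assert (Hz1 : Cmod z < 1) by (apply (Hin z0); lra).
        assert (Hzw : z <> w).
        { intro Heq. rewrite Heq, Cmod_minus_sym in Hz. lra. }
        rewrite Hphi by exact Hzw. field. split; solve [now apply Hnz | now apply Cminus_eq_contra].
    - intros eps He. destruct (blaschke_near_boundary w eps Hw He) as [r [Hwr [Hr H]]].
      exists r. split; [exact Hr|]. intros z Hrz Hz.
      assert (Hzw : z <> w) by (intro Heq; rewrite Heq in Hrz; lra).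
      pose proof (Cminus_eq_contra z w Hzw) as Hzw'.
      rewrite Hphi by exact Hzw.
      rewrite Cmod_div by (apply Cmult_neq_0; [exact Hzw'|now apply Hnz]).
      rewrite !Cmod_mult. specialize (H z Hrz Hz).
      pose proof (blaschke_le (h w) (h z) (Rlt_le _ _ (Hbd w Hw)) (Rlt_le _ _ (Hbd z Hz))) as HB.
      pose proof (proj1 (Cmod_gt_0 _) Hzw') as H1. pose proof (proj1 (Cmod_gt_0 _) (Hnz z Hz)) as H2.
      apply (Rmult_le_reg_r (Cmod (z - w) * Cmod (1 - Cconj (h w) * h z))); [now apply Rmult_lt_0_compat|].
      unfold Rdiv. rewrite Rmult_assoc, Rinv_l, Rmult_1_r by (apply Rgt_not_eq; now apply Rmult_lt_0_compat).
      pose proof (Cmod_ge_0 (h z - h w)%C). pose proof (Cmod_ge_0 (1 - Cconj w * z)%C).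
      apply Rle_trans with (Cmod (1 - Cconj (h w) * h z) * ((1 + eps) * Cmod (z - w))).
      + apply Rmult_le_compat; lra.
      + right; ring. }
  assert (Hone : forall a : C, (1 - Cconj a * a)%C = RtoC (1 - Cmod a * Cmod a)).
  { intro a. rewrite RtoC_minus, RtoC_mult. f_equal. rewrite <- RtoC_mult.
    rewrite Cmult_comm, <- Cmod2_conj. f_equal. ring. }
  split.
  - specialize (Hmax w Hw). rewrite Hphi0, HEw in Hmax.
    rewrite Cmod_div, Cmod_mult in Hmax by now apply Hnz.
    rewrite !Hone, !Cmod_R in Hmax.
    pose proof (Cmod_ge_0 w). pose proof (Cmod_ge_0 (h w)). pose proof (Hbd w Hw).
    assert (Hpos : 0 < 1 - Cmod (h w) * Cmod (h w)) by nra.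
    rewrite (Rabs_pos_eq (1 - Cmod (h w) * Cmod (h w))) in Hmax by lra.
    rewrite (Rabs_pos_eq (1 - Cmod w * Cmod w)) in Hmax by nra.
    apply (Rmult_le_compat_r (1 - Cmod (h w) * Cmod (h w))) in Hmax; [|lra].
    unfold Rdiv in Hmax. rewrite Rmult_assoc, Rinv_l in Hmax by lra. lra.
  - intros z Hz. destruct (classic (z = w)) as [->|Hzw].
    + rewrite !Cmod_self_minus. lra.
    + specialize (Hmax z Hz). pose proof (Cminus_eq_contra z w Hzw) as Hzw'.
      rewrite Hphi in Hmax by exact Hzw.
      rewrite Cmod_div in Hmax by (apply Cmult_neq_0; [exact Hzw'|now apply Hnz]).
      rewrite !Cmod_mult in Hmax.
      pose proof (proj1 (Cmod_gt_0 _) Hzw') as H1. pose proof (proj1 (Cmod_gt_0 _) (Hnz z Hz)) as H2.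
      set (D := Cmod (z - w) * Cmod (1 - Cconj (h w) * h z)) in *.
      assert (HD : 0 < D) by now apply Rmult_lt_0_compat.
      apply (Rmult_le_compat_r D) in Hmax; [|lra].
      unfold Rdiv in Hmax. rewrite Rmult_assoc, Rinv_l in Hmax by lra. lra.
Qed.

(** The two-point inequality with base point 0 says that [h z] lies in a pseudohyperbolic
    disk around [h 0]; the point of that disk farthest from 0 has the modulus
    [(A + r) / (1 + A r)]. *)
Lemma schwarz_pick_growth : forall (h : C -> C), analytic_on_disk h ->
  (forall z, Cmod z < 1 -> Cmod (h z) < 1) ->
  forall z, Cmod z < 1 ->
  Cmod (h z) * (1 + Cmod (h (RtoC 0)) * Cmod z) <= Cmod (h (RtoC 0)) + Cmod z.
Proof.
  intros h Hh Hbd z Hz.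
  assert (H0 : Cmod (RtoC 0) < 1) by (rewrite Cmod_0; lra).
  destruct (schwarz_pick h Hh Hbd (RtoC 0) H0) as [_ H]. specialize (H z Hz).
  replace (1 - Cconj 0 * z)%C with (RtoC 1) in H.
  2:{ apply injective_projections; destruct z; simpl; ring. }
  replace (z - 0)%C with z in H by ring. rewrite Cmod_1, Rmult_1_r in H.
  pose proof (blaschke_identity (h (RtoC 0)) (h z)) as HI.
  pose proof (Cmod_triangle_rev (h z) (h (RtoC 0))) as HT.
  pose proof (Hbd z Hz) as HX. pose proof (Hbd _ H0) as HA.
  pose proof (Cmod_ge_0 (h z)). pose proof (Cmod_ge_0 (h (RtoC 0))). pose proof (Cmod_ge_0 z).
  pose proof (Cmod_ge_0 (1 - Cconj (h (RtoC 0)) * h z)%C) as Hy.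
  set (X := Cmod (h z)) in *. set (A := Cmod (h (RtoC 0))) in *. set (r := Cmod z) in *.
  set (x := Cmod (h z - h (RtoC 0))%C) in *. set (y := Cmod (1 - Cconj (h (RtoC 0)) * h z)%C) in *.
  destruct (Rle_or_lt X A) as [HXA|HXA].
  { assert (X * A <= 1) by nra. assert (X * A * r <= 1 * r) by (apply Rmult_le_compat_r; lra). lra. }
  assert (Hx2 : x * x <= r * r * (y * y)).
  { replace (r * r * (y * y)) with ((r * y) * (r * y)) by ring. apply Rmult_le_compat; lra. }
  assert (Hxr : x * x * (1 - r * r) <= r * r * ((1 - A * A) * (1 - X * X))) by (rewrite <- HI; lra).
  assert (Hd : (X - A) * (X - A) * (1 - r * r) <= x * x * (1 - r * r)).
  { apply Rmult_le_compat_r; [nra|]. apply Rmult_le_compat; lra. }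
  (* By the triangle inequality the worst case is that of aligned [h z] and [h 0]. *)
  assert (Hs : (X - A) * (X - A) <= (r * (1 - A * X)) * (r * (1 - A * X))) by nra.
  assert (0 <= r * (1 - A * X)) by (apply Rmult_le_pos; nra).
  assert (X - A <= r * (1 - A * X)) by nra.
  lra.
Qed.

(** * Parseval's formula *)

Lemma expi_conj : forall t, Cconj (expi t) = expi (- t).
Proof. intro t. unfold expi, Cconj. simpl. now rewrite cos_neg, sin_neg. Qed.

Lemma expi_period : forall n, expi (INR n * (2 * PI)) = RtoC 1.
Proof.
  intro n. rewrite <- expi_pow. replace (expi (2 * PI)) with (RtoC 1).
  - apply Cpow_1_l.
  - unfold expi. now rewrite cos_2PI, sin_2PI.
Qed.

Lemma expi_neq_1 : forall t, 0 < t < 2 * PI -> expi t <> RtoC 1.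
Proof.
  intros t Ht H. apply (f_equal fst) in H. simpl in H.
  replace t with (2 * (t / 2)) in H by field. rewrite cos_2a_sin in H.
  pose proof (sin_gt_0 (t / 2) ltac:(lra) ltac:(lra)). nra.
Qed.

Lemma geometric_sum : forall (w : C) n,
  ((w - 1) * sum_n (fun k => w ^ k)%C n)%C = (w ^ S n - 1)%C.
Proof.
  intros w n; induction n as [|n IH].
  - rewrite sum_O, Cpow_1_r. change (w ^ 0)%C with (RtoC 1). ring.
  - rewrite sum_Sn_C, Cmult_plus_distr_l, IH, (Cpow_S w (S n)). ring.
Qed.

Definition root_of_unity (M k : nat) : C := expi (INR k * (2 * PI / INR (S M))).

(** The summands are the powers of a number different from 1 whose power [M+1] is 1. *)
Lemma root_of_unity_orthogonal : forall M n m, (n < m)%nat -> (m <= M)%nat ->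
  sum_n (fun k => root_of_unity M k ^ n * Cconj (root_of_unity M k ^ m))%C M = RtoC 0.
Proof.
  intros M n m Hnm HmM.
  assert (HM : 0 < INR (S M)) by (apply lt_0_INR; lia).
  set (t := INR (m - n) * (2 * PI / INR (S M))).
  assert (Ht : 0 < t < 2 * PI).
  { pose proof PI_RGT_0. unfold t.
    assert (0 < INR (m - n)) by (apply lt_0_INR; lia).
    assert (INR (m - n) < INR (S M)) by (apply lt_INR; lia).
    split.
    - apply Rmult_lt_0_compat; [assumption|]. apply Rdiv_lt_0_compat; lra.
    - apply (Rmult_lt_reg_r (INR (S M))); [exact HM|].
      replace (INR (m - n) * (2 * PI / INR (S M)) * INR (S M)) with (INR (m - n) * (2 * PI)) by (field; lra).
      nra. }
  set (w := Cconj (expi t)).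
  assert (Hw : w <> RtoC 1).
  { intro H. apply (expi_neq_1 t Ht). rewrite <- (Cconj_conj (expi t)). fold w. rewrite H.
    unfold Cconj; simpl. now rewrite Ropp_0. }
  assert (HwM : (w ^ S M)%C = RtoC 1).
  { unfold w. rewrite <- Cpow_conj, expi_pow. unfold t.
    replace (INR (S M) * (INR (m - n) * (2 * PI / INR (S M)))) with (INR (m - n) * (2 * PI)) by (field; lra).
    rewrite expi_period. unfold Cconj; simpl. now rewrite Ropp_0. }
  rewrite (sum_n_ext _ (fun k => w ^ k)%C).
  - apply NNPP. intro Hne. apply (Cmult_neq_0 (w - 1) (sum_n (fun k => w ^ k)%C M)).
    + now apply Cminus_eq_contra.
    + exact Hne.
    + rewrite geometric_sum, HwM. ring.
  - intro k. unfold w, root_of_unity.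
    rewrite <- Cpow_conj, !expi_pow, !expi_conj, <- expi_plus. f_equal.
    unfold t. rewrite minus_INR by lia. ring.
Qed.

Lemma fst_sum_n : forall (u : nat -> C) n, fst (sum_n u n) = sum_n (fun k => fst (u k)) n.
Proof.
  intros u n; induction n as [|n IH].
  - now rewrite !sum_O.
  - rewrite sum_Sn_C, sum_Sn, <- IH. reflexivity.
Qed.

Lemma Cmod_plus_sq : forall a b : C,
  Cmod (a + b)%C ^ 2 = Cmod a ^ 2 + Cmod b ^ 2 + 2 * fst (a * Cconj b)%C.
Proof.
  intros a b. rewrite <- !Rsqr_pow2. unfold Rsqr. rewrite !Cmod_sq. destruct a, b. simpl. ring.
Qed.

Lemma sum_n_mult_l_C : forall (a : C) (u : nat -> C) n,
  sum_n (fun k => a * u k)%C n = (a * sum_n u n)%C.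
Proof.
  intros a u n; induction n as [|n IH].
  - now rewrite !sum_O.
  - rewrite !sum_Sn_C, IH. Cring.
Qed.

Lemma sum_n_mult_l_R : forall (a : R) (u : nat -> R) n,
  sum_n (fun k => a * u k) n = a * sum_n u n.
Proof. intros a u n. exact (sum_n_mult_l (K := R_Ring) a u n). Qed.

Lemma sum_n_zero_C : forall n, sum_n (fun _ => RtoC 0) n = RtoC 0.
Proof.
  induction n as [|n IH]; [now rewrite sum_O|]. rewrite sum_Sn_C, IH. Cring.
Qed.

(** For degree at most [M] the [M+1] roots of unity integrate exactly. *)
Lemma parseval_polynomial : forall M (x : nat -> C) L, (L <= M)%nat ->
  sum_n (fun k => Cmod (sum_n (fun n => x n * root_of_unity M k ^ n)%C L) ^ 2) M
  = INR (S M) * sum_n (fun n => Cmod (x n) ^ 2) L.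
Proof.
  intros M x L; induction L as [|L IH]; intro HL.
  - rewrite sum_O. rewrite (sum_n_ext _ (fun _ => Cmod (x 0%nat) ^ 2)).
    + apply sum_n_const.
    + intro k. rewrite sum_O. change (root_of_unity M k ^ 0)%C with (RtoC 1). now rewrite Cmult_1_r.
  - rewrite sum_Sn. change plus with Rplus. rewrite Rmult_plus_distr_l, <- IH by lia.
    rewrite <- (sum_n_const M (Cmod (x (S L)) ^ 2)).
    set (e := root_of_unity M). set (p := fun k => sum_n (fun n => x n * e k ^ n)%C L).
    (* The new monomial is orthogonal to all previous ones. *)
    assert (Hcross : sum_n (fun k => fst (p k * Cconj (x (S L) * e k ^ S L))%C) M = 0).
    { rewrite <- fst_sum_n.
      rewrite (sum_n_ext _ (fun k => sum_n (fun n => (x n * Cconj (x (S L))) * (e k ^ n * Cconj (e k ^ S L)))%C L)).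
      - rewrite sum_n_switch.
        rewrite (sum_n_ext_loc _ (fun _ => RtoC 0)).
        + now rewrite sum_n_zero_C.
        + intros n Hn. rewrite sum_n_mult_l_C.
          unfold e. rewrite root_of_unity_orthogonal by lia. Cring.
      - intro k. unfold p. rewrite Cmult_comm, <- sum_n_mult_l_C. apply sum_n_ext. intro n.
        rewrite Cmult_conj. Cring. }
    rewrite (sum_n_ext _ (fun k => plus (plus (Cmod (p k) ^ 2) (Cmod (x (S L)) ^ 2))
                                        (2 * fst (p k * Cconj (x (S L) * e k ^ S L))%C))).
    + rewrite !sum_n_plus. change plus with Rplus.
      rewrite sum_n_mult_l_R, Hcross. unfold p. match goal with |- @eq _ ?a ?b => change (@eq R a b) end. ring.
    + intro k. rewrite sum_Sn_C. change plus with Rplus.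
      fold (p k). rewrite Cmod_plus_sq. f_equal. f_equal.
      unfold e, root_of_unity. rewrite Cmod_mult, Cmod_pow, Cmod_expi, pow1. ring.
Qed.

Definition circle_mean (M : nat) (r : R) (phi : C -> R) : R :=
  sum_n (fun k => phi (RtoC r * root_of_unity M k)%C) M / INR (S M).

Lemma ex_series_coef_sq : forall c r, coef_bounded c 1 -> 0 <= r < 1 ->
  ex_series (fun n => (Cmod (c n) * r ^ n) ^ 2).
Proof.
  intros c r Hc Hr. destruct (coef_bounded_terms c 1 r Hc Hr) as [B [y [HB [Hy H]]]].
  apply (ex_series_le (K := R_AbsRing) (V := R_CompleteNormedModule) _ (fun n => B ^ 2 * (y * y) ^ n)).
  - intro n. change norm with Rabs.
    assert (0 <= Cmod (c n) * r ^ n) by (apply Rmult_le_pos; [apply Cmod_ge_0|apply pow_le; lra]).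
    rewrite Rabs_pos_eq by apply pow2_ge_0.
    replace (B ^ 2 * (y * y) ^ n) with ((B * y ^ n) ^ 2) by (rewrite !Rpow_mult_distr; ring).
    apply pow_incr. split; [assumption|apply H].
  - exists (B ^ 2 / (1 - y * y)). apply is_series_geom_scal. nra.
Qed.

(** Parseval's formula through means over roots of unity: for the polynomial parts the
    means are exact, and the tails are uniformly small on the circle. *)
Lemma parseval_mean : forall c F r, has_series c 1 F -> 0 <= r < 1 ->
  is_lim_seq (fun M => circle_mean M r (fun z => Cmod (F z) ^ 2))
             (Series (fun n => (Cmod (c n) * r ^ n) ^ 2)).
Proof.
  intros c F r HF Hr. pose proof (has_series_coef_bounded c 1 F HF) as Hc.
  destruct (coef_bounded_terms c 1 r Hc Hr) as [B [y [HB [Hy Hterm]]]].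
  destruct (has_series_bounded c 1 F r HF) as [B' [HB' Hbd]]; [lra|].
  set (T := B / (1 - y)).
  assert (HT : 0 <= T) by (apply Rmult_le_pos; [lra|left; apply Rinv_0_lt_compat; lra]).
  set (S_ := fun M z => sum_n (fun n => c n * z ^ n)%C M).
  assert (Htail : forall M z, Cmod z = r -> Cmod (F z - S_ M z)%C <= T * y ^ S M).
  { intros M z Hz.
    apply (Cseries_le (fun k => c (S M + k)%nat * z ^ (S M + k))%C _ (fun k => B * y ^ S M * y ^ k)).
    - intro k. rewrite Cmod_mult, Cmod_pow, Hz.
      replace (B * y ^ S M * y ^ k) with (B * y ^ (S M + k)) by (rewrite pow_add; ring). apply Hterm.
    - apply (is_series_incr_n (K := C_AbsRing) (V := C_NormedModule) (fun n => c n * z ^ n)%C (S M)); [lia|].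
      match goal with |- is_series _ ?t => replace t with (F z) end.
      + apply is_Cpseries_series, HF. lra.
      + change (F z = ((F z - S_ M z) + S_ M z)%C). ring.
    - replace (T * y ^ S M) with (B * y ^ S M / (1 - y)) by (unfold T; field; lra).
      now apply is_series_geom_scal. }
  set (K := T * (2 * B' + T)).
  assert (Hpt : forall M z, Cmod z = r -> Rabs (Cmod (F z) ^ 2 - Cmod (S_ M z) ^ 2) <= K * y ^ S M).
  { intros M z Hz. pose proof (Htail M z Hz) as Ht. pose proof (Hbd z ltac:(lra)) as HFb.
    pose proof (Cmod_triangle_rev (F z) (S_ M z)) as H1.
    pose proof (Cmod_triangle_rev (S_ M z) (F z)) as H2. rewrite Cmod_minus_sym in H2.
    pose proof (Cmod_ge_0 (F z)). pose proof (Cmod_ge_0 (S_ M z)). pose proof (Cmod_ge_0 (F z - S_ M z)%C).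
    assert (Hy1 : 0 <= y ^ S M <= 1).
    { split; [apply pow_le; lra|]. rewrite <- (pow1 (S M)). apply pow_incr; lra. }
    assert (HTy : 0 <= T * y ^ S M <= T) by (split; [apply Rmult_le_pos; lra|nra]).
    replace (Cmod (F z) ^ 2 - Cmod (S_ M z) ^ 2) with ((Cmod (F z) - Cmod (S_ M z)) * (Cmod (F z) + Cmod (S_ M z))) by ring.
    rewrite Rabs_mult, (Rabs_pos_eq (Cmod (F z) + Cmod (S_ M z))) by lra.
    replace (K * y ^ S M) with ((T * y ^ S M) * (2 * B' + T)) by (unfold K; ring).
    apply Rmult_le_compat; [apply Rabs_pos|lra| |lra].
    apply Rabs_le; lra. }
  set (part := fun M => sum_n (fun n => (Cmod (c n) * r ^ n) ^ 2) M).
  assert (HM0 : forall M, 0 < INR (S M)) by (intro M; apply lt_0_INR; lia).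
  assert (Hmod : forall M k, Cmod (RtoC r * root_of_unity M k) = r).
  { intros M k. unfold root_of_unity. rewrite Cmod_mult, Cmod_expi, Cmod_R, Rabs_pos_eq; lra. }
  assert (Hpart : forall M, part M = circle_mean M r (fun z => Cmod (S_ M z) ^ 2)).
  { intro M. unfold circle_mean, S_.
    rewrite (sum_n_ext _ (fun k => Cmod (sum_n (fun n => (c n * RtoC r ^ n) * root_of_unity M k ^ n)%C M) ^ 2)).
    - rewrite parseval_polynomial by lia. unfold part.
      rewrite (sum_n_ext (fun n => Cmod (c n * RtoC r ^ n)%C ^ 2) (fun n => (Cmod (c n) * r ^ n) ^ 2)).
      + unfold Rdiv. rewrite (Rmult_comm (INR (S M))), Rmult_assoc, Rinv_r, Rmult_1_r; [reflexivity|apply Rgt_not_eq, HM0].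
      + intro n. rewrite Cmod_mult, Cmod_pow, Cmod_R, Rabs_pos_eq; lra.
    - intro k. f_equal. f_equal. apply sum_n_ext. intro n. rewrite Cpow_mult_l. Cring. }
  assert (Hdiff : forall M, Rabs (circle_mean M r (fun z => Cmod (F z) ^ 2) - part M) <= K * y ^ S M).
  { intro M. rewrite Hpart. unfold circle_mean.
    set (u := fun k => Cmod (F (RtoC r * root_of_unity M k)%C) ^ 2).
    set (v := fun k => Cmod (S_ M (RtoC r * root_of_unity M k)%C) ^ 2).
    change (Rabs (sum_n u M / INR (S M) - sum_n v M / INR (S M)) <= K * y ^ S M).
    assert (Huv : Rabs (sum_n u M - sum_n v M) <= INR (S M) * (K * y ^ S M)).
    { rewrite <- sum_n_const.
      assert (Hk : forall k, Rabs (u k - v k) <= K * y ^ S M) by (intro k; apply Hpt, Hmod).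
      clearbody u v. set (e := K * y ^ S M) in *. clearbody e. clear - Hk.
      induction M as [|M IH].
      - rewrite !sum_O. apply Hk.
      - rewrite !sum_Sn. change plus with Rplus. specialize (Hk (S M)).
        apply Rabs_le_between in IH. apply Rabs_le_between in Hk. apply Rabs_le_between. lra. }
    specialize (HM0 M).
    replace (sum_n u M / INR (S M) - sum_n v M / INR (S M)) with ((sum_n u M - sum_n v M) * / INR (S M)) by (field; lra).
    rewrite Rabs_mult, (Rabs_pos_eq (/ INR (S M))) by (left; now apply Rinv_0_lt_compat).
    apply (Rmult_le_reg_r (INR (S M))); [exact HM0|]. rewrite Rmult_assoc, Rinv_l by lra. lra. }
  apply (is_lim_seq_ext (fun M => part M + (circle_mean M r (fun z => Cmod (F z) ^ 2) - part M))).
  { intro M. ring. }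
  replace (Finite (Series (fun n => (Cmod (c n) * r ^ n) ^ 2)))
    with (Finite (Series (fun n => (Cmod (c n) * r ^ n) ^ 2) + 0)) by (f_equal; ring).
  apply is_lim_seq_plus'.
  - exact (Series_correct _ (ex_series_coef_sq c r Hc Hr)).
  - apply is_lim_seq_abs_0.
    apply (is_lim_seq_le_le (fun _ => 0) _ (fun M => K * y ^ S M)).
    + intro M. split; [apply Rabs_pos|apply Hdiff].
    + apply is_lim_seq_const.
    + replace (Finite 0) with (Rbar_mult K 0) by (simpl; f_equal; ring).
      apply is_lim_seq_scal_l. apply is_lim_seq_incr_1 with (u := fun n => y ^ n).
      apply is_lim_seq_geom. rewrite Rabs_pos_eq; lra.
Qed.

(** The means over roots of unity are monotone; Parseval's formula passes to the limit. *)
Lemma series_sq_le : forall c d F G r, has_series c 1 F -> has_series d 1 G ->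
  (forall z, Cmod z < 1 -> Cmod (F z) <= Cmod (G z)) -> 0 <= r < 1 ->
  Series (fun n => (Cmod (c n) * r ^ n) ^ 2) <= Series (fun n => (Cmod (d n) * r ^ n) ^ 2).
Proof.
  intros c d F G r HF HG Hle Hr.
  refine (is_lim_seq_le _ _ _ _ _ (parseval_mean c F r HF Hr) (parseval_mean d G r HG Hr)).
  intro M. unfold circle_mean,  Rdiv. apply Rmult_le_compat_r.
  - left. apply Rinv_0_lt_compat, lt_0_INR. lia.
  - apply sum_n_m_le. intro k. apply pow_incr. split; [apply Cmod_ge_0|]. apply Hle.
    unfold root_of_unity. rewrite Cmod_mult, Cmod_expi, Cmod_R, Rabs_pos_eq; lra.
Qed.

(** * Bounds for the coefficients of a bounded function *)

Definition one_coef (k : nat) : C := match k with O => RtoC 1 | S _ => RtoC 0 end.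

Lemma has_series_one : forall d, 0 < d -> has_series one_coef d (fun _ => RtoC 1).
Proof.
  intros d Hd. split; [exact Hd|]. intros z _. apply is_Cpseries_series, is_Cseries_eps.
  intros eps He. exists O. intros n _. replace (sum_n _ n) with (RtoC 1); [now rewrite Cmod_self_minus|].
  induction n as [|n IH].
  - rewrite sum_O. change (z ^ 0)%C with (RtoC 1). simpl. ring.
  - rewrite sum_Sn_C, <- IH. simpl. ring.
Qed.

(** The coefficients of [(x + y z^n) F] when those of [F] are [c]. *)
Definition binomial_coef (x y : C) (n : nat) (c : nat -> C) (k : nat) : C :=
  (x * c k + y * PS_incr_n (V := C_NormedModule) c n k)%C.

Lemma has_series_mult_binomial : forall x y n c d F, has_series c d F ->
  has_series (binomial_coef x y n c) d (fun z => (x + y * z ^ n) * F z)%C.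
Proof.
  intros x y n c d F [Hd HF]. split; [exact Hd|]. intros z Hz.
  replace ((x + y * z ^ n) * F z)%C with (x * F z + y * (z ^ n * F z))%C by ring.
  rewrite <- pow_n_Cpow.
  apply (is_pseries_plus (K := C_AbsRing) (V := C_NormedModule) (PS_scal x c) (PS_scal y (PS_incr_n c n)));
    apply (is_pseries_scal (K := C_AbsRing) (V := C_NormedModule)); try apply Cmult_comm.
  - now apply HF.
  - apply (is_pseries_incr_n (K := C_AbsRing) (V := C_NormedModule)). now apply HF.
Qed.

Lemma binomial_coef_0 : forall x y n c, (0 < n)%nat -> binomial_coef x y n c 0 = (x * c 0%nat)%C.
Proof.
  intros x y n c Hn. unfold binomial_coef. rewrite PS_incr_n_simplify.
  destruct (Compare_dec.le_lt_dec n 0); [lia|]. change zero with (RtoC 0). ring.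
Qed.

Lemma binomial_coef_n : forall x y n c, binomial_coef x y n c n = (x * c n + y * c 0%nat)%C.
Proof.
  intros x y n c. unfold binomial_coef. rewrite PS_incr_n_simplify.
  destruct (Compare_dec.le_lt_dec n n); [|lia]. now rewrite Nat.sub_diag.
Qed.

Lemma is_series_single : forall n (v : R), is_series (fun k => if Nat.eqb k n then v else 0) v.
Proof.
  intros n v. change (is_lim_seq (sum_n (fun k => if Nat.eqb k n then v else 0)) v).
  apply (is_lim_seq_ext_loc (fun _ => v)); [|apply is_lim_seq_const].
  exists n. intros k Hk.
  assert (H : forall j, sum_n (fun k => if Nat.eqb k n then v else 0) j = if Nat.leb n j then v else 0).
  { induction j as [|j IH].
    - rewrite sum_O. now destruct n.
    - rewrite sum_Sn, IH. change plus with Rplus.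
      destruct (Nat.eqb_spec (S j) n); destruct (Nat.leb_spec n j); destruct (Nat.leb_spec n (S j)); try lia; lra. }
  rewrite H. destruct (Nat.leb_spec n k); [reflexivity|lia].
Qed.

(** Parseval applied to [(x + y z^n) F], which is dominated by [x + y z^n], keeping
    only the coefficients of orders [0] and [n] on the left.  The estimate holds on every
    circle of radius [r < 1], and [r] tends to 1. *)
Lemma toeplitz_contraction : forall c F n (x y : C), has_series c 1 F ->
  (forall z, Cmod z < 1 -> Cmod (F z) <= 1) -> (0 < n)%nat ->
  Cmod (x * c 0%nat)%C ^ 2 + Cmod (x * c n + y * c 0%nat)%C ^ 2 <= Cmod x ^ 2 + Cmod y ^ 2.
Proof.
  intros c F n x y HF Hle Hn.
  pose proof (has_series_mult_binomial x y n c 1 F HF) as H1.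
  pose proof (has_series_mult_binomial x y n one_coef 1 _ (has_series_one 1 Rlt_0_1)) as H2.
  assert (Hr : forall r, 0 <= r < 1 ->
    Cmod (x * c 0%nat) ^ 2 + Cmod (x * c n + y * c 0%nat) ^ 2 * (r ^ n) ^ 2 <= Cmod x ^ 2 + Cmod y ^ 2).
  { intros r Hr.
    pose proof (series_sq_le _ _ _ _ r H1 H2) as HS. cbv beta in HS.
    specialize (HS ltac:(intros z Hz; rewrite !Cmod_mult, Cmod_1; apply Rmult_le_compat_l; [apply Cmod_ge_0|now apply Hle]) Hr).
    set (single := fun a b k => (if Nat.eqb k 0 then a else 0) + (if Nat.eqb k n then b else 0)).
    assert (Hsingle : forall a b, is_series (single a b) (a + b)).
    { intros a b. exact (is_series_plus _ _ _ _ (is_series_single 0 a) (is_series_single n b)). }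
    assert (Hlow : Cmod (x * c 0%nat) ^ 2 + Cmod (x * c n + y * c 0%nat) ^ 2 * (r ^ n) ^ 2
       <= Series (fun k => (Cmod (binomial_coef x y n c k) * r ^ k) ^ 2)).
    { rewrite <- (is_series_unique _ _ (Hsingle (Cmod (x * c 0%nat) ^ 2) (Cmod (x * c n + y * c 0%nat) ^ 2 * (r ^ n) ^ 2))).
      apply Series_le; [|apply ex_series_coef_sq; [exact (has_series_coef_bounded _ _ _ H1)|exact Hr]].
      intro k. unfold single. pose proof (pow2_ge_0 (Cmod (binomial_coef x y n c k) * r ^ k)).
      destruct (Nat.eqb_spec k 0); destruct (Nat.eqb_spec k n); subst; try lia.
      - rewrite binomial_coef_0 by lia. pose proof (pow2_ge_0 (Cmod (x * c 0%nat))). simpl (r ^ 0). split; [lra|]. right; ring.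
      - rewrite binomial_coef_n, Rpow_mult_distr.
        pose proof (pow2_ge_0 (Cmod (x * c n + y * c 0%nat) * r ^ n)). rewrite Rpow_mult_distr in *. lra.
      - lra. }
    assert (Hup : Series (fun k => (Cmod (binomial_coef x y n one_coef k) * r ^ k) ^ 2) = Cmod x ^ 2 + Cmod y ^ 2 * (r ^ n) ^ 2).
    { apply is_series_unique.
      apply (is_series_ext (single (Cmod x ^ 2) (Cmod y ^ 2 * (r ^ n) ^ 2))); [|apply Hsingle].
      intro k. unfold single.
      destruct (Nat.eqb_spec k 0); destruct (Nat.eqb_spec k n); subst; try lia.
      - rewrite binomial_coef_0 by lia. simpl one_coef. rewrite Cmult_1_r. simpl (r ^ 0). Rring.
      - rewrite binomial_coef_n. destruct n as [|n]; [lia|]. simpl one_coef.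
        replace (x * 0 + y * 1)%C with y by ring. Rring.
      - unfold binomial_coef. rewrite PS_incr_n_simplify.
        destruct (Compare_dec.le_lt_dec n k).
        + replace (one_coef (k - n)) with (RtoC 0) by (destruct (k - n)%nat eqn:E; [lia|reflexivity]).
          destruct k; [lia|]. simpl one_coef. replace (x * 0 + y * 0)%C with (RtoC 0) by ring. rewrite Cmod_0. Rring.
        + destruct k; [lia|]. simpl one_coef. change zero with (RtoC 0).
          replace (x * 0 + y * 0)%C with (RtoC 0) by ring. rewrite Cmod_0. Rring. }
    rewrite Hup in HS.
    assert (Hrn : 0 <= (r ^ n) ^ 2 <= 1).
    { split; [apply pow2_ge_0|]. rewrite <- pow_mult, <- (pow1 (n * 2)). apply pow_incr; lra. }
    pose proof (pow2_ge_0 (Cmod y)). nra. }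
  set (X := Cmod (x * c n + y * c 0%nat) ^ 2) in *.
  assert (HX : 0 <= X) by apply pow2_ge_0.
  apply le_epsilon. intros eps He.
  destruct (pow_near_1 (n * 2) (eps / (X + 1))) as [r [Hr1 Hr2]]; [apply Rdiv_lt_0_compat; lra|].
  specialize (Hr r ltac:(lra)). specialize (Hr2 r ltac:(lra)). rewrite pow_mult in Hr2.
  assert (Hp : 0 <= (r ^ n) ^ 2 <= 1).
  { split; [apply pow2_ge_0|]. rewrite <- pow_mult, <- (pow1 (n * 2)). apply pow_incr; lra. }
  set (p := (r ^ n) ^ 2) in *.
  assert (Hd : 1 - p <= eps / (X + 1)).
  { assert (0 < eps / (X + 1)) by (apply Rdiv_lt_0_compat; lra). nra. }
  assert (Hd2 : (1 - p) * (X + 1) <= eps).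
  { apply Rle_trans with (eps / (X + 1) * (X + 1)); [apply Rmult_le_compat_r; lra|right; field; lra]. }
  nra.
Qed.

(** Wiener's bound: optimise the two-term inequality over the ratio [y/x], the phase of
    [y] being chosen so that the two contributions to the coefficient add up. *)
Lemma coefficient_bound : forall c F n, has_series c 1 F ->
  (forall z, Cmod z < 1 -> Cmod (F z) <= 1) -> (0 < n)%nat ->
  Cmod (c n) <= 1 - Cmod (c 0%nat) ^ 2.
Proof.
  intros c F n HF Hle Hn.
  destruct (aligned_direction (c 0%nat) (c n) 0) as [u [Hu Halign]].
  set (A := Cmod (c 0%nat)) in *. set (B := Cmod (c n)) in *.
  assert (HA : 0 <= A) by apply Cmod_ge_0. assert (HB : 0 <= B) by apply Cmod_ge_0.
  assert (H : forall t, 0 <= t -> A ^ 2 + (B + t * A) ^ 2 <= 1 + t ^ 2).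
  { intros t Ht. pose proof (toeplitz_contraction c F n (RtoC 1) (RtoC t * u)%C HF Hle Hn) as HT.
    rewrite !Cmult_1_l, Cmod_1, Cmod_mult, Hu, Cmod_R, Rabs_pos_eq in HT by exact Ht.
    specialize (Halign t Ht). rewrite Cpow_1_r in Halign.
    replace (c n + RtoC t * u * c 0%nat)%C with (c n + RtoC t * (u * c 0%nat))%C in HT by ring.
    rewrite Halign in HT. fold A in HT. lra. }
  pose proof (H 0 (Rle_refl _)) as H0.
  assert (HA1 : A ^ 2 <= 1) by nra.
  destruct (Rle_or_lt 1 (A ^ 2)) as [HA2|HA2].
  - assert (B * B <= 0) by nra. nra.
  - (* The value at which the quadratic polynomial in [t] is minimal. *)
    set (t := B * A / (1 - A ^ 2)).
    assert (Ht : t * (1 - A ^ 2) = B * A) by (unfold t; field; lra).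
    assert (Ht0 : 0 <= t) by (apply Rmult_le_pos; [nra|left; apply Rinv_0_lt_compat; lra]).
    specialize (H t Ht0).
    assert (Hk : B ^ 2 + B * A * t <= 1 - A ^ 2).
    { assert (t * (t * (1 - A ^ 2)) = t * (B * A)) by (now rewrite Ht). nra. }
    assert (Hk2 : B ^ 2 <= (1 - A ^ 2) ^ 2).
    { assert ((B ^ 2 + B * A * t) * (1 - A ^ 2) <= (1 - A ^ 2) * (1 - A ^ 2)) by (apply Rmult_le_compat_r; lra).
      assert (B * A * t * (1 - A ^ 2) = B * A * (B * A)) by (rewrite <- Ht; ring). nra. }
    nra.
Qed.

(** * The co-analytic part *)

(** The new series is the integral from 0 to [x] of the old one, divided by [x]. *)
Lemma PSeries_average_nonneg : forall a : nat -> R, Rbar_le 1 (CV_radius a) ->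
  (forall x, 0 <= x < 1 -> 0 <= PSeries a x) ->
  forall x, 0 <= x < 1 -> 0 <= PSeries (fun n => a n / INR (S n)) x.
Proof.
  intros a Ha Hpos x Hx.
  destruct (Rle_lt_or_eq_dec 0 x (proj1 Hx)) as [Hx0|<-].
  - assert (Hr : Rbar_lt (Rabs x) (CV_radius a)).
    { apply Rbar_lt_le_trans with 1; [|exact Ha]. simpl. rewrite Rabs_pos_eq; lra. }
    apply (Rmult_le_reg_l x); [exact Hx0|]. rewrite Rmult_0_r.
    rewrite <- PSeries_incr_1.
    rewrite (PSeries_ext _ (PS_Int a)) by (intros [|n]; reflexivity).
    rewrite <- RInt_PSeries by exact Hr.
    apply RInt_ge_0; [lra|now apply ex_RInt_PSeries|]. intros y Hy. apply Hpos; lra.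
  - rewrite PSeries_0. specialize (Hpos 0 Hx). rewrite PSeries_0 in Hpos.
    simpl INR. lra.
Qed.

Lemma CV_radius_average : forall a : nat -> R,
  CV_radius (fun n => a n / INR (S n)) = CV_radius a.
Proof.
  intro a. rewrite <- (CV_radius_Int a), <- CV_radius_incr_1.
  apply CV_radius_ext. now intros [|n].
Qed.

Lemma CV_radius_ge_1 : forall a : nat -> R,
  (forall s, 0 <= s < 1 -> exists M, forall n, Rabs (a n * s ^ n) <= M) -> Rbar_le 1 (CV_radius a).
Proof.
  intros a H. destruct (CV_radius_bounded a) as [Hub _].
  pose proof (CV_radius_ge_0 a) as H0.
  assert (Hs : forall s, 0 <= s < 1 -> Rbar_le s (CV_radius a)) by (intros s Hs; apply Hub, H, Hs).
  destruct (CV_radius a) as [R| |]; simpl in *; [|exact I|contradiction].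
  apply Rnot_lt_le. intro Hlt. specialize (Hs ((R + 1) / 2) ltac:(lra)). lra.
Qed.

(** In the variable [x = r^2], the difference of the two sides is a power series;
    dividing its coefficients by [(n+1)^2] averages it twice over [0, x], which keeps it
    nonnegative. *)
Lemma series_sq_average_le : forall alpha beta : nat -> C,
  coef_bounded alpha 1 -> coef_bounded beta 1 ->
  (forall r, 0 <= r < 1 ->
     Series (fun n => (Cmod (beta n) * r ^ n) ^ 2) <= Series (fun n => (Cmod (alpha n) * r ^ n) ^ 2)) ->
  forall r, 0 <= r < 1 ->
    Series (fun n => (Cmod (beta n) / INR (S n) * r ^ n) ^ 2)
    <= Series (fun n => (Cmod (alpha n) / INR (S n) * r ^ n) ^ 2).
Proof.
  intros alpha beta Ha Hb Hle.
  set (e := fun n => Cmod (alpha n) ^ 2 - Cmod (beta n) ^ 2).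
  assert (Hsq : forall r n, (r ^ 2) ^ n = (r ^ n) ^ 2).
  { intros r n. rewrite <- !pow_mult. f_equal. lia. }
  assert (Hrad : Rbar_le 1 (CV_radius e)).
  { apply CV_radius_ge_1. intros s Hs.
    assert (Hss : 0 <= sqrt s < 1).
    { split; [apply sqrt_pos|]. rewrite <- sqrt_1. apply sqrt_lt_1; lra. }
    destruct (Ha (sqrt s) Hss) as [A [HA0 HA]]. destruct (Hb (sqrt s) Hss) as [B [HB0 HB]].
    exists (A ^ 2 + B ^ 2). intro n. specialize (HA n). specialize (HB n).
    assert (Es : s = sqrt s ^ 2) by (rewrite <- Rsqr_pow2, Rsqr_sqrt; lra).
    rewrite Es, Hsq. unfold e.
    assert (Hp : 0 <= sqrt s ^ n) by (apply pow_le; lra).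
    assert (0 <= Cmod (alpha n) * sqrt s ^ n) by (apply Rmult_le_pos; [apply Cmod_ge_0|exact Hp]).
    assert (0 <= Cmod (beta n) * sqrt s ^ n) by (apply Rmult_le_pos; [apply Cmod_ge_0|exact Hp]).
    replace ((Cmod (alpha n) ^ 2 - Cmod (beta n) ^ 2) * (sqrt s ^ n) ^ 2)
      with ((Cmod (alpha n) * sqrt s ^ n) ^ 2 - (Cmod (beta n) * sqrt s ^ n) ^ 2) by ring.
    apply Rabs_le. nra. }
  assert (Hpos : forall x, 0 <= x < 1 -> 0 <= PSeries e x).
  { intros x Hx.
    assert (Hxx : 0 <= sqrt x < 1).
    { split; [apply sqrt_pos|]. rewrite <- sqrt_1. apply sqrt_lt_1; lra. }
    assert (Ex : x = sqrt x ^ 2) by (rewrite <- Rsqr_pow2, Rsqr_sqrt; lra).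
    specialize (Hle (sqrt x) Hxx). unfold PSeries.
    rewrite (Series_ext _ (fun n => (Cmod (alpha n) * sqrt x ^ n) ^ 2 - (Cmod (beta n) * sqrt x ^ n) ^ 2)).
    - rewrite Series_minus by now apply ex_series_coef_sq. lra.
    - intro n. rewrite Ex at 1. rewrite Hsq. unfold e. ring. }
  pose proof (PSeries_average_nonneg e Hrad Hpos) as H1.
  pose proof (PSeries_average_nonneg (fun n => e n / INR (S n))) as H2.
  rewrite CV_radius_average in H2. specialize (H2 Hrad H1).
  assert (Hav : forall c, coef_bounded c 1 -> coef_bounded (fun n => c n / RtoC (INR (S n)))%C 1).
  { intros c Hc s Hs. destruct (Hc s Hs) as [M [HM0 HM]]. exists M. split; [exact HM0|]. intro n.
    eapply Rle_trans; [|apply (HM n)]. apply Rmult_le_compat_r; [apply pow_le; lra|].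
    assert (1 <= INR (S n)) by (rewrite S_INR; pose proof (pos_INR n); lra).
    rewrite Cmod_div by (intro E; apply RtoC_inj in E; lra).
    rewrite Cmod_R, Rabs_pos_eq by lra. pose proof (Cmod_ge_0 (c n)).
    apply (Rmult_le_reg_r (INR (S n))); [lra|]. unfold Rdiv. rewrite Rmult_assoc, Rinv_l by lra. nra. }
  assert (Hmod : forall (c : nat -> C) n, Cmod (c n / RtoC (INR (S n)))%C = Cmod (c n) / INR (S n)).
  { intros c n. assert (1 <= INR (S n)) by (rewrite S_INR; pose proof (pos_INR n); lra).
    rewrite Cmod_div by (intro E; apply RtoC_inj in E; lra).
    rewrite Cmod_R, Rabs_pos_eq by lra. reflexivity. }
  intros r Hr.
  specialize (H2 (r ^ 2) ltac:(nra)). unfold PSeries in H2.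
  rewrite (Series_ext _ (fun n => (Cmod (alpha n / RtoC (INR (S n)))%C * r ^ n) ^ 2
                          - (Cmod (beta n / RtoC (INR (S n)))%C * r ^ n) ^ 2)) in H2.
  - rewrite Series_minus in H2.
    2: apply (ex_series_coef_sq (fun n => alpha n / RtoC (INR (S n)))%C); [now apply Hav|exact Hr].
    2: apply (ex_series_coef_sq (fun n => beta n / RtoC (INR (S n)))%C); [now apply Hav|exact Hr].
    rewrite (Series_ext (fun n => (Cmod (beta n) / INR (S n) * r ^ n) ^ 2)
                        (fun n => (Cmod (beta n / RtoC (INR (S n)))%C * r ^ n) ^ 2)) by (intro; now rewrite Hmod).
    rewrite (Series_ext (fun n => (Cmod (alpha n) / INR (S n) * r ^ n) ^ 2)
                        (fun n => (Cmod (alpha n / RtoC (INR (S n)))%C * r ^ n) ^ 2)) by (intro; now rewrite Hmod).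
    lra.
  - intro n. rewrite !Hmod, Hsq. unfold e. field.
    rewrite S_INR. pose proof (pos_INR n). lra.
Qed.

Lemma partial_sum_le_Series : forall (u : nat -> R) N, (forall n, 0 <= u n) -> ex_series u ->
  sum_n u N <= Series u.
Proof.
  intros u N Hu Hex. apply (is_lim_seq_incr_compare (sum_n u) (Series u)).
  - exact (Series_correct u Hex).
  - intro n. rewrite sum_Sn. change plus with Rplus. specialize (Hu (S n)). lra.
Qed.

Lemma geometric_partial_sum_le : forall (u : nat -> R) B y N, 0 <= B -> 0 <= y < 1 ->
  (forall n, u n <= B * y ^ n) -> sum_n u N <= B / (1 - y).
Proof.
  intros u B y N HB Hy Hu.
  pose proof (is_series_geom_scal B y Hy) as HS.
  apply Rle_trans with (sum_n (fun n => B * y ^ n) N); [now apply sum_n_m_le|].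
  rewrite <- (is_series_unique _ _ HS). apply partial_sum_le_Series; [|now exists (B / (1 - y))].
  intro n. apply Rmult_le_pos; [exact HB|apply pow_le; lra].
Qed.

(** By Parseval's formula the bound on the derivatives compares square sums of the
    coefficients of [g'] and [h'], and by averaging those of [g] and [h].  The inequality
    of arithmetic and geometric means with weight [t] returns to the sum of moduli. *)
Lemma coanalytic_sum_le_pos : forall k a b h g t,
  0 <= k -> has_series a 1 h -> has_series b 1 g ->
  (forall z, Cmod z < 1 -> Cmod (C_derive g z) <= k * Cmod (C_derive h z)) ->
  0 < t -> (forall n, (0 < n)%nat -> k * Cmod (a n) <= t) ->
  forall y N, 0 <= y < 1 -> sum_n (fun n => Cmod (b (S n)) * y ^ n) N <= t / (1 - y).
Proof.
  intros k a b h g t Hk Hh Hg Hdil Ht Hat y N Hy.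
  pose proof (has_series_derive _ _ _ Hh) as Hh'. pose proof (has_series_derive _ _ _ Hg) as Hg'.
  assert (Hkh : has_series (PS_scal (K := C_AbsRing) (V := C_NormedModule) (RtoC k) (deriv_coef a)) 1 (fun z => RtoC k * C_derive h z)%C).
  { split; [lra|]. intros z Hz.
    apply (is_pseries_scal (K := C_AbsRing) (V := C_NormedModule)); [apply Cmult_comm|now apply Hh']. }
  set (r := sqrt y).
  assert (Hr : 0 <= r < 1).
  { unfold r. split; [apply sqrt_pos|]. rewrite <- sqrt_1. apply sqrt_lt_1; lra. }
  assert (Er : forall n, (r ^ n) ^ 2 = y ^ n).
  { intro n. rewrite <- pow_mult, Nat.mul_comm, pow_mult. unfold r.
    now rewrite <- (Rsqr_pow2 (sqrt y)), Rsqr_sqrt by lra. }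
  pose proof (series_sq_average_le _ _ (has_series_coef_bounded _ _ _ Hkh) (has_series_coef_bounded _ _ _ Hg')) as HI.
  assert (Hpre : forall r, 0 <= r < 1 ->
     Series (fun n => (Cmod (deriv_coef b n) * r ^ n) ^ 2) <=
     Series (fun n => (Cmod (PS_scal (K := C_AbsRing) (V := C_NormedModule) (RtoC k) (deriv_coef a) n) * r ^ n) ^ 2)).
  { intros s Hs. apply (series_sq_le _ _ _ _ s Hg' Hkh); [|exact Hs].
    intros z Hz. rewrite Cmod_mult, Cmod_R, Rabs_pos_eq by exact Hk. now apply Hdil. }
  specialize (HI Hpre r Hr).
  assert (HS : forall n, 0 < INR (S n)) by (intro n; apply lt_0_INR; lia).
  assert (Hmb : forall n, Cmod (deriv_coef b n) / INR (S n) = Cmod (b (S n))).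
  { intro n. unfold deriv_coef. rewrite Cmod_mult, Cmod_R, Rabs_pos_eq by apply pos_INR.
    field. apply Rgt_not_eq, HS. }
  assert (Hma : forall n, Cmod (PS_scal (K := C_AbsRing) (V := C_NormedModule) (RtoC k) (deriv_coef a) n) / INR (S n) = k * Cmod (a (S n))).
  { intro n. change (PS_scal (RtoC k) (deriv_coef a) n) with (RtoC k * (RtoC (INR (S n)) * a (S n)))%C.
    rewrite !Cmod_mult, !Cmod_R, !Rabs_pos_eq by (exact Hk || apply pos_INR).
    field. apply Rgt_not_eq, HS. }
  rewrite (Series_ext _ (fun n => (Cmod (b (S n)) * r ^ n) ^ 2)) in HI by (intro n; now rewrite Hmb).
  rewrite (Series_ext (fun n => (Cmod (PS_scal _ _ n) / _ * _) ^ 2) (fun n => (k * Cmod (a (S n)) * r ^ n) ^ 2)) in HI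
    by (intro n; now rewrite Hma).
  assert (Hup : Series (fun n => (k * Cmod (a (S n)) * r ^ n) ^ 2) <= t ^ 2 / (1 - y)).
  { rewrite <- (is_series_unique _ _ (is_series_geom_scal (t ^ 2) y Hy)).
    apply Series_le; [|exists (t ^ 2 / (1 - y)); now apply is_series_geom_scal].
    intro n. split; [apply pow2_ge_0|].
    rewrite Rpow_mult_distr, Er. apply Rmult_le_compat_r; [apply pow_le; lra|].
    apply pow_incr. split; [|apply Hat; lia]. apply Rmult_le_pos; [exact Hk|apply Cmod_ge_0]. }
  assert (Hb2 : sum_n (fun n => (Cmod (b (S n)) * r ^ n) ^ 2) N <= t ^ 2 / (1 - y)).
  { apply Rle_trans with (Series (fun n => (Cmod (b (S n)) * r ^ n) ^ 2)); [|lra].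
    apply partial_sum_le_Series; [intro; apply pow2_ge_0|].
    apply (ex_series_coef_sq (fun n => b (S n))); [|exact Hr].
    apply coef_bounded_shift. exact (has_series_coef_bounded _ _ _ Hg). }
  assert (Hg1 : sum_n (fun n => t * y ^ n) N <= t / (1 - y)).
  { apply geometric_partial_sum_le; [lra|exact Hy|]. intro; lra. }
  apply Rle_trans with (sum_n (fun n => / (2 * t) * ((Cmod (b (S n)) * r ^ n) ^ 2) + / 2 * (t * y ^ n)) N).
  - apply sum_n_m_le. intro n. rewrite Rpow_mult_distr, Er.
    assert (Hyn : 0 <= y ^ n) by (apply pow_le; lra).
    (* [2 t |b| <= |b|^2 + t^2]; both sums are then at most [t^2 / (1 - y)]. *)
    pose proof (pow2_ge_0 (Cmod (b (S n)) - t)) as Hsq.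
    apply (Rmult_le_reg_l (2 * t)); [lra|].
    replace (2 * t * (/ (2 * t) * (Cmod (b (S n)) ^ 2 * y ^ n) + / 2 * (t * y ^ n)))
      with ((Cmod (b (S n)) ^ 2 + t ^ 2) * y ^ n) by (field; lra).
    replace (2 * t * (Cmod (b (S n)) * y ^ n)) with (2 * t * Cmod (b (S n)) * y ^ n) by ring.
    apply Rmult_le_compat_r; [exact Hyn|lra].
  - rewrite (sum_n_plus (G := R_AbelianMonoid)). change plus with Rplus.
    rewrite (sum_n_mult_l_R (/ (2 * t)) (fun n => (Cmod (b (S n)) * r ^ n) ^ 2)).
    rewrite (sum_n_mult_l_R (/ 2) (fun n => t * y ^ n)).
    apply Rle_trans with (/ (2 * t) * (t ^ 2 / (1 - y)) + / 2 * (t / (1 - y))).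
    + apply Rplus_le_compat; apply Rmult_le_compat_l; 
        [left; apply Rinv_0_lt_compat; lra|exact Hb2|lra|exact Hg1].
    + right. field. lra.
Qed.

(** The case [t = 0] is the limit of the weights [t > 0]. *)
Lemma coanalytic_sum_le : forall k a b h g t,
  0 <= k -> has_series a 1 h -> has_series b 1 g ->
  (forall z, Cmod z < 1 -> Cmod (C_derive g z) <= k * Cmod (C_derive h z)) ->
  0 <= t -> (forall n, (0 < n)%nat -> k * Cmod (a n) <= t) ->
  forall y N, 0 <= y < 1 -> sum_n (fun n => Cmod (b (S n)) * y ^ n) N <= t / (1 - y).
Proof.
  intros k a b h g t Hk Hh Hg Hdil Ht Hat y N Hy. apply le_epsilon. intros eps He.
  replace (t / (1 - y) + eps) with ((t + eps * (1 - y)) / (1 - y)) by (field; lra).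
  assert (0 < eps * (1 - y)) by (apply Rmult_lt_0_compat; lra).
  apply (coanalytic_sum_le_pos k a b h g); try assumption; [lra|].
  intros n Hn. specialize (Hat n Hn). lra.
Qed.

(** * The equations of the radii *)

Lemma pow_lt_compat : forall x y n, 0 <= x < y -> (1 <= n)%nat -> x ^ n < y ^ n.
Proof.
  intros x y n Hxy Hn. induction n as [|n IH]; [lia|].
  destruct n as [|n]; [simpl; lra|]. specialize (IH ltac:(lia)).
  change (x * x ^ S n < y * y ^ S n).
  apply Rmult_le_0_lt_compat; try lra. apply pow_le; lra.
Qed.

Lemma pow_unit : forall x n, 0 < x < 1 -> (1 <= n)%nat -> 0 < x ^ n < 1.
Proof.
  intros x n Hx Hn. split; [apply pow_lt; lra|].
  rewrite <- (pow1 n). apply pow_lt_compat; [lra|exact Hn].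
Qed.

(** The left-hand side of the equation multiplied by [1 + r^m]: unlike the left-hand
    side itself it is visibly increasing. *)
Definition radius_fun (m p q : nat) (k r : R) : R :=
  2 * r ^ q + 2 * ((k + r ^ p) * (r ^ p / (1 - r ^ p)) * (1 + r ^ m) ^ 2) - (1 - r ^ (2 * m)).

(** Cleared of denominators, hence continuous on the whole line. *)
Definition radius_poly (m p q : nat) (k r : R) : R :=
  (1 - r ^ p) * (2 * r ^ q - (1 - r ^ (2 * m))) + 2 * ((k + r ^ p) * r ^ p * (1 + r ^ m) ^ 2).

Lemma pow_double : forall r m, r ^ (2 * m) = r ^ m * r ^ m.
Proof. intros r m. rewrite <- pow_add. f_equal. lia. Qed.

Lemma eqn_r_radius_fun : forall m p q k r, (1 <= p)%nat -> 0 < r < 1 ->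
  (eqn_r m p q k r <-> radius_fun m p q k r = 0).
Proof.
  intros m p q k r Hp Hr. unfold eqn_r, radius_fun. rewrite pow_double.
  pose proof (pow_unit r p Hr Hp). assert (0 < r ^ m) by (apply pow_lt; lra).
  set (x := r ^ p) in *. set (s := r ^ m) in *. set (u := r ^ q) in *.
  assert (E : 2 * u + 2 * ((k + x) * (x / (1 - x)) * (1 + s) ^ 2) - (1 - s * s)
     = (2 * u / (1 + s) + 2 * (k + x) * (1 + s) * x / (1 - x) - (1 - s)) * (1 + s)) by (field; lra).
  rewrite E. split; intro H1.
  - rewrite H1. ring.
  - apply Rmult_integral in H1. lra.
Qed.

Lemma radius_poly_fun : forall m p q k r, (1 <= p)%nat -> 0 < r < 1 ->
  radius_poly m p q k r = (1 - r ^ p) * radius_fun m p q k r.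
Proof.
  intros m p q k r Hp Hr. unfold radius_poly, radius_fun.
  pose proof (pow_unit r p Hr Hp). field. lra.
Qed.

Lemma radius_fun_increasing : forall m p q k r s, (1 <= p)%nat -> (1 <= q)%nat -> 0 <= k ->
  0 < r -> r < s -> s < 1 -> radius_fun m p q k r < radius_fun m p q k s.
Proof.
  intros m p q k r s Hp Hq Hk Hr Hrs Hs. unfold radius_fun.
  assert (Hu : r ^ q < s ^ q) by (apply pow_lt_compat; [lra|exact Hq]).
  assert (Hm2 : r ^ (2 * m) <= s ^ (2 * m)) by (apply pow_incr; lra).
  assert (Hm : 0 < r ^ m <= s ^ m) by (split; [apply pow_lt; lra|apply pow_incr; lra]).
  pose proof (pow_unit r p ltac:(lra) Hp) as Hx. pose proof (pow_unit s p ltac:(lra) Hp) as Hy.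
  assert (Hxy : r ^ p <= s ^ p) by (apply pow_incr; lra).
  set (x := r ^ p) in *. set (y := s ^ p) in *.
  assert (Hdiv : 0 <= x / (1 - x) <= y / (1 - y)).
  { split; [apply Rmult_le_pos; [lra|left; apply Rinv_0_lt_compat; lra]|].
    apply Rmult_le_compat; [lra|left; apply Rinv_0_lt_compat; lra|lra|].
    apply Rinv_le_contravar; lra. }
  assert (H1 : (k + x) * (x / (1 - x)) * (1 + r ^ m) ^ 2 <= (k + y) * (y / (1 - y)) * (1 + s ^ m) ^ 2).
  { apply Rmult_le_compat.
    - apply Rmult_le_pos; lra.
    - apply pow2_ge_0.
    - apply Rmult_le_compat; lra.
    - apply pow_incr; lra. }
  lra.
Qed.

Lemma root_in_unit_interval : forall f : R -> R, continuity f -> f 0 < 0 -> 0 < f 1 ->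
  exists r, 0 < r < 1 /\ f r = 0.
Proof.
  intros f Hf H0 H1. destruct (IVT f 0 1 Hf Rlt_0_1 H0 H1) as [r [Hr E]].
  exists r. split; [|exact E].
  split; apply Rnot_le_lt; intro Hle.
  - replace r with 0 in E by lra. lra.
  - replace r with 1 in E by lra. lra.
Qed.

Lemma pow_0_pos : forall n, (1 <= n)%nat -> 0 ^ n = 0.
Proof. intros n Hn. apply pow_i. lia. Qed.

Lemma eqn_R_unique_root : forall m q, (1 <= m)%nat -> (1 <= q)%nat ->
  exists R0, unique (fun r => 0 < r < 1 /\ eqn_R m q r) R0 /\
    forall r, 0 < r < 1 -> r ^ (2 * m) + 2 * r ^ q - 1 <= 0 -> r <= R0.
Proof.
  intros m q Hm Hq. unfold eqn_R.
  destruct (root_in_unit_interval (fun r => r ^ (2 * m) + 2 * r ^ q - 1)) as [R0 [HR0 E0]].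
  - intro r. reg.
  - rewrite !pow_0_pos by lia. lra.
  - rewrite !pow1. lra.
  - assert (Hinc : forall r s, 0 < r -> r < s -> r ^ (2 * m) + 2 * r ^ q < s ^ (2 * m) + 2 * s ^ q).
    { intros r s Hr Hrs.
      pose proof (pow_lt_compat r s (2 * m) ltac:(lra) ltac:(lia)).
      pose proof (pow_lt_compat r s q ltac:(lra) Hq). lra. }
    exists R0. split.
    + split; [now split|]. intros r [Hr E].
      destruct (Rtotal_order R0 r) as [H|[H|H]]; [|exact H|].
      * pose proof (Hinc R0 r ltac:(lra) H). lra.
      * pose proof (Hinc r R0 ltac:(lra) H). lra.
    + intros r Hr Hle. apply Rnot_lt_le. intro H.
      pose proof (Hinc R0 r ltac:(lra) H). lra.
Qed.

Lemma radius_root : forall m p q k, (1 <= m)%nat -> (1 <= p)%nat -> (1 <= q)%nat -> 0 <= k ->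
  exists r0, 0 < r0 < 1 /\ radius_fun m p q k r0 = 0.
Proof.
  intros m p q k Hm Hp Hq Hk.
  destruct (root_in_unit_interval (radius_poly m p q k)) as [r [Hr E]].
  - unfold radius_poly. intro r. reg.
  - unfold radius_poly. rewrite !pow_0_pos by lia. lra.
  - unfold radius_poly. rewrite !pow1. nra.
  - exists r. split; [exact Hr|]. rewrite radius_poly_fun in E by assumption.
    pose proof (pow_unit r p Hr Hp). apply Rmult_integral in E. lra.
Qed.

(** * The Bohr inequality *)

(** For [lam <= 1/2] the function [X + lam (1 - X^2)] increases on [0,1], so the two
    Schwarz-Pick bounds can be inserted simultaneously. *)
Lemma first_terms_le : forall A s u v c X d,
  0 <= A <= 1 -> 0 <= v <= s -> s < 1 -> 0 <= c <= u -> 2 * u <= 1 - s * s ->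
  0 <= X <= 1 -> 0 <= d -> X * (1 + A * v) <= A + v -> d * (1 - v * v) <= 1 - X * X ->
  X + d * c <= (A + s) / (1 + A * s) + u * (1 - A * A) / (1 + A * s) ^ 2.
Proof.
  intros A s u v c X d HA Hv Hs Hc Hu HX Hd HXv Hdv.
  assert (HAs : 0 <= A * s) by nra.
  set (X1 := (A + s) / (1 + A * s)).
  assert (HX1 : X1 * (1 + A * s) = A + s) by (unfold X1; field; lra).
  assert (HX1b : X1 <= 1).
  { apply (Rmult_le_reg_r (1 + A * s)); [lra|]. rewrite HX1. nra. }
  assert (HXX1 : X <= X1).
  { apply (Rmult_le_reg_r (1 + A * s)); [lra|]. rewrite HX1.
    assert (0 <= A * v) by nra.
    assert (HXA : X * A <= 1) by nra.
    assert (0 <= (s - v) * (1 - X * A)) by (apply Rmult_le_pos; lra). nra. }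
  assert (Hss : 0 < 1 - s * s) by nra.
  set (lam := u / (1 - s * s)).
  assert (Hlam : lam * (1 - s * s) = u) by (unfold lam; field; lra).
  assert (Hlam2 : 0 <= lam <= 1 / 2).
  { split; [apply Rmult_le_pos; [lra|left; apply Rinv_0_lt_compat; lra]|].
    apply (Rmult_le_reg_r (1 - s * s)); [lra|]. rewrite Hlam. lra. }
  assert (Hdc : d * c <= lam * (1 - X * X)).
  { assert (Hd1 : d * (1 - s * s) <= 1 - X * X).
    { assert (d * (v * v) <= d * (s * s)) by (apply Rmult_le_compat_l; [lra|nra]). lra. }
    apply Rle_trans with (d * u); [apply Rmult_le_compat_l; lra|].
    rewrite <- Hlam. replace (d * (lam * (1 - s * s))) with (lam * (d * (1 - s * s))) by ring.
    apply Rmult_le_compat_l; lra. }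
  assert (Hmono : X + lam * (1 - X * X) <= X1 + lam * (1 - X1 * X1)).
  { assert (Hl : lam * (X + X1) <= 1 / 2 * 2) by (apply Rmult_le_compat; lra).
    assert (0 <= (X1 - X) * (1 - lam * (X + X1))) by (apply Rmult_le_pos; lra). lra. }
  replace (u * (1 - A * A) / (1 + A * s) ^ 2) with (lam * (1 - X1 * X1)); [lra|].
  rewrite <- Hlam. unfold X1. field. lra.
Qed.

(** One minus the majorant is [1 - A] times a bracket.  Multiplied by [1 + A s] the bracket
    decreases in [A], and at [A = 1] it is nonnegative by the last hypothesis. *)
Lemma majorant_le_1 : forall A s u W,
  0 <= A <= 1 -> 0 <= s < 1 -> 0 <= W -> 2 * u + 2 * (W * (1 + s) ^ 2) <= 1 - s * s ->
  (A + s) / (1 + A * s) + u * (1 - A * A) / (1 + A * s) ^ 2 + (1 - A * A) * W <= 1.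
Proof.
  intros A s u W HA Hs HW H.
  assert (HAs : 0 <= A * s) by nra.
  apply (Rmult_le_reg_r ((1 + A * s) ^ 2)); [apply pow_lt; lra|].
  replace (((A + s) / (1 + A * s) + u * (1 - A * A) / (1 + A * s) ^ 2 + (1 - A * A) * W) * (1 + A * s) ^ 2)
    with ((A + s) * (1 + A * s) + u * (1 - A * A) + (1 - A * A) * (W * (1 + A * s) ^ 2)) by (field; lra).
  assert (HWA : W * (1 + A * s) ^ 2 <= W * (1 + s) ^ 2).
  { apply Rmult_le_compat_l; [exact HW|]. apply pow_incr. split; [lra|]. nra. }
  assert (HA2 : 0 <= 1 - A * A) by nra.
  assert (Hu : (1 - A * A) * (u + W * (1 + A * s) ^ 2) <= (1 - A * A) * ((1 - s * s) / 2)).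
  { apply Rmult_le_compat_l; lra. }
  assert (Hrest : 0 <= (1 - A) * ((1 - A) * ((1 - s) * (1 - s)) / 2)).
  { apply Rmult_le_pos; [lra|]. assert (0 <= (1 - A) * ((1 - s) * (1 - s))) by (apply Rmult_le_pos; [lra|nra]). lra. }
  nra.
Qed.

Lemma sum_from_shift : forall n0 u,
  sum_from n0 u = Lim_seq (sum_n (fun k => u (n0 + k)%nat)).
Proof.
  intros n0 u. unfold sum_from. rewrite <- (Lim_seq_incr_n _ n0).
  apply Lim_seq_ext. intro n. induction n as [|n IH].
  - rewrite sum_O, Nat.add_0_r. simpl. apply sum_n_n.
  - rewrite Nat.add_succ_l, sum_n_Sm by lia. rewrite sum_Sn, <- IH, Nat.add_succ_r, (Nat.add_comm n0 n).
    reflexivity.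
Qed.

Lemma sum_from_le : forall n0 u M, (forall n, 0 <= u n) ->
  (forall N, sum_n (fun k => u (n0 + k)%nat) N <= M) ->
  exists L, sum_from n0 u = Finite L /\ L <= M.
Proof.
  intros n0 u M Hu HM. rewrite sum_from_shift.
  assert (H0 : Rbar_le 0 (Lim_seq (sum_n (fun k => u (n0 + k)%nat)))).
  { rewrite <- (Lim_seq_const 0). apply Lim_seq_le_loc. exists O. intros n _.
    induction n as [|n IH]; [rewrite sum_O; apply Hu|].
    rewrite sum_Sn. change plus with Rplus. specialize (Hu (n0 + S n)%nat). lra. }
  assert (H1 : Rbar_le (Lim_seq (sum_n (fun k => u (n0 + k)%nat))) M).
  { rewrite <- (Lim_seq_const M). apply Lim_seq_le_loc. exists O. intros n _. apply HM. }
  destruct (Lim_seq _) as [L| |]; simpl in *; [now exists L|contradiction|contradiction].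
Qed.

(** A point where [|h| = 1] would be a local maximum, so [h] would be constant near it. *)
Lemma derivative_nonzero_lt_1 : forall h, analytic_on_disk h ->
  (forall z, Cmod z < 1 -> Cmod (h z) <= 1) -> (forall z, Cmod z < 1 -> C_derive h z <> RtoC 0) ->
  forall z, Cmod z < 1 -> Cmod (h z) < 1.
Proof.
  intros h Hh Hle Hd z Hz.
  assert (HQ : quotient_at h z).
  { exists h, (fun _ => RtoC 1), 1. split; [now apply analytic_on_disk_at|].
    split; [apply analytic_at_const|]. split; [apply C1_nz|]. split; [lra|]. intros; ring. }
  destruct (quotient_at_local_max h z HQ) as [[d [Hd0 Hc]]|Hmax].
  - exfalso. apply (Hd z Hz).
    apply (C_derive_factor h (fun _ => RtoC 0) z d Hd0); [apply analytic_at_const|].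
    intros y Hy. rewrite (Hc y Hy). ring.
  - destruct (Hmax (1 - Cmod z)) as [y [Hy1 Hy2]]; [lra|].
    pose proof (Cmod_triangle_rev y z). specialize (Hle y ltac:(lra)). lra.
Qed.

Lemma sum_n_geometric_shift : forall (c : nat -> R) n0 y N,
  sum_n (fun k => c (n0 + k)%nat * y ^ (n0 + k)) N = y ^ n0 * sum_n (fun k => c (n0 + k)%nat * y ^ k) N.
Proof.
  intros c n0 y N. rewrite <- sum_n_mult_l_R. apply sum_n_ext. intro k. rewrite pow_add. Rring.
Qed.

(** Schwarz's lemma replaces [w j z] by [|z|^j], the coefficients are at most [1 - A^2]
    with [A = |a 0|], and the sum of the resulting bounds is the majorant above with
    [W = r^p (k + r^p) / (1 - r^p)]. *)
Lemma bohr_inequality : forall m p q k (h g : C -> C) (a b : nat -> C) (w : nat -> C -> C) r0,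
  (1 <= m)%nat -> (1 <= p)%nat -> (1 <= q)%nat -> 0 <= k ->
  analytic_on_disk h -> disk_expansion h g a b ->
  (forall z, Cmod z < 1 -> Cmod (h z) <= 1) ->
  (forall z, Cmod z < 1 -> C_derive h z <> RtoC 0) ->
  (forall z, Cmod z < 1 -> Cmod (C_derive g z) <= k * Cmod (C_derive h z)) ->
  (forall j, (1 <= j)%nat -> class_Bj j (w j)) ->
  0 < r0 < 1 -> radius_fun m p q k r0 = 0 ->
  forall z, Cmod z <= r0 -> Rbar_le (bohr_sum h a b w m p q z) 1.
Proof.
  intros m p q k h g a b w r0 Hm Hp Hq Hk Hh [Hb0 Hexp] Hle Hd Hdil Hw Hr0 Hroot z Hz.
  pose proof (derivative_nonzero_lt_1 h Hh Hle Hd) as Hlt.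
  assert (Ha : has_series a 1 h) by (split; [lra|intros y Hy; now apply Hexp]).
  assert (Hb : has_series b 1 g) by (split; [lra|intros y Hy; now apply Hexp]).
  pose proof (Cmod_ge_0 z) as Hz0.
  assert (Hwj : forall j, (1 <= j)%nat -> Cmod (w j z) <= Cmod z ^ j).
  { intros j Hj. apply schwarz_order; [now apply Hw|lra]. }
  assert (Hpow : forall j, (1 <= j)%nat -> 0 <= Cmod z ^ j < 1).
  { intros j Hj. split; [apply pow_le; lra|]. rewrite <- (pow1 j). apply pow_lt_compat; [lra|exact Hj]. }
  set (r := Cmod z) in *.
  assert (Hcond : 2 * r ^ q + 2 * ((k + r ^ p) * (r ^ p / (1 - r ^ p)) * (1 + r ^ m) ^ 2) <= 1 - r ^ m * r ^ m).
  { destruct (Rle_lt_or_eq_dec 0 r Hz0) as [Hr|Hr].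
    - assert (radius_fun m p q k r <= 0).
      { destruct (Rle_lt_or_eq_dec r r0 Hz) as [Hlt0|Heq].
        - pose proof (radius_fun_increasing m p q k r r0 Hp Hq Hk Hr Hlt0 ltac:(lra)). lra.
        - rewrite Heq. lra. }
      unfold radius_fun in H. rewrite pow_double in H. lra.
    - (* The radius function is compared on positive arguments only. *)
      rewrite <- Hr, !pow_0_pos by lia. lra. }
  pose proof (Hpow m Hm) as Hs. pose proof (Hpow p Hp) as Hrho. pose proof (Hpow q Hq) as Hu.
  set (s := r ^ m) in *. set (rho := r ^ p) in *. set (u := r ^ q) in *.
  set (A := Cmod (a 0%nat)).
  assert (EA : Cmod (h (RtoC 0)) = A) by (unfold A; f_equal; now apply (has_series_at_0 a 1)).
  assert (HA : 0 <= A <= 1).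
  { split; [apply Cmod_ge_0|]. rewrite <- EA. apply Hle. rewrite Cmod_0. lra. }
  assert (Hcoef : forall n, (0 < n)%nat -> Cmod (a n) <= 1 - A * A).
  { intros n Hn. replace (1 - A * A) with (1 - A ^ 2) by ring. now apply (coefficient_bound a h). }
  set (y := Cmod (w p z)).
  assert (Hy : 0 <= y <= rho) by (split; [apply Cmod_ge_0|now apply Hwj]).
  assert (HA2 : 0 <= 1 - A * A) by nra.
  assert (Hinv : 0 < / (1 - y) <= / (1 - rho)).
  { split; [apply Rinv_0_lt_compat; lra|]. apply Rinv_le_contravar; lra. }
  destruct (sum_from_le 2 (fun n => Cmod (a n) * y ^ n) ((1 - A * A) * (rho * rho / (1 - rho)))) as [L1 [E1 HL1]].
  { intro n. apply Rmult_le_pos; [apply Cmod_ge_0|apply pow_le; lra]. }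
  { intro N. rewrite (sum_n_geometric_shift (fun n => Cmod (a n)) 2 y N).
    assert (HN : sum_n (fun n => Cmod (a (2 + n)%nat) * y ^ n) N <= (1 - A * A) / (1 - y)).
    { apply geometric_partial_sum_le; [exact HA2|lra|]. intro n.
      apply Rmult_le_compat_r; [apply pow_le; lra|]. apply Hcoef; lia. }
    apply Rle_trans with (y ^ 2 * ((1 - A * A) / (1 - y))).
    - apply Rmult_le_compat_l; [apply pow2_ge_0|exact HN].
    - unfold Rdiv. replace (y ^ 2 * ((1 - A * A) * / (1 - y))) with ((1 - A * A) * (y * y * / (1 - y))) by ring.
      apply Rmult_le_compat_l; [exact HA2|]. apply Rmult_le_compat; nra. }
  destruct (sum_from_le 1 (fun n => Cmod (b n) * y ^ n) ((1 - A * A) * (k * (rho / (1 - rho))))) as [L2 [E2 HL2]].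
  { intro n. apply Rmult_le_pos; [apply Cmod_ge_0|apply pow_le; lra]. }
  { intro N. rewrite (sum_n_geometric_shift (fun n => Cmod (b n)) 1 y N).
    assert (HN : sum_n (fun n => Cmod (b (1 + n)%nat) * y ^ n) N <= k * (1 - A * A) / (1 - y)).
    { apply (coanalytic_sum_le k a b h g); try assumption; [now apply Rmult_le_pos| |lra].
      intros n Hn. apply Rmult_le_compat_l; [exact Hk|now apply Hcoef]. }
    apply Rle_trans with (y ^ 1 * (k * (1 - A * A) / (1 - y))).
    - apply Rmult_le_compat_l; [simpl; lra|exact HN].
    - unfold Rdiv. replace (y ^ 1 * (k * (1 - A * A) * / (1 - y))) with ((1 - A * A) * (k * (y * / (1 - y)))) by ring.
      apply Rmult_le_compat_l; [exact HA2|]. apply Rmult_le_compat_l; [exact Hk|]. apply Rmult_le_compat; lra. }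
  unfold bohr_sum. fold y. rewrite E1, E2. simpl.
  assert (Hwm : Cmod (w m z) < 1) by (apply Rle_lt_trans with s; [exact (Hwj m Hm)|lra]).
  assert (Hw' : 0 <= rho * ((k + rho) / (1 - rho))).
  { apply Rmult_le_pos; [lra|]. apply Rmult_le_pos; [lra|left; apply Rinv_0_lt_compat; lra]. }
  assert (EW : (k + rho) * (rho / (1 - rho)) = rho * ((k + rho) / (1 - rho))) by (field; lra).
  rewrite EW in Hcond.
  assert (HW2 : 0 <= rho * ((k + rho) / (1 - rho)) * (1 + s) ^ 2) by (apply Rmult_le_pos; [exact Hw'|apply pow2_ge_0]).
  pose proof (first_terms_le A s u (Cmod (w m z)) (Cmod (w q z)) (Cmod (h (w m z))) (Cmod (C_derive h (w m z)))) as HF.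
  pose proof (majorant_le_1 A s u (rho * ((k + rho) / (1 - rho))) HA Hs Hw' Hcond) as HM.
  destruct (schwarz_pick h Hh Hlt (w m z) Hwm) as [HP _].
  pose proof (schwarz_pick_growth h Hh Hlt (w m z) Hwm) as HG. rewrite EA in HG.
  pose proof (Hlt _ Hwm).
  specialize (HF HA (conj (Cmod_ge_0 _) (Hwj m Hm)) (proj2 Hs) (conj (Cmod_ge_0 _) (Hwj q Hq)) ltac:(lra)
                (conj (Cmod_ge_0 _) (Hle _ Hwm)) (Cmod_ge_0 _) HG HP).
  replace ((1 - A * A) * (rho * ((k + rho) / (1 - rho)))) with
    ((1 - A * A) * (rho * rho / (1 - rho)) + (1 - A * A) * (k * (rho / (1 - rho)))) in HM by (field; lra).
  lra.
Qed.

(** * The extremal functions *)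

Lemma class_Bj_pow : forall j, class_Bj j (fun z => z ^ j)%C.
Proof.
  intro j. split; [split|].
  - apply analytic_at_on_disk. intros z _. apply analytic_at_pow.
  - apply sup_norm_le_1. intros z Hz. rewrite Cmod_pow, <- (pow1 j).
    apply pow_incr. split; [apply Cmod_ge_0|lra].
  - assert (HS : has_series (PS_incr_n (V := C_NormedModule) one_coef j) 1 (fun z => z ^ j)%C).
    { split; [lra|]. intros z Hz. replace (z ^ j)%C with (z ^ j * 1)%C by ring. rewrite <- pow_n_Cpow.
      apply (is_pseries_incr_n (K := C_AbsRing) (V := C_NormedModule)).
      now apply (has_series_one 1 Rlt_0_1). }
    split.
    + intros i Hi. apply (derive_n_at_0 i _ _ _ HS). rewrite PS_incr_n_simplify.
      destruct (Compare_dec.le_lt_dec j i); [lia|reflexivity].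
    + intro H. apply (derive_n_at_0 j _ _ _ HS) in H. rewrite PS_incr_n_simplify in H.
      destruct (Compare_dec.le_lt_dec j j); [|lia]. rewrite Nat.sub_diag in H. exact (C1_nz H).
Qed.

Lemma is_Cpseries_geometric : forall w z : C, Cmod (w * z)%C < 1 ->
  is_Cpseries (fun n => w ^ n)%C z (/ (1 - w * z))%C.
Proof.
  intros w z Hwz. apply is_Cpseries_series, is_Cseries_eps. intros eps He.
  set (v := (w * z)%C) in *.
  assert (Hv : (1 - v)%C <> RtoC 0).
  { apply Cmod_gt_0. pose proof (Cmod_triangle_rev 1 v) as HT. rewrite Cmod_1 in HT. lra. }
  pose proof (proj1 (Cmod_gt_0 _) Hv) as Hv0.
  destruct (pow_lt_1_zero (Cmod v) ltac:(rewrite Rabs_pos_eq; [exact Hwz|apply Cmod_ge_0]) (eps * Cmod (1 - v)%C)) as [N HN].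
  { now apply Rmult_lt_0_compat. }
  exists N. intros n Hn.
  rewrite (sum_n_ext _ (fun k => v ^ k)%C) by (intro k; unfold v; rewrite Cpow_mult_l; reflexivity).
  pose proof (geometric_sum v n) as HG.
  replace (sum_n (fun k => v ^ k)%C n - / (1 - v))%C with (- (v ^ S n) / (1 - v))%C.
  - rewrite Cmod_div, Cmod_opp, Cmod_pow by exact Hv.
    specialize (HN (S n) ltac:(lia)). apply Rabs_def2 in HN.
    apply (Rmult_lt_reg_r (Cmod (1 - v)%C)); [exact Hv0|]. unfold Rdiv. rewrite Rmult_assoc, Rinv_l by lra. lra.
  - replace (v ^ S n)%C with ((v - 1) * sum_n (fun k => v ^ k)%C n + 1)%C by (rewrite HG; ring).
    field. exact Hv.
Qed.

Lemma affine_denominator_nz : forall a, 0 < a < 1 -> forall z : C, Cmod z < 1 -> (1 + a * z)%C <> RtoC 0.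
Proof.
  intros a Ha z Hz. apply Cmod_gt_0.
  pose proof (Cmod_triangle_rev 1 (- (a * z))%C) as HT.
  replace (1 - - (a * z))%C with (1 + a * z)%C in HT by ring.
  rewrite Cmod_1, Cmod_opp, Cmod_mult, Cmod_R, Rabs_pos_eq in HT by lra.
  pose proof (Cmod_ge_0 z). nra.
Qed.

Lemma analytic_at_inv_affine : forall a, 0 < a < 1 -> forall z, Cmod z < 1 -> analytic_at (fun y => / (1 + a * y))%C z.
Proof.
  intros a Ha z Hz. pose proof (affine_denominator_nz a Ha z Hz) as Hnz.
  pose proof (proj1 (Cmod_gt_0 _) Hnz) as Hpos.
  set (D := (1 + a * z)%C) in *.
  exists (PS_scal (K := C_AbsRing) (V := C_NormedModule) (/ D)%C (fun n => (- (a / D)) ^ n)%C), (Cmod D / a).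
  split; [apply Rdiv_lt_0_compat; lra|]. intros h Hh.
  assert (Hsmall : Cmod (- (a / D) * h)%C < 1).
  { rewrite Cmod_mult, Cmod_opp, Cmod_div, Cmod_R, Rabs_pos_eq by (exact Hnz || lra).
    apply Rlt_le_trans with (a / Cmod D * (Cmod D / a)).
    - apply Rmult_lt_compat_l; [apply Rdiv_lt_0_compat; lra|exact Hh].
    - right. field. lra. }
  assert (Hden : (1 - - (a / D) * h)%C <> RtoC 0).
  { apply Cmod_gt_0. pose proof (Cmod_triangle_rev 1 (- (a / D) * h)%C) as HT. rewrite Cmod_1 in HT. lra. }
  assert (Hsum : (1 + a * (z + h))%C = (D * (1 - - (a / D) * h))%C) by (unfold D; field; exact Hnz).
  replace (/ (1 + a * (z + h)))%C with (/ D * / (1 - - (a / D) * h))%C.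
  - apply (is_pseries_scal (K := C_AbsRing) (V := C_NormedModule)); [apply Cmult_comm|].
    now apply is_Cpseries_geometric.
  - rewrite Hsum. set (t := (1 - - (a / D) * h)%C) in *. field. split; assumption.
Qed.

(** The disk automorphism [(a + z) / (1 + a z)], written in the form that gives its
    expansion at once. *)
Definition extremal_h (a : R) (z : C) : C := (a + (1 - a * a) * (z * / (1 + a * z)))%C.

Definition extremal_coef (a : R) (n : nat) : C :=
  match n with O => RtoC a | S n => ((1 - a * a) * (- a) ^ n)%C end.

Lemma extremal_h_eq : forall a, 0 < a < 1 -> forall z, Cmod z < 1 -> extremal_h a z = ((a + z) / (1 + a * z))%C.
Proof.
  intros a Ha z Hz. unfold extremal_h. field. now apply (affine_denominator_nz a Ha).
Qed.

Lemma extremal_h_analytic : forall a, 0 < a < 1 -> forall z, Cmod z < 1 -> analytic_at (extremal_h a) z.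
Proof.
  intros a Ha z Hz. unfold extremal_h.
  apply (analytic_at_plus (fun _ => RtoC a)); [apply analytic_at_const|].
  apply analytic_at_scal, analytic_at_mult_id. now apply (analytic_at_inv_affine a Ha).
Qed.

Lemma extremal_h_le_1 : forall a, 0 < a < 1 -> forall z, Cmod z < 1 -> Cmod (extremal_h a z) <= 1.
Proof.
  intros a Ha z Hz. rewrite (extremal_h_eq a Ha) by exact Hz.
  pose proof (affine_denominator_nz a Ha z Hz) as Hnz.
  rewrite Cmod_div by exact Hnz. pose proof (proj1 (Cmod_gt_0 _) Hnz).
  apply (Rmult_le_reg_r (Cmod (1 + a * z)%C)); [assumption|].
  unfold Rdiv. rewrite Rmult_assoc, Rinv_l by lra. rewrite Rmult_1_r, Rmult_1_l.
  pose proof (blaschke_le (RtoC (- a)) z) as HB.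
  rewrite Cmod_R, Rabs_left in HB by lra. specialize (HB ltac:(lra) ltac:(lra)).
  rewrite RtoC_opp in HB. replace (z - - a)%C with (a + z)%C in HB by ring.
  replace (1 - Cconj (- a) * z)%C with (1 + a * z)%C in HB; [exact HB|].
  apply injective_projections; destruct z; simpl; ring.
Qed.

Lemma extremal_h_series : forall a, 0 < a < 1 -> has_series (extremal_coef a) 1 (extremal_h a).
Proof.
  intros a Ha. split; [lra|]. intros z Hz.
  assert (Hsmall : Cmod (- a * z)%C < 1).
  { rewrite Cmod_mult, Cmod_opp, Cmod_R, Rabs_pos_eq by lra. pose proof (Cmod_ge_0 z). nra. }
  pose proof (is_Cpseries_geometric (- a)%C z Hsmall) as HG.
  replace (1 - - a * z)%C with (1 + a * z)%C in HG by ring.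
  unfold extremal_h. replace (RtoC a) with (RtoC a * 1)%C at 1 by ring.
  apply (is_pseries_ext (K := C_AbsRing) (V := C_NormedModule)
     (PS_plus (PS_scal (RtoC a) one_coef) (PS_scal (1 - a * a)%C (PS_incr_1 (fun n => (- a) ^ n)%C)))).
  - intros [|n].
    + change ((a * 1 + (1 - a * a) * 0)%C = RtoC a). ring.
    + change ((a * 0 + (1 - a * a) * (- a) ^ n)%C = ((1 - a * a) * (- a) ^ n)%C). ring.
  - apply (is_pseries_plus (K := C_AbsRing) (V := C_NormedModule));
      apply (is_pseries_scal (K := C_AbsRing) (V := C_NormedModule)); try apply Cmult_comm.
    + now apply (has_series_one 1 Rlt_0_1).
    + now apply (is_pseries_incr_1 (K := C_AbsRing) (V := C_NormedModule)).
Qed.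

(** The difference quotient of [extremal_h] between [z0] and [z]. *)
Definition extremal_slope (a : R) (z0 z : C) : C := ((1 - a * a) / (1 + a * z0) * / (1 + a * z))%C.

Lemma extremal_h_difference : forall a, 0 < a < 1 -> forall z0 z, Cmod z0 < 1 -> Cmod z < 1 ->
  extremal_h a z = (extremal_h a z0 + (z - z0) * extremal_slope a z0 z)%C.
Proof.
  intros a Ha z0 z Hz0 Hz. unfold extremal_h, extremal_slope. field.
  split; now apply (affine_denominator_nz a Ha).
Qed.

Lemma extremal_slope_analytic : forall a, 0 < a < 1 -> forall z0, Cmod z0 < 1 -> analytic_at (extremal_slope a z0) z0.
Proof. intros a Ha z0 Hz0. apply analytic_at_scal. now apply (analytic_at_inv_affine a Ha). Qed.

Lemma extremal_derivatives : forall a, 0 < a < 1 -> forall (k : R) z, Cmod z < 1 ->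
  C_derive (extremal_h a) z = extremal_slope a z z /\
  C_derive (fun y => k * (extremal_h a y - a))%C z = (k * extremal_slope a z z)%C.
Proof.
  intros a Ha k z Hz.
  assert (Hin : forall y, Cmod (y - z) < 1 - Cmod z -> Cmod y < 1).
  { intros y Hy. pose proof (Cmod_triangle_rev y z). lra. }
  split.
  - apply (C_derive_factor _ (extremal_slope a z) z (1 - Cmod z)); [lra|now apply (extremal_slope_analytic a Ha)|].
    intros y Hy. apply (extremal_h_difference a Ha); [exact Hz|now apply Hin].
  - apply (C_derive_factor _ (fun y => k * extremal_slope a z y)%C z (1 - Cmod z)); [lra| |].
    + now apply analytic_at_scal, (extremal_slope_analytic a Ha).
    + intros y Hy. rewrite (extremal_h_difference a Ha z y) by (try exact Hz; now apply Hin). ring.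
Qed.

Lemma extremal_slope_nz : forall a, 0 < a < 1 -> forall z, Cmod z < 1 -> extremal_slope a z z <> RtoC 0.
Proof.
  intros a Ha z Hz. pose proof (affine_denominator_nz a Ha z Hz) as Hnz. unfold extremal_slope.
  replace ((1 - a * a) / (1 + a * z) * / (1 + a * z))%C with ((1 - a * a) * (/ (1 + a * z) * / (1 + a * z)))%C
    by (field; exact Hnz).
  apply Cmult_neq_0.
  - rewrite <- RtoC_mult, <- RtoC_minus. intro E. apply RtoC_inj in E. nra.
  - apply Cmult_neq_0; apply Cmod_gt_0; rewrite Cmod_inv by exact Hnz; apply Rinv_0_lt_compat; now apply Cmod_gt_0.
Qed.

Lemma Cmod_extremal_h : forall a, 0 < a < 1 -> forall s, 0 <= s < 1 -> Cmod (extremal_h a (RtoC s)) = (a + s) / (1 + a * s).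
Proof.
  intros a Ha s Hs. assert (0 <= a * s) by nra.
  rewrite (extremal_h_eq a Ha) by (rewrite Cmod_R, Rabs_pos_eq; lra).
  rewrite <- RtoC_mult, <- !RtoC_plus, <- RtoC_div by lra.
  rewrite Cmod_R, Rabs_pos_eq; [reflexivity|].
  apply Rmult_le_pos; [lra|left; apply Rinv_0_lt_compat; lra].
Qed.

Lemma Cmod_extremal_slope : forall a, 0 < a < 1 -> forall s, 0 <= s < 1 ->
  Cmod (extremal_slope a (RtoC s) (RtoC s)) = (1 - a * a) / (1 + a * s) ^ 2.
Proof.
  intros a Ha s Hs. assert (0 <= a * s) by nra. unfold extremal_slope.
  rewrite <- !RtoC_mult, <- RtoC_minus, <- RtoC_plus, <- RtoC_div, <- RtoC_inv, <- RtoC_mult by lra.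
  rewrite Cmod_R, Rabs_pos_eq; [field; lra|].
  repeat apply Rmult_le_pos; try nra; left; apply Rinv_0_lt_compat; lra.
Qed.

Lemma Cmod_extremal_coef : forall a, 0 < a < 1 -> forall n, Cmod (extremal_coef a (S n)) = (1 - a * a) * a ^ n.
Proof.
  intros a Ha n. simpl extremal_coef. rewrite <- RtoC_mult, <- RtoC_minus, Cmod_mult, Cmod_pow, Cmod_opp, !Cmod_R.
  rewrite !Rabs_pos_eq by nra. reflexivity.
Qed.

(** The signs of the coefficients of [extremal_h] disappear in the moduli, which makes
    both sums geometric series with ratio [a r^p]. *)
Lemma extremal_bohr_sum : forall a, 0 < a < 1 -> forall m p q k r,
  (1 <= m)%nat -> (1 <= p)%nat -> (1 <= q)%nat -> 0 <= k -> 0 < r < 1 ->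
  bohr_sum (extremal_h a) (extremal_coef a) (fun n => match n with O => RtoC 0 | S _ => k * extremal_coef a n end)%C
    (fun j z => z ^ j)%C m p q (RtoC r)
  = Finite ((a + r ^ m) / (1 + a * r ^ m) + (1 - a * a) / (1 + a * r ^ m) ^ 2 * r ^ q
      + (1 - a * a) * a * (r ^ p * r ^ p) / (1 - a * r ^ p)
      + k * (1 - a * a) * r ^ p / (1 - a * r ^ p)).
Proof.
  intros a Ha m p q k r Hm Hp Hq Hk Hr.
  pose proof (pow_unit r m Hr Hm). pose proof (pow_unit r p Hr Hp). pose proof (pow_unit r q Hr Hq).
  assert (Hap : 0 <= a * r ^ p < 1) by nra.
  unfold bohr_sum. rewrite <- !RtoC_pow.
  destruct (extremal_derivatives a Ha k (RtoC (r ^ m))) as [-> _].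
  { rewrite Cmod_R, Rabs_pos_eq; lra. }
  rewrite (Cmod_extremal_h a Ha), (Cmod_extremal_slope a Ha), !Cmod_R, !Rabs_pos_eq by lra.
  rewrite !sum_from_shift.
  set (rho := r ^ p) in *.
  assert (E1 : Lim_seq (sum_n (fun j => Cmod (extremal_coef a (2 + j)) * rho ^ (2 + j)))
     = Finite ((1 - a * a) * a * (rho * rho) / (1 - a * rho))).
  { apply is_lim_seq_unique.
    apply (is_series_ext (fun j => (1 - a * a) * a * (rho * rho) * (a * rho) ^ j)); [|now apply is_series_geom_scal].
    intro j. change (2 + j)%nat with (S (S j)). rewrite (Cmod_extremal_coef a Ha), Rpow_mult_distr. simpl. Rring. }
  assert (E2 : Lim_seq (sum_n (fun j => Cmod (match (1 + j)%nat with O => RtoC 0 | S _ => k * extremal_coef a (1 + j) end)%C * rho ^ (1 + j)))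
     = Finite (k * (1 - a * a) * rho / (1 - a * rho))).
  { apply is_lim_seq_unique.
    apply (is_series_ext (fun j => k * (1 - a * a) * rho * (a * rho) ^ j)); [|now apply is_series_geom_scal].
    intro j. change (1 + j)%nat with (S j). cbv iota. rewrite Cmod_mult, (Cmod_extremal_coef a Ha), Cmod_R, Rabs_pos_eq, Rpow_mult_distr by exact Hk.
    simpl. Rring. }
  rewrite E1, E2. reflexivity.
Qed.


Lemma near_1_positive : forall f : R -> R, continuity f -> 0 < f 1 -> exists a, 0 < a < 1 /\ 0 < f a.
Proof.
  intros f Hf H1. destruct (Hf 1 (f 1) H1) as [d [Hd H]].
  set (t := Rmin (1 / 2) (d / 2)).
  assert (Ht : 0 < t /\ t <= 1 / 2 /\ t < d).
  { unfold t. pose proof (Rmin_l (1 / 2) (d / 2)). pose proof (Rmin_r (1 / 2) (d / 2)).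
    split; [apply Rmin_pos; lra|lra]. }
  exists (1 - t). split; [lra|].
  assert (HR : R_dist (f (1 - t)) (f 1) < f 1).
  { apply H. split; [split; [exact I|lra]|]. simpl. unfold R_dist.
    replace (1 - t - 1) with (- t) by ring. rewrite Rabs_Ropp, Rabs_pos_eq; lra. }
  unfold R_dist in HR. apply Rabs_def2 in HR. lra.
Qed.

(** The excess of the Bohr sum over 1 is [1 - a] times a function of [a] that is continuous
    at [a = 1], where it is a positive multiple of the radius function. *)
Lemma bohr_radius_sharp : forall m p q k r,
  (1 <= m)%nat -> (1 <= p)%nat -> (1 <= q)%nat -> 0 <= k -> 0 < r < 1 ->
  0 < radius_fun m p q k r ->
  exists a, 0 < a < 1 /\
    1 < (a + r ^ m) / (1 + a * r ^ m) + (1 - a * a) / (1 + a * r ^ m) ^ 2 * r ^ q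
      + (1 - a * a) * a * (r ^ p * r ^ p) / (1 - a * r ^ p)
      + k * (1 - a * a) * r ^ p / (1 - a * r ^ p).
Proof.
  intros m p q k r Hm Hp Hq Hk Hr Hpos.
  pose proof (pow_unit r m Hr Hm). pose proof (pow_unit r p Hr Hp).
  assert (HP : 0 < radius_poly m p q k r).
  { rewrite radius_poly_fun by assumption. apply Rmult_lt_0_compat; lra. }
  unfold radius_poly in HP. rewrite pow_double in HP.
  set (s := r ^ m) in *. set (rho := r ^ p) in *. set (u := r ^ q) in *.
  (* The excess divided by [1 - a], cleared of denominators. *)
  destruct (near_1_positive (fun a => (1 - a * rho) * ((1 + a) * u - (1 - s) * (1 + a * s))
       + (1 + a) * ((k + a * rho) * rho * (1 + a * s) ^ 2))) as [a [Ha Hfa]].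
  - intro x. reg.
  - replace ((1 - 1 * rho) * ((1 + 1) * u - (1 - s) * (1 + 1 * s)) + (1 + 1) * ((k + 1 * rho) * rho * (1 + 1 * s) ^ 2))
      with ((1 - rho) * (2 * u - (1 - s * s)) + 2 * ((k + rho) * rho * (1 + s) ^ 2)) by ring. exact HP.
  - exists a. split; [exact Ha|].
    assert (0 <= a * s) by nra. assert (a * rho < 1) by nra.
    match goal with |- 1 < ?t => assert (E : t - 1 = (1 - a) * ((1 - a * rho) * ((1 + a) * u - (1 - s) * (1 + a * s))
       + (1 + a) * ((k + a * rho) * rho * (1 + a * s) ^ 2)) / ((1 + a * s) ^ 2 * (1 - a * rho))) end.
    { field. lra. }
    match type of E with ?t - 1 = ?v => assert (0 < v); [|lra] end.
    apply Rdiv_lt_0_compat.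
    + apply Rmult_lt_0_compat; lra.
    + apply Rmult_lt_0_compat; [apply pow_lt|]; lra.
Qed.

Theorem theorem3p2 :
  forall (K : R) (m p q : nat),
    1 <= K -> (1 <= m)%nat -> (1 <= p)%nat -> (1 <= q)%nat ->
    exists Rmq rmpqk : R,
      unique (fun r => 0 < r < 1 /\ eqn_R m q r) Rmq /\
      smallest_positive_root (eqn_r m p q (dilatation_bound K)) rmpqk /\
      rmpqk <= Rmq /\
      (forall (f h g : C -> C) (a b : nat -> C) (w : nat -> C -> C),
         quasiconformal_harmonic K f h g ->
         disk_expansion h g a b ->
         Rbar_le (sup_norm h) 1 ->
         (forall j : nat, (1 <= j)%nat -> class_Bj j (w j)) ->
         forall z : C, Cmod z <= rmpqk ->
           Rbar_le (bohr_sum h a b w m p q z) 1) /\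
      (forall rho : R, rmpqk < rho < 1 ->
         exists (f h g : C -> C) (a b : nat -> C) (w : nat -> C -> C) (z : C),
           quasiconformal_harmonic K f h g /\
           disk_expansion h g a b /\
           Rbar_le (sup_norm h) 1 /\
           (forall j : nat, (1 <= j)%nat -> class_Bj j (w j)) /\
           Cmod z <= rho /\
           ~ Rbar_le (bohr_sum h a b w m p q z) 1).
Proof.
  intros K m p q HK Hm Hp Hq.
  set (k := dilatation_bound K).
  assert (Hk : 0 <= k < 1).
  { unfold k, dilatation_bound. split.
    - apply Rmult_le_pos; [lra|left; apply Rinv_0_lt_compat; lra].
    - apply (Rmult_lt_reg_r (K + 1)); [lra|]. unfold Rdiv. rewrite Rmult_assoc, Rinv_l; lra. }
  destruct (eqn_R_unique_root m q Hm Hq) as [R0 [HR0 HR0le]].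
  destruct (radius_root m p q k Hm Hp Hq (proj1 Hk)) as [r0 [Hr0 Hroot]].
  exists R0, r0. split; [exact HR0|]. split; [|split; [|split]].
  - split; [exact Hr0|]. split; [now apply eqn_r_radius_fun|].
    intros s Hs Es. apply (eqn_r_radius_fun m p q k s Hp Hs) in Es.
    apply Rnot_lt_le. intro Hlt.
    pose proof (radius_fun_increasing m p q k s r0 Hp Hq (proj1 Hk) ltac:(lra) Hlt ltac:(lra)). lra.
  - apply HR0le; [exact Hr0|]. unfold radius_fun in Hroot.
    pose proof (pow_unit r0 p Hr0 Hp).
    assert (0 <= (k + r0 ^ p) * (r0 ^ p / (1 - r0 ^ p)) * (1 + r0 ^ m) ^ 2).
    { apply Rmult_le_pos; [|apply pow2_ge_0]. apply Rmult_le_pos; [lra|].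
      apply Rmult_le_pos; [lra|left; apply Rinv_0_lt_compat; lra]. }
    lra.
  - intros f h g a b w [[Hh [Hg _]] [Hsp Hdil]] Hexp Hsup Hw z Hz.
    assert (Hd : forall z, Cmod z < 1 -> C_derive h z <> RtoC 0).
    { intros y Hy E. specialize (Hsp y Hy). rewrite E, Cmod_0 in Hsp.
      pose proof (pow2_ge_0 (Cmod (C_derive g y))). lra. }
    apply (bohr_inequality m p q k h g a b w r0); try assumption; [lra|now apply sup_norm_le_1|].
    intros y Hy. specialize (Hdil y Hy). pose proof (Hd y Hy) as Hdy.
    rewrite Cmod_div in Hdil by exact Hdy. apply Cmod_gt_0 in Hdy.
    apply (Rmult_le_compat_r (Cmod (C_derive h y))) in Hdil; [|lra].
    unfold Rdiv in Hdil. rewrite Rmult_assoc, Rinv_l in Hdil by lra. fold k in Hdil. lra.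
  - intros rho Hrho.
    pose proof (radius_fun_increasing m p q k r0 rho Hp Hq (proj1 Hk) ltac:(lra) ltac:(lra) ltac:(lra)) as Hinc.
    destruct (bohr_radius_sharp m p q k rho Hm Hp Hq (proj1 Hk) ltac:(lra) ltac:(lra)) as [a [Ha Hgt]].
    set (g := fun z => (k * (extremal_h a z - a))%C).
    exists (fun z => (extremal_h a z + Cconj (g z))%C), (extremal_h a), g, (extremal_coef a),
      (fun n => match n with O => RtoC 0 | S _ => k * extremal_coef a n end)%C, (fun j z => z ^ j)%C, (RtoC rho).
    assert (HD : forall z, Cmod z < 1 -> C_derive (extremal_h a) z = extremal_slope a z z /\
                    C_derive g z = (k * extremal_slope a z z)%C /\ extremal_slope a z z <> RtoC 0).
    { intros z Hz. destruct (extremal_derivatives a Ha k z Hz) as [E1 E2].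
      split; [exact E1|]. split; [exact E2|]. now apply extremal_slope_nz. }
    split; [split; [split; [|split]|split]|].
    + apply analytic_at_on_disk. now apply extremal_h_analytic.
    + apply analytic_at_on_disk. intros z Hz. unfold g.
      apply analytic_at_scal, analytic_at_minus_const. now apply extremal_h_analytic.
    + reflexivity.
    + intros z Hz. destruct (HD z Hz) as [-> [-> Hnz]]. apply Cmod_gt_0 in Hnz.
      rewrite Cmod_mult, Cmod_R, Rabs_pos_eq by lra.
      set (x := Cmod (extremal_slope a z z)) in *.
      replace (x ^ 2 - (k * x) ^ 2) with ((1 - k * k) * (x * x)) by ring.
      apply Rmult_lt_0_compat; nra.
    + intros z Hz. destruct (HD z Hz) as [-> [-> Hnz]].
      replace (k * extremal_slope a z z / extremal_slope a z z)%C with (RtoC k) by (field; exact Hnz).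
      rewrite Cmod_R, Rabs_pos_eq; [apply Rle_refl|lra].
    + split; [|split; [|split; [|split]]].
      * split; [reflexivity|]. intros z Hz. split; [now apply (extremal_h_series a Ha)|].
        unfold g.
        apply (is_pseries_ext (K := C_AbsRing) (V := C_NormedModule)
          (PS_scal (RtoC k) (fun n => match n with O => RtoC 0 | S _ => extremal_coef a n end))).
        -- intros [|n]; [|reflexivity]. change ((k * 0)%C = RtoC 0). ring.
        -- apply (is_pseries_scal (K := C_AbsRing) (V := C_NormedModule)); [apply Cmult_comm|].
           now apply (has_series_minus_const (extremal_coef a) 1 (extremal_h a) (extremal_h_series a Ha)).
      * apply sup_norm_le_1. now apply extremal_h_le_1.
      * intros j _. apply class_Bj_pow.
      * rewrite Cmod_R, Rabs_pos_eq; lra.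
      * rewrite (extremal_bohr_sum a Ha) by (assumption || lra). exact (Rlt_not_le _ _ Hgt).
Qed.
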